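(* Let $\gamma\in(0,1]$. Let $\{X_{n,j}\}_{j\ge 1}$, $n=1,2,\ldots$, be a double array of row-wise independent and identically distributed random variables, and let $\{N_n\}_{n\ge 1}$ be a sequence of nonnegative integer-valued random variables such that for each $n\ge 1$ the random variables $N_n,X_{n,1},X_{n,2},\ldots$ are independent. Put $S_{n,k}=X_{n,1}+\ldots+X_{n,k}$ (with $S_{n,0}=0$). Assume that there exist a sequence of natural numbers $\{k_n\}_{n\ge 1}$ and numbers $\mu\in\mathbb R$ and $\sigma>0$ such that $$\mathsf P\big(S_{n,k_n}<x\big)\Longrightarrow\Phi\Big(\frac{x-\mu}{\sigma}\Big)\qquad(n\to\infty).$$ Assume that $N_n\to\infty$ in probability. Then the distributions of the random sums $S_{n,N_n}$ converge to the asymmetric two-sided Weibull distribution of the second kind $\mathfrak W_{II}$ with parameters $\mu,\sigma,\gamma$: $$\mathsf P\big(S_{n,N_n}<x\big)\Longrightarrow\mathfrak W_{II}(x)\qquad(n\to\infty),$$ if and only if $$\mathsf P(N_n<xk_n)\Longrightarrow H_{\gamma}(x)\qquad(n\to\infty).$$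
   Context: $\Longrightarrow$ denotes convergence in distribution (weak convergence of distribution functions); $\Phi$ is the standard normal distribution function. For $\gamma\in(0,1)$, $S_{\gamma,1}$ is a positive random variable with the one-sided strictly stable distribution with characteristic exponent $\gamma$, normalized so that $\mathsf E e^{-sS_{\gamma,1}}=e^{-(2s)^\gamma}$ for $s\ge 0$; for $\gamma=1$ this means $S_{1,1}=2$ almost surely. $G_{\gamma,1}$ is its distribution function. The distribution function $H_\gamma$ is $$H_\gamma(y)=1-\int_0^\infty\exp\{-\tfrac18yz^2\}\,dG_{\gamma,1}(z),\ y\ge 0,\qquad H_\gamma(y)=0,\ y<0.$$ For $\mu\in\mathbb R$, $\sigma>0$, $\gamma\in(0,1]$, the asymmetric (two-sided) Weibull distribution of the second kind with parameters $\mu,\sigma,\gamma$ is the distribution function $$\mathfrak W_{II}(x)=\int_0^\infty\Phi\Big(\frac{x-\mu z}{\sigma\sqrt z}\Big)\,dH_\gamma(z),\qquad x\in\mathbb R.$$ *)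

(* Defs.v *)
From HB Require Import structures.
From mathcomp Require Import all_boot all_order all_algebra.
From mathcomp Require Import all_classical all_reals all_analysis.
From mathcomp Require Import measurable_realfun.

Set Implicit Arguments.
Unset Strict Implicit.
Unset Printing Implicit Defensive.
Import Order.TTheory GRing.Theory Num.Theory.
Import numFieldNormedType.Exports.
Local Open Scope classical_set_scope.
Local Open Scope ring_scope.

(* Weak convergence of distribution functions: pointwise convergence at every
   continuity point of the limit.  In this form it does not matter whether
   distribution functions are taken left- or right-continuous. *)
Definition weakly_cvg (R : realType) (F : nat -> R -> R) (G : R -> R) : Prop :=
  forall x : R, {for x, continuous G} -> F n x @[n --> \oo] --> G x.

(* Left-continuous convention: x |-> P(Y < x). *)
Definition dist_fun (d : measure_display) (T : measurableType d) (R : realType)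
    (P : probability T R) (Y : T -> R) (x : R) : R :=
  fine (P [set w | Y w < x]).

Definition Phi (R : realType) (x : R) : R :=
  fine (normal_prob (0 : R) 1 `]-oo, x]).

Section independence.
Context (d : measure_display) (T : measurableType d) (R : realType).
Variable P : probability T R.

Definition mutually_independent (I : choiceType) (F : I -> set (set T)) : Prop :=
  forall (s : seq I) (E : I -> set T), uniq s ->
    (forall i, i \in s -> F i (E i)) ->
    P (\bigcap_(i in [set` s]) E i) = (\prod_(i <- s) P (E i))%E.

Definition sigma_of (d' : measure_display) (T' : measurableType d')
    (Y : {RV P >-> T'}) : set (set T) :=
  preimage_set_system setT Y measurable.

(* [None] stands for the counting variable, [Some j] for the j-th summand. *)
Definition sigma_family (N : {RV P >-> nat}) (X : nat -> {RV P >-> R})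
    (o : option nat) : set (set T) :=
  if o is Some j then sigma_of (X j) else sigma_of N.

Definition iid (X : nat -> {RV P >-> R}) : Prop :=
  mutually_independent (fun j => sigma_of (X j)) /\
  forall (i j : nat) (A : set R), measurable A ->
    distribution P (X i) A = distribution P (X j) A.

(* Summands are numbered from 0: [X j] is the (j+1)-st one. *)
Definition partial_sum (X : nat -> {RV P >-> R}) (k : nat) (w : T) : R :=
  \sum_(j < k) X j w.

Definition cvg_infty_in_prob (N : nat -> {RV P >-> nat}) : Prop :=
  forall M : nat,
    fine (P [set w | (M < N n w)%N]) @[n --> \oo] --> (1 : R).

End independence.

(* aY + bY' and (a^g + b^g)^(1/g) Y have the same law for independent copies
   Y, Y' with law G, and all a, b > 0. *)
Definition strictly_stable (R : realType) (g : R) (G : probability R R) : Prop :=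
  forall a b : R, 0 < a -> 0 < b ->
  forall A : set R, measurable A ->
    (G \x G)%E [set p | A (a * p.1 + b * p.2)] =
    G [set z | A ((a `^ g + b `^ g) `^ g^-1 * z)].

(* G is the law of S_{g,1}.  For g < 1 the Laplace transform
   E exp(-sS) = exp(-(2s)^g) pins this law down; it degenerates to the point
   mass at 2 for g = 1. *)
Definition one_sided_stable_law (R : realType) (g : R) (G : probability R R) :
    Prop :=
  (g < 1 ->
    [/\ G `]0, +oo[%classic = 1%E,
        strictly_stable g G
      & forall s : R, 0 <= s ->
          (\int[G]_z (expR (- (s * z)))%:E = (expR (- ((2 * s) `^ g)))%:E)%E]) /\
  (g = 1 -> G [set 2] = 1%E).

Section mixing_distribution.
Context (R : realType).
Variable G : probability R R.

(* H_g, when G is the law of S_{g,1}. *)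
Definition Hmix (y : R) : R :=
  if 0 <= y then 1 - \int[G]_(z in `[0, +oo[) expR (- (8^-1 * y * z ^+ 2))
  else 0.

Let f (y z : R) : R := expR (- (8^-1 * y * z ^+ 2)).

Let mf y : measurable_fun setT (f y).
Proof.
apply: measurableT_comp => //; apply: measurableT_comp => //.
apply: measurable_funM => //; exact: measurable_funX.
Qed.

Let f_ge0 y z : 0 <= f y z. Proof. exact: expR_ge0. Qed.

Let f_le1 y z : 0 <= y -> f y z <= 1.
Proof.
move=> y0; rewrite -expR0 ler_expR oppr_le0.
by rewrite mulr_ge0 ?sqr_ge0// mulr_ge0// invr_ge0.
Qed.

Let int1 : G.-integrable `[0, +oo[ (EFin \o (fun=> 1 : R)).
Proof. exact: finite_measure_integrable_cst. Qed.

Let int_f y : 0 <= y -> G.-integrable `[0, +oo[ (EFin \o f y).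
Proof.
move=> y0; apply: (le_integrable _ _ _ int1) => //=.
  by apply/measurable_EFinP; apply: measurable_funTS; exact: mf.
by move=> z _; rewrite lee_fin normr1 ger0_norm// f_le1.
Qed.

Let Hmix_nd : nondecreasing Hmix.
Proof.
move=> x y xy; rewrite /Hmix.
have [x0|x0] := leP 0 x.
  have y0 := le_trans x0 xy.
  rewrite y0 lerD2l lerN2; apply: le_Rintegral => //; try exact: int_f.
  move=> z _; rewrite ler_expR lerN2 ler_wpM2r ?sqr_ge0//.
  by rewrite ler_wpM2l ?invr_ge0.
case: ifPn => // y0; rewrite subr_ge0.
apply: (@le_trans _ _ (\int[G]_(z in `[0, +oo[) 1)).
  apply: le_Rintegral => //; first exact: int_f.
  by move=> z _; exact: f_le1.
rewrite Rintegral_cst// mul1r -lee_fin fineK ?fin_num_measure//.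
exact: probability_le1.
Qed.

Let Hmix_rc : right_continuous Hmix.
Proof.
move=> a; have [a0|a0] := leP 0 a; last first.
  apply: cvg_within_filter.
  rewrite {2}/Hmix leNgt a0/=; apply: cvg_near_cst.
  near=> x; rewrite /Hmix leNgt ifF//; apply/negbF.
  by near: x; exact: lt_nbhsl a0.
pose F y := 1 - \int[G]_(z in `[0, +oo[) f (Num.max y 0) z.
have FH y : 0 <= y -> F y = Hmix y.
  by move=> y0; rewrite /F /Hmix y0 max_l.
rewrite -FH//.
have max0 y : 0 <= Num.max y 0 :> R by rewrite le_max lexx orbT.
apply: (@cvg_trans _ (F x @[x --> a^'+])).
  apply: near_eq_cvg; near=> x; apply: FH; apply: (le_trans a0).
  by near: x; exact: nbhs_right_ge.
apply: cvg_within_filter; apply: cvgB; first exact: cvg_cst.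
apply: (@continuity_under_integral _ _ _ G
  (fun y z => f (Num.max y 0) z) `[0, +oo[ _ (a - 1) (a + 1) _ _ (fun=> 1)) => //.
- by move=> x _; exact: int_f.
- apply: aeW => z _ x _; rewrite /f.
  apply: continuous_comp; last exact: continuous_expR.
  apply: cvgN; apply: cvgM; last exact: cvg_cst.
  apply: cvgM; first exact: cvg_cst.
  by apply: continuous_max => //; exact: cvg_cst.
- by move=> x _; apply: aeW => z _; rewrite ger0_norm// f_le1.
- by rewrite inE/= in_itv/= ltrBlDr !ltrDl ltr01.
Unshelve. all: end_near. Qed.

HB.instance Definition _ := isCumulative.Build R _ R Hmix Hmix_nd Hmix_rc.

(* The asymmetric two-sided Weibull distribution of the second kind, when G is
   the law of S_{g,1}: a Lebesgue-Stieltjes integral.  The point z = 0, where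
   the integrand is undefined, carries no H_g-mass. *)
Definition weibull_II (mu sigma x : R) : R :=
  \int[lebesgue_stieltjes_measure Hmix]_(z in `]0, +oo[)
    Phi ((x - mu * z) / (sigma * Num.sqrt z)).

End mixing_distribution.

(* Main.v *)
(* Write [V_n = N_n / k_n] and let [f_n] be the characteristic function of
   [X_(n,1)], so that the one of the random sum [U_n] at [t] is the mean of
   [f_n(t) ^ N_n].  If [k_n] tends to infinity, asymptotic normality of the row
   sums makes [f_n(t) ^ m] uniformly close to [exp(i mu t v - sigma^2 t^2 v / 2)],
   [v = m / k_n], as long as [v] stays bounded: symmetrization shows that the
   suitably centred summands have characteristic functions within [o(1 / k_n)]
   of reals.  Hence, if [(V_n)] is tight, [U_n] has asymptotically the
   characteristic function of [mu V_n + sigma sqrt(V_n) Z], where [Z] is standard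
   normal and independent of [V_n].  Either side of the equivalence gives
   tightness: a large [V_n] makes [|f_n| ^ N_n] small, which spreads [U_n] out.
   As [N_n] tends to infinity, tightness in turn forces [k_n] to do so.

   It remains to compare the laws of [V] and of [W = mu V + sigma sqrt(V) Z].
   From [V] to [W] this is the continuity theorem.  Conversely, a Gaussian shift
   turns [E exp(- mu W / sigma^2) cos(t W)] into
   [E exp(- (mu^2 / sigma^2 + sigma^2 t^2) V / 2)], so the law of [W] yields the
   Laplace transform of [V] on a half-line, hence all the moments of some
   bounded variable [exp(- s V)].  Characteristic functions are handled through
   their real and imaginary parts. *)

(* The limit of f_n(t) ^ k_n determines the size of 1 - |f_n(t)|, but the argument of f_n(t) only
   modulo 2 pi / k_n, and the summands come with no moments. Hence a detour: the modulus, taken at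
   all frequencies, controls truncated moments of the symmetrized summand; these provide a centre
   c_n, about which the phase is o(1 / k_n); and k_n c_n is found to tend to mu by comparison with
   the given limit at every t.

   In the converse direction the obstacle is that the characteristic function of W at t is the
   Laplace transform of V at the complex point sigma^2 t^2 / 2 - i mu t. For nonzero mu these points
   run along a parabola, from which V would have to be recovered by analytic continuation. The tilt
   exp(- mu W / sigma^2) moves them onto the half-line from mu^2 / (2 sigma^2) to infinity. Being
   unbounded, it is used with a Gaussian cut-off, whose removal costs an error uniform only for
   bounded V.

   Both passages from transforms to distribution functions rest on the polynomials 1 - (1 - x^p)^q,
   which approximate indicators of half-lines on [0, 1]. *)
Require Import Defs.
From HB Require Import structures.
From mathcomp Require Import all_boot all_order all_algebra.
From mathcomp Require Import all_classical all_reals all_analysis.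
From mathcomp Require Import ring lra zify measurable_realfun.
Set Implicit Arguments.
Unset Strict Implicit.
Unset Printing Implicit Defensive.
Import Order.TTheory GRing.Theory Num.Theory.
Import numFieldNormedType.Exports.
Local Open Scope classical_set_scope.
Local Open Scope ring_scope.

(** * Means of bounded functions *)

Section bounded_mfun.
Context {d : measure_display} {T : measurableType d} {R : realType}.
Implicit Types f g : T -> R.

(** Such functions are integrable for every probability at once, so the rules for means below carry
    no integrability condition tied to a measure. *)
Definition bounded_mfun f :=
  measurable_fun setT f /\ exists C : R, forall x, `|f x| <= C.

Lemma bounded_mfun_cst (c : R) : bounded_mfun (fun=> c).
Proof. by split => //; exists `|c|. Qed.

Lemma bounded_mfunD f g : bounded_mfun f -> bounded_mfun g ->
  bounded_mfun (fun x => f x + g x).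
Proof.
move=> [mf [C fC]] [mg [D gD]]; split; first exact: measurable_funD.
by exists (C + D) => x; rewrite (le_trans (ler_normD _ _))// lerD.
Qed.

Lemma bounded_mfunN f : bounded_mfun f ->
  bounded_mfun (fun x => - f x).
Proof.
move=> [mf [C fC]]; split; first exact: measurableT_comp.
by exists C => x; rewrite normrN.
Qed.

Lemma bounded_mfunB f g : bounded_mfun f -> bounded_mfun g ->
  bounded_mfun (fun x => f x - g x).
Proof.
by move=> bf bg; apply: bounded_mfunD => //; exact: bounded_mfunN.
Qed.

Lemma bounded_mfunM f g : bounded_mfun f -> bounded_mfun g ->
  bounded_mfun (fun x => f x * g x).
Proof.
move=> [mf [C fC]] [mg [D gD]]; split; first exact: measurable_funM.
by exists (C * D) => x; rewrite normrM ler_pM.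
Qed.

Lemma bounded_mfunX f n : bounded_mfun f ->
  bounded_mfun (fun x => f x ^+ n).
Proof.
move=> bf; elim: n => [|n ih].
  by under eq_fun do rewrite expr0; exact: bounded_mfun_cst.
by under eq_fun do rewrite exprS; exact: bounded_mfunM.
Qed.

Lemma bounded_mfun_norm f : bounded_mfun f ->
  bounded_mfun (fun x => `|f x|).
Proof.
move=> [mf [C fC]]; split; first exact: measurableT_comp.
by exists C => x; rewrite normr_id.
Qed.

Lemma bounded_mfun_sum (I : Type) (s : seq I) (F : I -> T -> R) :
  (forall i, bounded_mfun (F i)) ->
  bounded_mfun (fun x => \sum_(i <- s) F i x).
Proof.
move=> bF; elim: s => [|i s ih].
  by under eq_fun do rewrite big_nil; exact: bounded_mfun_cst.
by under eq_fun do rewrite big_cons; exact: bounded_mfunD.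
Qed.

Lemma measurable_cos : measurable_fun setT (@cos R).
Proof. by apply: continuous_measurable_fun; exact: continuous_cos. Qed.

Lemma measurable_sin : measurable_fun setT (@sin R).
Proof. by apply: continuous_measurable_fun; exact: continuous_sin. Qed.

Lemma bounded_mfun_cos f : measurable_fun setT f ->
  bounded_mfun (fun x => cos (f x)).
Proof.
move=> mf; split; first exact: (measurableT_comp measurable_cos).
by exists 1 => x; exact: cos_max.
Qed.

Lemma bounded_mfun_sin f : measurable_fun setT f ->
  bounded_mfun (fun x => sin (f x)).
Proof.
move=> mf; split; first exact: (measurableT_comp measurable_sin).
by exists 1 => x; exact: sin_max.
Qed.

Lemma bounded_mfun_expR f : measurable_fun setT f ->
  (forall x, f x <= 0) -> bounded_mfun (fun x => expR (f x)).
Proof.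
move=> mf f0; split; first exact: measurableT_comp.
by exists 1 => x; rewrite ger0_norm ?expR_ge0// expR_le1.
Qed.

Lemma bounded_mfun_gauss f : measurable_fun setT f ->
  bounded_mfun (fun x => expR (- (2^-1 * f x ^+ 2))).
Proof.
move=> mf; apply: bounded_mfun_expR => [|x].
  by apply: measurableT_comp => //; apply: measurable_funM => //; exact: measurable_funX.
by rewrite oppr_le0 mulr_ge0 ?invr_ge0 ?sqr_ge0.
Qed.

Lemma bounded_mfun_indic (A : set T) : measurable A ->
  bounded_mfun (\1_A : T -> R).
Proof.
move=> mA; split; first exact: measurable_indic.
by exists 1 => x; rewrite indicE; case: (_ \in _); rewrite ?normr1 ?normr0.
Qed.

End bounded_mfun.

Lemma bounded_mfun_comp {d d'} {T : measurableType d}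
    {T' : measurableType d'} {R : realType} (f : T' -> R) (h : T -> T') :
  bounded_mfun f -> measurable_fun setT h ->
  bounded_mfun (fun x => f (h x)).
Proof.
move=> [mf [C fC]] mh; split; first exact: (measurableT_comp mf mh).
by exists C.
Qed.

Section expectation.
Context {d : measure_display} {T : measurableType d} {R : realType}.
Variable m : probability T R.
Implicit Types f g : T -> R.

Lemma bounded_integrable f : bounded_mfun f ->
  m.-integrable setT (EFin \o f).
Proof.
move=> [mf [C fC]]; apply: (@le_integrable _ _ _ m _ measurableT _ (EFin \o cst C)) => //.
- exact/measurable_EFinP.
- by move=> x _ /=; rewrite lee_fin (le_trans (fC x))// ler_norm.
- exact: finite_measure_integrable_cst.
Qed.

Lemma mean_cst (c : R) : \int[m]_x c = c.
Proof.
rewrite Rintegral_cst// (_ : fine _ = 1) ?mulr1//.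
by rewrite -[RHS]/(fine 1%E); congr fine; exact: probability_setT.
Qed.

Lemma meanD f g : bounded_mfun f -> bounded_mfun g ->
  \int[m]_x (f x + g x) = \int[m]_x f x + \int[m]_x g x.
Proof. by move=> bf bg; rewrite RintegralD//; exact: bounded_integrable. Qed.

Lemma meanB f g : bounded_mfun f -> bounded_mfun g ->
  \int[m]_x (f x - g x) = \int[m]_x f x - \int[m]_x g x.
Proof. by move=> bf bg; rewrite RintegralB//; exact: bounded_integrable. Qed.

Lemma meanZ f (c : R) : bounded_mfun f ->
  \int[m]_x (c * f x) = c * \int[m]_x f x.
Proof. by move=> bf; rewrite RintegralZl//; exact: bounded_integrable. Qed.

Lemma mean_sum (I : Type) (s : seq I) (F : I -> T -> R) :
  (forall i, bounded_mfun (F i)) ->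
  \int[m]_x (\sum_(i <- s) F i x) = \sum_(i <- s) \int[m]_x F i x.
Proof.
move=> bF; elim: s => [|i s ih].
  by under eq_Rintegral do rewrite big_nil; rewrite mean_cst big_nil.
rewrite big_cons -ih -meanD//; last exact: bounded_mfun_sum.
by apply: eq_Rintegral => x _; rewrite big_cons.
Qed.

Lemma mean_le f g : bounded_mfun f -> bounded_mfun g ->
  (forall x, f x <= g x) -> \int[m]_x f x <= \int[m]_x g x.
Proof. by move=> bf bg fg; apply: le_Rintegral => //; exact: bounded_integrable. Qed.

Lemma mean_ge0 f : (forall x, 0 <= f x) -> 0 <= \int[m]_x f x.
Proof. by move=> f0; apply: Rintegral_ge0. Qed.

Lemma norm_mean f : bounded_mfun f ->
  `|\int[m]_x f x| <= \int[m]_x `|f x|.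
Proof. by move=> bf; apply: le_normr_Rintegral => //; exact: bounded_integrable. Qed.

Lemma mean_norm_le f (C : R) : measurable_fun setT f ->
  (forall x, `|f x| <= C) -> `|\int[m]_x f x| <= C.
Proof.
move=> mf fC; have bf : bounded_mfun f by split => //; exists C.
rewrite (le_trans (norm_mean bf))// -[leRHS]mean_cst.
by apply: mean_le => //;
  [exact: bounded_mfun_norm|exact: bounded_mfun_cst].
Qed.

Lemma mean_indic (A : set T) : measurable A -> \int[m]_x \1_A x = fine (m A).
Proof. by move=> mA; rewrite /Rintegral integral_indic// setIT. Qed.

(** The gap between the two sides is a variance. *)
Lemma mean_sqr_le f : bounded_mfun f ->
  (\int[m]_x f x) ^+ 2 <= \int[m]_x (f x ^+ 2).
Proof.
move=> bf; set e := \int[m]_x f x; rewrite -subr_ge0.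
have -> : \int[m]_x (f x ^+ 2) - e ^+ 2 = \int[m]_x ((f x - e) ^+ 2).
  transitivity (\int[m]_x ((f x ^+ 2 - 2 * e * f x) + e ^+ 2)); last first.
    by apply: eq_Rintegral => x _; ring.
  rewrite meanD ?meanB ?meanZ ?mean_cst; first by rewrite -/e; ring.
  all: do ?[exact: bounded_mfunX|exact: bounded_mfun_cst|
    apply: bounded_mfunB|apply: bounded_mfunM] => //.
by apply: mean_ge0 => x; exact: sqr_ge0.
Qed.

Lemma mean_dominated_cvg (f : nat -> T -> R) f0 g :
  (forall n, measurable_fun setT (f n)) ->
  m.-integrable setT (EFin \o g) ->
  (\forall n \near \oo, forall x, `|f n x| <= g x) ->
  (forall x, f n x @[n --> \oo] --> f0 x) ->
  \int[m]_x f n x @[n --> \oo] --> \int[m]_x f0 x.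
Proof.
move=> mf ig [n0 _ fg] ff0; rewrite -(@cvg_shiftn n0).
have mf0 : measurable_fun setT f0 by exact: measurable_fun_cvg (fun x _ => ff0 x).
have ff0' x : (f (n + n0)%N x)%:E @[n --> \oo] --> (f0 x)%:E.
  by apply: cvg_EFin; [near=> n|by move: (ff0 x); rewrite -(@cvg_shiftn n0)].
have [if0 _ h] := @dominated_convergence _ _ _ m setT measurableT
  (fun n x => (f (n + n0)%N x)%:E) (EFin \o f0) (EFin \o g)
  (fun n => (measurable_EFinP _ _).2 (mf (n + n0)%N)) ((measurable_EFinP _ _).2 mf0)
  (aeW _ (fun x _ => ff0' x)) ig
  (aeW _ (fun x n _ => fg (n + n0)%N (leq_addl _ _) x)).
by apply: fine_cvg; rewrite fineK//; exact: integrable_fin_num.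
Unshelve. all: end_near. Qed.

Lemma mean_bounded_cvg (f : nat -> T -> R) f0 (C : R) :
  (forall n, measurable_fun setT (f n)) ->
  (\forall n \near \oo, forall x, `|f n x| <= C) ->
  (forall x, f n x @[n --> \oo] --> f0 x) ->
  \int[m]_x f n x @[n --> \oo] --> \int[m]_x f0 x.
Proof.
move=> mf fC ff0; apply: (@mean_dominated_cvg f f0 (fun=> C)) => //.
exact: (bounded_integrable (bounded_mfun_cst C)).
Qed.

End expectation.

Section iterated_expectation.
Context {d d' : measure_display} {T : measurableType d} {T' : measurableType d'}.
Context {R : realType}.
Variables (m : probability T R) (m' : probability T' R) (f : T * T' -> R).
Hypothesis bf : bounded_mfun f.

Lemma bounded_mfun_pair1 x : bounded_mfun (fun y => f (x, y)).
Proof. by case: bf => mf [C fC]; split; [exact: measurableT_comp|exists C]. Qed.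

Lemma bounded_mfun_pair2 y : bounded_mfun (fun x => f (x, y)).
Proof. by case: bf => mf [C fC]; split; [exact: measurableT_comp|exists C]. Qed.

Lemma bounded_integrable_prod : (m \x m')%E.-integrable setT (EFin \o f).
Proof.
have [mf [C fC]] := bf.
(* Seen as a subprobability, the product is a finite measure, for which constants are integrable. *)
have -> : (m \x m')%E = product_subprobability
  ((m : subprobability T R), (m' : subprobability T' R)) by [].
apply: (@le_integrable _ _ _ _ _ measurableT _ (EFin \o cst C)) => //.
- exact/measurable_EFinP.
- by move=> x _ /=; rewrite lee_fin (le_trans (fC x))// ler_norm.
- exact: finite_measure_integrable_cst.
Qed.

Let innerE x : (\int[m']_y f (x, y))%:E = (\int[m']_y (f (x, y))%:E)%E.
Proof.
rewrite /Rintegral fineK//; apply: integrable_fin_num => //.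
exact: bounded_integrable (bounded_mfun_pair1 x).
Qed.

Let innerE' y : (\int[m]_x f (x, y))%:E = (\int[m]_x (f (x, y))%:E)%E.
Proof.
rewrite /Rintegral fineK//; apply: integrable_fin_num => //.
exact: bounded_integrable (bounded_mfun_pair2 y).
Qed.

Lemma bounded_mfun_mean : bounded_mfun (fun x => \int[m']_y f (x, y)).
Proof.
have [mf [C fC]] := bf; split; last first.
  by exists C => x; apply: mean_norm_le => //; case: (bounded_mfun_pair1 x).
apply/measurable_EFinP.
have := measurable_fubini_F bounded_integrable_prod.
by apply: eq_measurable_fun => x _ /=; rewrite innerE.
Qed.

Lemma mean_fubini :
  \int[m]_x \int[m']_y f (x, y) = \int[m']_y \int[m]_x f (x, y).
Proof.
rewrite {1}/Rintegral [RHS]/Rintegral; congr fine.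
under eq_integral do rewrite innerE.
under [RHS]eq_integral do rewrite innerE'.
exact: (Fubini bounded_integrable_prod).
Qed.

Lemma mean_prod : fine (\int[(m \x m')%E]_p (f p)%:E)%E =
  \int[m]_x \int[m']_y f (x, y).
Proof.
rewrite [RHS]/Rintegral; congr fine.
under [RHS]eq_integral do rewrite innerE.
by rewrite (integral12_prod_meas1 bounded_integrable_prod).
Qed.

End iterated_expectation.

(** * Gaussian integrals *)

Section canonical_reals.
Context {R : realType}.

Definition to_canonical (x : measurableTypeR R) : R := x.

Let to_canonical_measurable : measurable_fun setT to_canonical.
Proof. by move=> _ A mA; rewrite setTI; exact: mA. Qed.

HB.instance Definition _ :=
  isMeasurableFun.Build _ _ _ _ to_canonical to_canonical_measurable.

(* Stieltjes measures live on [measurableTypeR R], whose display differs from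
   the one of the canonical measurable structure of [R]. *)
Definition canonical_law (m : probability (measurableTypeR R) R) :
  probability R R := distribution m to_canonical.

Lemma canonical_lawE (m : probability (measurableTypeR R) R) (A : set R) :
  canonical_law m A = m A.
Proof. by []. Qed.

Lemma ge0_integral_canonical_law (m : probability (measurableTypeR R) R)
    (f : R -> \bar R) : measurable_fun setT f -> (forall x, (0 <= f x)%E) ->
  (\int[canonical_law m]_x f x = \int[m]_x f x)%E.
Proof. by move=> mf f0; rewrite /canonical_law ge0_integral_distribution. Qed.

End canonical_reals.

Definition gauss (R : realType) : probability R R :=
  canonical_law [the probability _ _ of normal_prob (0 : R) 1].

Section gauss_density.
Context {R : realType}.
Local Notation mu := (@lebesgue_measure R).
Local Notation pdf := (normal_pdf (0 : R) 1).
Local Open Scope ereal_scope.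

Import HBNNSimple.

(** Both sides are monotone limits along the simple approximations of [f]; for a simple function the
    identity is the definition of [normal_prob] on each level set. *)
Lemma ge0_integral_gauss (f : R -> \bar R) :
  measurable_fun setT f -> (forall x, 0 <= f x) ->
  \int[gauss R]_x f x = \int[mu]_x (f x * (pdf x)%:E).
Proof.
move=> mf f0; rewrite ge0_integral_canonical_law//.
pose P0 := [the probability _ _ of normal_prob (0 : R) 1].
rewrite -/P0.
pose g := nnsfun_approx (@measurableT _ (measurableTypeR R)) mf.
have pdf0 x : 0 <= (pdf x)%:E by rewrite lee_fin normal_pdf_ge0.
have mpdf : measurable_fun setT (EFin \o pdf).
  by apply/measurable_EFinP; exact: measurable_normal_pdf.
have gf x : (EFin \o g ^~ x) n @[n --> \oo] --> f x by exact: cvg_nnsfun_approx.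
transitivity (limn (fun n => \int[P0]_x (g n x)%:E)).
  rewrite -monotone_convergence//=.
  - by apply: eq_integral => x _; apply/esym/cvg_lim => //; exact: gf.
  - by move=> n; exact/measurable_EFinP.
  - by move=> n x _; rewrite lee_fin.
  - by move=> x _ a b ab; rewrite lee_fin; exact/lefP/nd_nnsfun_approx.
transitivity (limn (fun n => \int[mu]_x ((g n x)%:E * (pdf x)%:E))); last first.
  rewrite -monotone_convergence//=.
  - apply: eq_integral => x _; apply/cvg_lim => //.
    by apply: cvgeZr => //; exact: gf.
  - by move=> n; apply: emeasurable_funM => //; exact/measurable_EFinP.
  - by move=> n x _; rewrite mule_ge0// lee_fin.
  - move=> x _ a b ab; apply: lee_wpmul2r => //.
    by rewrite lee_fin; exact/lefP/nd_nnsfun_approx.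
congr (limn _); apply/funext => n.
under [LHS]eq_integral do rewrite fimfunE -fsumEFin//.
rewrite [LHS]ge0_integral_fsum//; last 2 first.
  - by move=> r; exact/measurable_EFinP/measurableT_comp.
  - by move=> r x _; rewrite EFinM nnfun_muleindic_ge0.
under [RHS]eq_integral.
  move=> x xD; rewrite fimfunE -fsumEFin// muleC ge0_mule_fsumr; last first.
    by move=> r; rewrite EFinM nnfun_muleindic_ge0.
  over.
rewrite [RHS]ge0_integral_fsum//; last 2 first.
  - move=> r; apply: emeasurable_funM => //.
    by apply/measurable_EFinP; apply/measurableT_comp.
  - by move=> r x _; rewrite mule_ge0// EFinM nnfun_muleindic_ge0.
apply: eq_fsbigr => r _.
rewrite integralZl_indic_nnsfun// integral_indic// setIT.
have [r0|r0] := leP 0%R r; last first.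
  have -> : g n @^-1` [set r] = set0.
    apply/seteqP; split => // x /= gr; have : (0 <= g n x)%R by [].
    by rewrite gr leNgt r0.
  rewrite measure0 mule0; apply/esym.
  by apply: integral0_eq => x _; rewrite indic0 mulr0 mule0.
rewrite /P0/= /normal_prob integral_mkcond.
transitivity (\int[mu]_x (r%:E * (\1_(g n @^-1` [set r]) x * pdf x)%:E)).
  rewrite ge0_integralZl//.
  - congr (_ * _); apply: eq_integral => x _; rewrite patchE indicE.
    by case: ifPn => _; rewrite ?mul1r ?mul0r.
  - apply/measurable_EFinP; apply: measurable_funM.
      exact: measurable_indic.
    exact: measurable_normal_pdf.
  - by move=> x _; rewrite lee_fin mulr_ge0// normal_pdf_ge0.
by apply: eq_integral => x _; rewrite -!EFinM; congr EFin; rewrite mulrA mulrC.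
Qed.

(** Half-open intervals determine Lebesgue measure, and a translation preserves their lengths. *)
Lemma lebesgue_measure_shift (a : R) (A : set R) : measurable A ->
  pushforward mu (fun x : R => (x + a)%R) A = mu A.
Proof.
move=> mA; apply/esym.
have mphi : measurable_fun (@setT (measurableTypeR R))
  ((fun x : R => (x + a)%R) : measurableTypeR R -> measurableTypeR R).
  exact: measurable_funD.
pose s : {mfun measurableTypeR R >-> measurableTypeR R} :=
  HB.pack (fun x : R => (x + a)%R) (isMeasurableFun.Build _ _ _ _ _ mphi).
apply: (@lebesgue_measure_unique R (pushforward mu s)) => //= _ [[b c]] _ <-.
rewrite /pushforward/=.
have -> : (fun x : R => (x + a)%R) @^-1` `]b, c] = `](b - a)%R, (c - a)%R]%classic.
  by apply/seteqP; split => x /=; rewrite !in_itv/= ltrBlDr lerBrDr.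
rewrite !lebesgue_measure_itv/= !lte_fin ltrD2r.
by case: ifPn => // _; rewrite -!EFinB; congr EFin; rewrite opprD addrACA subrr addr0.
Qed.

Lemma ge0_integral_shift (a : R) (f : R -> \bar R) :
  measurable_fun setT f -> (forall x, 0 <= f x) ->
  \int[mu]_x f (x + a)%R = \int[mu]_x f x.
Proof.
move=> mf f0.
have mphi : measurable_fun (@setT (measurableTypeR R))
  ((fun x : R => (x + a)%R) : measurableTypeR R -> measurableTypeR R).
  exact: measurable_funD.
pose s : {mfun measurableTypeR R >-> measurableTypeR R} :=
  HB.pack (fun x : R => (x + a)%R) (isMeasurableFun.Build _ _ _ _ _ mphi).
rewrite -[LHS](@ge0_integral_pushforward _ _ (measurableTypeR R)
  (measurableTypeR R) R s mphi mu setT f)//.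
by apply: eq_measure_integral => A mA _; exact: lebesgue_measure_shift.
Qed.

Lemma normal_pdf01E (x : R) :
  pdf x = (normal_peak (1 : R) * expR (- (2^-1 * x ^+ 2)))%R.
Proof.
by rewrite normal_pdfE// /normal_fun; congr (_ * expR _)%R; rewrite subr0 expr1n; field.
Qed.

(** The Cameron-Martin formula in dimension one: translate by [a], then complete the square in the
    exponent. *)
Lemma gauss_shift (a : R) (F : R -> R) :
  measurable_fun setT F -> (forall x, (0 <= F x)%R) ->
  \int[gauss R]_x (F x * expR (a * x))%:E =
  (expR (2^-1 * a ^+ 2))%:E * \int[gauss R]_x (F (x + a)%R)%:E.
Proof.
move=> mF F0.
have mFa : measurable_fun setT (fun x : R => F (x + a)%R).
  by apply: measurableT_comp => //; exact: measurable_funD.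
have mexp : measurable_fun setT (fun x : R => expR (a * x)).
  by apply: measurableT_comp => //; exact: measurable_funM.
rewrite ge0_integral_gauss; last 2 first.
- by apply/measurable_EFinP; exact: measurable_funM.
- by move=> x; rewrite lee_fin mulr_ge0// expR_ge0.
rewrite ge0_integral_gauss; last 2 first.
- exact/measurable_EFinP.
- by move=> x; rewrite lee_fin.
rewrite -(ge0_integral_shift a); last 2 first.
- apply: emeasurable_funM; first by apply/measurable_EFinP; exact: measurable_funM.
  by apply/measurable_EFinP; exact: measurable_normal_pdf.
- by move=> x; rewrite mule_ge0 ?lee_fin ?mulr_ge0 ?expR_ge0 ?normal_pdf_ge0.
rewrite -ge0_integralZl//; last 2 first.
- apply: emeasurable_funM; first exact/measurable_EFinP.
  by apply/measurable_EFinP; exact: measurable_normal_pdf.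
- by move=> x _; rewrite mule_ge0 ?lee_fin ?mulr_ge0 ?expR_ge0 ?normal_pdf_ge0.
apply: eq_integral => x _; rewrite -!EFinM; congr EFin; rewrite !normal_pdf01E.
transitivity (F (x + a)%R * normal_peak 1 *
  (expR (a * (x + a)) * expR (- (2^-1 * (x + a) ^+ 2))))%R; first by ring.
rewrite -expRD.
have -> : (a * (x + a) + - (2^-1 * (x + a) ^+ 2) =
  2^-1 * a ^+ 2 + - (2^-1 * x ^+ 2))%R by field.
by rewrite expRD; ring.
Qed.

Lemma ge0_integral_opp (f : R -> \bar R) :
  measurable_fun setT f -> (forall x, 0 <= f x) ->
  \int[mu]_x f (- x)%R = \int[mu]_x f x.
Proof.
move=> mf f0.
have mN : measurable_fun (@setT (measurableTypeR R))
  ((fun x : R => (- x)%R) : measurableTypeR R -> measurableTypeR R).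
  exact: measurableT_comp.
pose s : {mfun measurableTypeR R >-> measurableTypeR R} :=
  HB.pack (fun x : R => (- x)%R) (isMeasurableFun.Build _ _ _ _ _ mN).
rewrite -[LHS](@ge0_integral_pushforward _ _ (measurableTypeR R)
  (measurableTypeR R) R s mN mu setT f)//.
apply: eq_measure_integral => A mA _.
by rewrite /pushforward; exact: lebesgue_measureN.
Qed.

Lemma gaussN (f : R -> \bar R) : measurable_fun setT f -> (forall x, 0 <= f x) ->
  \int[gauss R]_x f (- x)%R = \int[gauss R]_x f x.
Proof.
move=> mf f0.
have mfp : measurable_fun setT (fun x => f x * (pdf x)%:E).
  by apply: emeasurable_funM => //; apply/measurable_EFinP; exact: measurable_normal_pdf.
have mfN : measurable_fun setT (fun x : R => f (- x)%R) by exact: measurableT_comp.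
rewrite !ge0_integral_gauss// -(ge0_integral_opp mfp) => [|x]; last first.
  by rewrite mule_ge0 ?lee_fin ?normal_pdf_ge0.
by apply: eq_integral => x _; rewrite !normal_pdf01E sqrrN.
Qed.

End gauss_density.

(** Domination is asked for only within distance 1 of [a]: the exponentials differentiated below
    have no integrable envelope over all values of the parameter. *)
Lemma mean_is_derive {d : measure_display} {T : measurableType d} {R : realType}
    (m : probability T R) (f f' : R -> T -> R) (a : R) (G : T -> R) :
  (forall x, m.-integrable setT (EFin \o f x)) ->
  (forall (x : R) (y : T), is_derive x 1 (f ^~ y) (f' x y)) ->
  m.-integrable setT (EFin \o G) ->
  (forall x y, `|x - a| < 1 -> `|f' x y| <= G y) ->
  is_derive a 1 (fun x => \int[m]_y f x y) (\int[m]_y f' a y).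
Proof.
move=> fi df Gi fG.
have I1 x : `](a - 1), (a + 1)[%classic x -> `|x - a| < 1.
  by rewrite /= in_itv/= => ?; rewrite ltr_distl.
have Ia : `](a - 1), (a + 1)[%classic a.
  by rewrite /= in_itv/= ltrBlDr ltrDl ltr01.
have d1E x y : partial1of2 f x y = f' x y.
  by rewrite partial1of2E; exact: derive_val.
have G0 y : 0 <= G y by rewrite (le_trans _ (fG a y _))// subrr normr0.
have df1 x y : `](a - 1), (a + 1)[%classic x -> setT y -> derivable (f ^~ y) x 1.
  by move=> _ _; exact: ex_derive.
have fG1 x y : `](a - 1), (a + 1)[%classic x -> setT y ->
    `|partial1of2 f x y| <= G y.
  by move=> /I1 xa _; rewrite d1E; exact: fG.
apply: DeriveDef.
  exact: (@derivable_under_integral _ _ _ m f setT measurableT a _ _ Ia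
    (fun x _ => fi x) df1 G G0 Gi fG1).
rewrite -derive1E (@differentiation_under_integral _ _ _ m f setT measurableT a _ _ Ia
  (fun x _ => fi x) df1 G G0 Gi fG1).
by apply: eq_Rintegral => y _; exact: d1E.
Qed.

Section gauss_transforms.
Context {R : realType}.
Implicit Types (a x : R) (F : R -> R).

Lemma gauss_integrable_expR a :
  (gauss R).-integrable setT (EFin \o (fun z => expR (a * z))).
Proof.
have me : measurable_fun setT (fun z : R => expR (a * z)).
  by apply: measurableT_comp => //; exact: measurable_funM.
apply/integrableP; split; first exact/measurable_EFinP.
under eq_integral do rewrite /= ger0_norm ?expR_ge0// -[expR _]mul1r.
rewrite (@gauss_shift _ a (cst 1))//=.
have -> : (\int[gauss R]_x 1 = 1)%E.
  by rewrite integral_cst// mul1e; exact: probability_setT.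
by rewrite mule1 ltry.
Qed.

Lemma gauss_integrable_bounded_expR a F : bounded_mfun F ->
  (gauss R).-integrable setT (EFin \o (fun z => F z * expR (a * z))).
Proof.
move=> [mF [C FC]].
have me : measurable_fun setT (fun z : R => expR (a * z)).
  by apply: measurableT_comp => //; exact: measurable_funM.
apply: (@le_integrable _ _ _ _ _ measurableT _
  (fun z => (C%:E * (expR (a * z))%:E)%E)) => //.
- by apply/measurable_EFinP; exact: measurable_funM.
- move=> z _; rewrite /= lee_fin !normrM (ger0_norm (expR_ge0 _)).
  by rewrite ler_wpM2r ?expR_ge0// (le_trans (FC z))// ler_norm.
- by apply: integrableZl => //; exact: gauss_integrable_expR.
Qed.

Lemma mean_gauss_shift a F : bounded_mfun F ->
  \int[gauss R]_z (F z * expR (a * z)) =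
  expR (2^-1 * a ^+ 2) * \int[gauss R]_z F (z + a).
Proof.
move=> bF; have [mF [C FC]] := bF.
have mFa : measurable_fun setT (fun z : R => F (z + a)).
  by apply: measurableT_comp => //; exact: measurable_funD.
have bFa : bounded_mfun (fun z : R => F (z + a)) by split => //; exists C.
have bC : @bounded_mfun _ R R (fun=> C) by exact: bounded_mfun_cst.
have pos G : bounded_mfun G -> (forall z, 0 <= G z) ->
    \int[gauss R]_z (G z * expR (a * z)) =
    expR (2^-1 * a ^+ 2) * \int[gauss R]_z G (z + a).
  move=> bG G0; rewrite {1}/Rintegral gauss_shift//; last by case: bG.
  rewrite fineM//; apply: integrable_fin_num => //.
  apply: (@bounded_integrable _ _ _ _ (fun z : R => G (z + a))).
  by apply: (bounded_mfun_comp bG); exact: measurable_funD.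
have FC0 z : 0 <= F z + C.
  by rewrite addrC -[F z]opprK subr_ge0 (le_trans _ (FC z))// -normrN ler_norm.
have FCp := pos (fun z => F z + C) (bounded_mfunD bF bC) FC0.
have C0 : 0 <= C by rewrite (le_trans _ (FC 0)).
have Cp := pos (fun=> C) bC (fun=> C0).
have -> : \int[gauss R]_z (F z * expR (a * z)) =
    \int[gauss R]_z ((F z + C) * expR (a * z)) - \int[gauss R]_z (C * expR (a * z)).
  rewrite -RintegralB//; last 2 first.
  - by apply: gauss_integrable_bounded_expR; exact: bounded_mfunD.
  - exact: (gauss_integrable_bounded_expR a bC).
  by apply: eq_Rintegral => z _; ring.
by rewrite FCp Cp meanD//; ring.
Qed.

Lemma mean_gaussN F : bounded_mfun F ->
  \int[gauss R]_z F (- z) = \int[gauss R]_z F z.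
Proof.
move=> bF; have [mF [C FC]] := bF.
have bC : @bounded_mfun _ R R (fun=> C) by exact: bounded_mfun_cst.
have bFN : bounded_mfun (fun z : R => F (- z)).
  by apply: (bounded_mfun_comp bF); exact: oppr_measurable.
apply: (@addIr _ C); rewrite -[in LHS](mean_cst (gauss R) C) -[in RHS](mean_cst (gauss R) C).
rewrite -!meanD//.
rewrite /Rintegral -(@gaussN _ (fun z => (F z + C)%:E))//.
- by apply/measurable_EFinP; exact: measurable_funD.
- move=> z; rewrite lee_fin.
  by rewrite addrC -[F z]opprK subr_ge0 (le_trans _ (FC z))// -normrN ler_norm.
Qed.

Lemma mean_gauss_sin x : \int[gauss R]_z sin (x * z) = 0.
Proof.
have bs : bounded_mfun (fun z : R => sin (x * z)).
  by apply: bounded_mfun_sin; exact: measurable_funM.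
have := mean_gaussN bs.
have -> : \int[gauss R]_z sin (x * - z) = - \int[gauss R]_z sin (x * z).
  rewrite -mulN1r -meanZ//.
  by apply: eq_Rintegral => z _; rewrite mulrN sinN mulN1r.
by move=> h; lra.
Qed.

Let y x := \int[gauss R]_z cos (x * z).

Let bcos x : bounded_mfun (fun z : R => cos (x * z)).
Proof. by apply: bounded_mfun_cos; exact: measurable_funM. Qed.

Let bsin x : bounded_mfun (fun z : R => sin (x * z)).
Proof. by apply: bounded_mfun_sin; exact: measurable_funM. Qed.

(** For |a| < 1 both |z| and exp(a z) are at most exp |z|; their product explains the exponents 2
    and -2. *)
Let G (z : R) := expR (2 * z) + expR (- 2 * z).

Let G_integrable : (gauss R).-integrable setT (EFin \o G).
Proof.
have -> : EFin \o G = (fun z => (expR (2 * z))%:E + (expR (-2 * z))%:E)%E by [].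
by apply: integrableD => //; exact: gauss_integrable_expR.
Qed.

Let le_G a z : `|a| < 1 -> `|z| * expR (a * z) <= G z.
Proof.
move=> a1.
have h1 : `|z| <= expR `|z|.
  by rewrite (le_trans _ (expR_ge1Dx _))// lerDr.
have h2 : expR (a * z) <= expR `|z|.
  rewrite ler_expR (le_trans (ler_norm _))// normrM -[leRHS]mul1r.
  by rewrite ler_wpM2r// ltW.
apply: (@le_trans _ _ (expR `|z| * expR `|z|)).
  by apply: ler_pM => //; exact: expR_ge0.
rewrite -expRD /G; have [z0|z0] := leP 0 z.
  by rewrite ger0_norm// (_ : z + z = 2 * z) ?lerDl ?expR_ge0//; ring.
by rewrite ltr0_norm// (_ : - z - z = - 2 * z) ?lerDr ?expR_ge0//; ring.
Qed.

(** Stein's identity for a sine. It is the derivative at [a = 0] of the Gaussian shift formula,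
    which replaces an integration by parts. *)
Let stein x : \int[gauss R]_z (z * sin (x * z)) = x * y x.
Proof.
have LE a : \int[gauss R]_z (sin (x * z) * expR (a * z)) =
    expR (2^-1 * a ^+ 2) * (sin (x * a) * y x).
  rewrite mean_gauss_shift//; congr (_ * _).
  transitivity (\int[gauss R]_z (cos (x * a) * sin (x * z) + sin (x * a) * cos (x * z))).
    by apply: eq_Rintegral => z _; rewrite mulrDr sinD; ring.
  rewrite meanD; last 2 first.
  - by apply: bounded_mfunM => //; exact: bounded_mfun_cst.
  - by apply: bounded_mfunM => //; exact: bounded_mfun_cst.
  by rewrite !meanZ// mean_gauss_sin mulr0 add0r.
have dL : is_derive (0 : R) 1 (fun a => \int[gauss R]_z (sin (x * z) * expR (a * z)))
    (\int[gauss R]_z (sin (x * z) * (z * expR (0 * z)))).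
  apply: (@mean_is_derive _ _ _ _ (fun a z => sin (x * z) * expR (a * z))
     (fun a z => sin (x * z) * (z * expR (a * z))) _ G) => //.
  - by move=> a; exact: gauss_integrable_bounded_expR.
  - move=> a z; apply: is_derive_eq.
    by rewrite /GRing.scale/=; ring.
  - move=> a z; rewrite subr0 => a1; rewrite normrM.
    rewrite (@le_trans _ _ (1 * `|z * expR (a * z)|))//.
      by rewrite ler_wpM2r// sin_max.
    by rewrite mul1r normrM (ger0_norm (expR_ge0 _)) le_G.
have dR : is_derive (0 : R) 1 (fun a => expR (2^-1 * a ^+ 2) * (sin (x * a) * y x)) (x * y x).
  apply: is_derive_eq.
  rewrite /GRing.scale/= ?expr0n/= ?mulr0 ?expR0 ?sin0 ?cos0 ?mul0r
    ?add0r ?addr0 ?mulr1 ?mul1r.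
  by ring.
have : (fun a => \int[gauss R]_z (sin (x * z) * expR (a * z))) =
   (fun a => expR (2^-1 * a ^+ 2) * (sin (x * a) * y x)) by apply/funext.
move=> LR; rewrite LR in dL.
have := @derive_val _ _ _ _ _ _ _ dL; rewrite (@derive_val _ _ _ _ _ _ _ dR) => ->.
by apply: eq_Rintegral => z _; rewrite mul0r expR0 mulr1 mulrC.
Qed.

(** By [stein] the left side solves y' = - x y, so y(x) exp(x^2 / 2) is constant, and it equals 1 at
    0. *)
Lemma mean_gauss_cos x : \int[gauss R]_z cos (x * z) = expR (- (2^-1 * x ^+ 2)).
Proof.
have dy (u : R) : is_derive u 1 y (- (u * y u)).
  rewrite -stein -mulN1r -RintegralZl//; last first.
    apply: (@le_integrable _ _ _ _ _ measurableT _ (EFin \o G)) => //.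
      by apply/measurable_EFinP; apply: measurable_funM => //; case: (bsin u).
    move=> z _; rewrite /= lee_fin normrM (@ger0_norm _ (G z)) ?addr_ge0 ?expR_ge0//.
    apply: le_trans (@le_G 0 z _); last by rewrite normr0.
    by rewrite mul0r expR0 ler_wpM2l// sin_max.
  under eq_Rintegral do rewrite mulN1r.
  apply: (@mean_is_derive _ _ _ _ (fun a z => cos (a * z))
     (fun a z => - (z * sin (a * z))) _ G) => //.
  - by move=> a; exact: bounded_integrable.
  - move=> a z; apply: is_derive_eq.
    by rewrite /GRing.scale/=; ring.
  - move=> a z _; rewrite normrN normrM.
    apply: le_trans (@le_G 0 z _); last by rewrite normr0.
    by rewrite mul0r expR0 ler_wpM2l// sin_max.
have d0 (u : R) : is_derive u 1 (fun v => y v * expR (2^-1 * v ^+ 2)) 0.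
  apply: is_derive_eq.
  by rewrite /GRing.scale/=; field.
have := @is_derive_0_is_cst R _ x 0 d0.
rewrite {2}/y; under eq_Rintegral do rewrite mul0r cos0.
rewrite mean_cst expr0n/= mulr0 expR0 mulr1 => h.
rewrite -/(y x) expRN -[LHS](@mulfK _ (expR (2^-1 * x ^+ 2))).
  by rewrite h mul1r.
by rewrite gt_eqF// expR_gt0.
Qed.

End gauss_transforms.

(** * Convergence from moments *)

Lemma cvg_sumr {R : realType} (I : Type) (s : seq I) (F : I -> nat -> R) (l : I -> R) :
  (forall i, F i n @[n --> \oo] --> l i) ->
  \sum_(i <- s) F i n @[n --> \oo] --> \sum_(i <- s) l i.
Proof.
move=> Fl; elim: s => [|i s ih].
  by rewrite big_nil; under eq_fun do rewrite big_nil; exact: cvg_cst.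
rewrite big_cons; under eq_fun do rewrite big_cons.
exact: cvgD (Fl i) ih.
Qed.

Section moments.
Context {d : measure_display} {T : measurableType d} {R : realType}.
Variables (m_ : nat -> probability T R) (m : probability T R).

Lemma bernoulli_le (x : R) q : 0 <= x <= 1 -> 1 - (1 - x) ^+ q <= q%:R * x.
Proof.
move=> /andP[x0 x1]; elim: q => [|q ih]; first by rewrite expr0 mul0r subrr.
rewrite exprS -natr1.
have : 0 <= (1 - x) ^+ q <= 1 by rewrite exprn_ge0 ?exprn_ile1 ?subr_ge0 ?lerBlDr ?lerDl.
move=> /andP[h0 h1]; nra.
Qed.

Lemma bernoulli_inv_le (x : R) q : 0 <= x <= 1 -> (1 - x) ^+ q * (1 + q%:R * x) <= 1.
Proof.
move=> /andP[x0 x1]; elim: q => [|q ih]; first by rewrite expr0 mul0r addr0 mul1r.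
have h0 : 0 <= (1 - x) ^+ q by rewrite exprn_ge0 ?subr_ge0.
apply: le_trans ih; rewrite exprS -mulrA -[leRHS]mul1r.
rewrite mulrCA -[leRHS]mulrCA; apply: ler_wpM2l => //; rewrite mul1r -natr1.
have q0 : 0 <= q%:R :> R by [].
nra.
Qed.

(** Take t strictly between r and s and q just above t^-p. Then q r^p is of the order of (r / t)^p,
    which tends to 0, while q s^p is at least (s / t)^p, which tends to infinity. *)
Lemma sharp_power (r s e : R) : 0 < r -> r < s -> s <= 1 -> 0 < e ->
  exists p q : nat, q%:R * r ^+ p <= e /\ (1 + q%:R * s ^+ p)^-1 <= e.
Proof.
move=> r0 rs s1 e0.
have [t rt ts] : exists2 t, r < t & t < s by exists ((r + s) / 2); lra.
have t0 : 0 < t by exact: lt_trans rt.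
have s0 : 0 < s by exact: lt_trans ts.
have c1 : (r / t) ^+ p @[p --> \oo] --> (0 : R).
  apply: cvg_expr; rewrite ger0_norm ?ltr_pdivrMr ?mul1r//.
  by rewrite divr_ge0// ltW.
have c2 : (t / s) ^+ p @[p --> \oo] --> (0 : R).
  apply: cvg_expr; rewrite ger0_norm ?ltr_pdivrMr ?mul1r//.
  by rewrite divr_ge0// ltW.
have e2 : 0 < e / 2 by rewrite divr_gt0.
have [p [p1 p2]] : exists p : nat, (r / t) ^+ p <= e / 2 /\ (t / s) ^+ p <= e / 2.
  have h : \forall p \near \oo, (r / t) ^+ p <= e / 2 /\ (t / s) ^+ p <= e / 2.
    move/cvgrPdist_le : c1 => /(_ _ e2) c1.
    move/cvgrPdist_le : c2 => /(_ _ e2) c2.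
    near=> p; split.
    - have : `|0 - (r / t) ^+ p| <= e / 2 by near: p.
      by rewrite sub0r normrN; apply: le_trans; exact: ler_norm.
    - have : `|0 - (t / s) ^+ p| <= e / 2 by near: p.
      by rewrite sub0r normrN; apply: le_trans; exact: ler_norm.
  by case: h => p _ h; exists p; apply: h => /=.
have tp0 : 0 < t ^+ p by rewrite exprn_gt0.
have sp0 : 0 < s ^+ p by rewrite exprn_gt0.
have rp0 : 0 < r ^+ p by rewrite exprn_gt0.
pose q := (Num.truncn (t ^+ p)^-1).+1.
have tpi0 : 0 <= (t ^+ p)^-1 by rewrite invr_ge0 ltW.
have /andP[q2 q1] := truncn_itv tpi0.
have {}q2 : q%:R <= (t ^+ p)^-1 + 1 by rewrite /q -natr1 lerD2r.
have {}q1 : (t ^+ p)^-1 < q%:R by [].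
have tp1 : 1 <= (t ^+ p)^-1.
  rewrite invf_ge1// exprn_ile1//; first exact: ltW.
  by rewrite ltW// (lt_le_trans ts).
exists p, q; split.
  apply: (@le_trans _ _ (2 * (t ^+ p)^-1 * r ^+ p)).
    by apply: ler_wpM2r; [exact: ltW|lra].
  by move: p1; rewrite expr_div_n mulrAC => p1; lra.
apply: (@le_trans _ _ ((t / s) ^+ p)); last by lra.
rewrite expr_div_n -[leRHS]invrK invf_div lef_pV2 ?posrE; last 2 first.
- by rewrite addr_gt0// mulr_gt0.
- by rewrite divr_gt0.
have : s ^+ p / t ^+ p <= q%:R * s ^+ p by rewrite mulrC ler_wpM2r ?ltW.
by lra.
Unshelve. all: end_near. Qed.

(** A single test polynomial 1 - (1 - x^p)^q is enough: by Bernoulli it is at most q r^p below r,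
    and within 1 / (1 + q s^p) of 1 above s. The estimate is one-sided, so the level r may carry
    mass. *)
Lemma moments_liminf (f : T -> R) (r e : R) :
  measurable_fun setT f -> (forall x, 0 <= f x <= 1) ->
  (forall j : nat, \int[m_ n]_x (f x ^+ j) @[n --> \oo] --> \int[m]_x (f x ^+ j)) ->
  0 < r -> 0 < e ->
  \forall n \near \oo,
    fine (m [set x | r < f x]) - e <= fine (m_ n [set x | r < f x]).
Proof.
move=> mf f01 fj r0 e0.
have bf : bounded_mfun f.
  by split => //; exists 1 => x; have /andP[? ?] := f01 x; rewrite ger0_norm.
have mgt s : measurable [set x | s < f x].
  by rewrite -[X in measurable X]setTI; apply: measurable_fun_ltr.
have [r1|r1] := leP 1 r.
  near=> n.
  have -> : [set x | r < f x] = set0.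
    apply/seteqP; split => // x /=; rewrite ltNge.
    by have /andP[_ /le_trans->] := f01 x.
  by rewrite !measure0 sub0r oppr_le0 ltW.
have e4 : 0 < e / 4 by rewrite divr_gt0.
(* The room between [r] and [s] is where the polynomial climbs; [s] is so close to [r] that [m]
   gives mass at most [e / 4] to the values in between. *)
have [s rs1 sm] : exists2 s, r < s <= 1 &
    fine (m [set x | r < f x]) - e / 4 <= fine (m [set x | s < f x]).
  pose s k : R := r + (1 - r) * k.+1%:R^-1.
  have sr : s k @[k --> \oo] --> r.
    rewrite -[X in _ --> X]addr0 -[X in _ --> _ + X](mulr0 (1 - r)).
    apply: cvgD; first exact: cvg_cst.
    apply: cvgM; first exact: cvg_cst.
    exact: cvg_harmonic.
  have c : \int[m]_x \1_[set x | s k < f x] x @[k --> \oo] -->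
      \int[m]_x \1_[set x | r < f x] x.
    apply: (@mean_bounded_cvg _ _ _ _ _ _ 1).
    - by move=> k; exact: measurable_indic.
    - by near=> k => x; rewrite indicE; case: (_ \in _); rewrite ?normr1 ?normr0.
    - move=> x; have [rf|fr] := ltP r (f x).
        apply: cvg_near_cst.
        have h : \forall k \near \oo, s k < f x by apply: cvgr_lt sr _ rf.
        near=> k; rewrite !indicE !mem_set//=; near: k; exact: h.
      apply: cvg_near_cst; near=> k.
      rewrite !indicE !memNset//=; apply/negP; rewrite -leNgt//.
      by rewrite (le_trans fr)// /s lerDl mulr_ge0// subr_ge0 ltW.
  move/cvgrPdist_le : c => /(_ _ e4)[k _ /(_ k (leqnn _))].
  rewrite !mean_indic// => /ler_normlP[_ h].
  exists (s k); last by lra.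
  rewrite /s ltrDl mulr_gt0 ?subr_gt0//=.
  rewrite -lerBrDl ler_piMr ?subr_ge0 ?(ltW r1)//.
  by rewrite invf_le1// ler1n.
have /andP[rs s1] := rs1.
have [p [q [pq1 pq2]]] := @sharp_power r s (e / 4) r0 rs s1 e4.
(* A polynomial in [f], small where [f <= r] and close to [1] where [s < f]. *)
pose g x := 1 - (1 - f x ^+ p) ^+ q.
have bfp : bounded_mfun (fun x => f x ^+ p) by exact: bounded_mfunX.
have b1 : @bounded_mfun _ T R (fun=> 1) by exact: bounded_mfun_cst.
have bg : bounded_mfun g.
  apply: bounded_mfunB => //; apply: bounded_mfunX.
  exact: bounded_mfunB.
have fp01 x : 0 <= f x ^+ p <= 1.
  by have /andP[? ?] := f01 x; rewrite exprn_ge0// exprn_ile1.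
(* The constant term of the binomial expansion cancels the leading 1, hence the value 0 at
   [i = 0]. *)
have gE x : g x = \sum_(i < q.+1) (if i == ord0 then 0 else
    - ((-1) ^+ i *+ 'C(q, i)) * f x ^+ (p * i)).
  rewrite /g exprBn big_ord_recl /= [in RHS]big_ord_recl eqxx add0r.
  rewrite expr0 subn0 expr1n !mulr1 bin0 mulr1n opprD addrA subrr add0r -sumrN.
  by apply: eq_bigr => i _; rewrite expr1n mulr1 -exprM -mulrnAl mulNr.
have mg (n : probability T R) : \int[n]_x g x = \sum_(i < q.+1) (if i == ord0 then 0 else
    - ((-1) ^+ i *+ 'C(q, i)) * \int[n]_x (f x ^+ (p * i))).
  under eq_Rintegral do rewrite gE.
  rewrite mean_sum; last first.
    move=> i; case: (i == ord0); first exact: bounded_mfun_cst.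
    apply: bounded_mfunM; first exact: bounded_mfun_cst.
    exact: bounded_mfunX.
  apply: eq_bigr => i _; case: ifP => _; first by rewrite mean_cst.
  by rewrite meanZ//; exact: bounded_mfunX.
have gm : \int[m_ n]_x g x @[n --> \oo] --> \int[m]_x g x.
  under eq_fun do rewrite mg.
  rewrite mg; apply: cvg_sumr => i; case: (i == ord0); first exact: cvg_cst.
  by apply: cvgM; [exact: cvg_cst|exact: fj].
have bi s' : bounded_mfun (\1_[set x | s' < f x] : T -> R).
  exact: bounded_mfun_indic.
have be : @bounded_mfun _ T R (fun=> e / 4) by exact: bounded_mfun_cst.
have gle (n : probability T R) : \int[n]_x g x - e / 4 <= fine (n [set x | r < f x]).
  rewrite -mean_indic// lerBlDr -(mean_cst n (e / 4)) -meanD//.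
  apply: mean_le => //; first exact: bounded_mfunD.
  move=> x; have /andP[h0 h1] := fp01 x; rewrite indicE; have [rf|fr] := ltP r (f x).
    rewrite mem_set//= /g.
    have : 0 <= (1 - f x ^+ p) ^+ q by rewrite exprn_ge0 ?subr_ge0.
    by rewrite /=; lra.
  rewrite memNset/=; last by apply/negP; rewrite -leNgt.
  rewrite add0r (le_trans _ pq1)// (le_trans (bernoulli_le q (fp01 x)))//.
  rewrite ler_wpM2l// lerXn2r// ?nnegrE ?(ltW r0)//.
  by have /andP[] := f01 x.
have geg : fine (m [set x | s < f x]) <= \int[m]_x g x + e / 4.
  rewrite -mean_indic// -(mean_cst m (e / 4)) -meanD//.
  apply: mean_le => //; first exact: bounded_mfunD.
  move=> x; rewrite indicE; have [sf|fs] := ltP s (f x); last first.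
    rewrite memNset/=; last by apply/negP; rewrite -leNgt.
    have /andP[p0 p1] := fp01 x.
    have : (1 - f x ^+ p) ^+ q <= 1 by apply: exprn_ile1; lra.
    by rewrite /g /=; lra.
  rewrite mem_set//= /g.
  have sp : s ^+ p <= f x ^+ p.
    rewrite lerXn2r// ?nnegrE ?ltW// ?(lt_trans r0)//.
    by rewrite (lt_trans _ sf)// (lt_trans r0).
  have s0 : 0 < s ^+ p by rewrite exprn_gt0// (lt_trans r0).
  have h := bernoulli_inv_le q (fp01 x).
  have d0 : 0 < 1 + q%:R * f x ^+ p.
    by rewrite ltr_wpDr// mulr_ge0//; have /andP[] := fp01 x.
  have : (1 - f x ^+ p) ^+ q <= e / 4.
    apply: le_trans pq2; apply: (@le_trans _ _ (1 + q%:R * f x ^+ p)^-1).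
      by rewrite -[leRHS]mul1r ler_pdivlMr.
    rewrite lef_pV2 ?posrE//; last by rewrite ltr_wpDr// mulr_ge0// ltW.
    by rewrite lerD2l ler_wpM2l.
  by rewrite /=; lra.
move/cvgrPdist_le : gm => /(_ _ e4) gm.
near=> n.
have /ler_normlP[_ gn] : `|\int[m]_x g x - \int[m_ n]_x g x| <= e / 4 by near: n.
by have := gle (m_ n); lra.
Unshelve. all: end_near. Qed.

(** The moments of 1 - f converge as well. A lower bound on the mass below [r] is an upper bound on
    the mass of the complement, so this and [moments_liminf] together enclose a distribution
    function. *)
Lemma moments_limsup (f : T -> R) (r e : R) :
  measurable_fun setT f -> (forall x, 0 <= f x <= 1) ->
  (forall j : nat, \int[m_ n]_x (f x ^+ j) @[n --> \oo] --> \int[m]_x (f x ^+ j)) ->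
  r < 1 -> 0 < e ->
  \forall n \near \oo,
    fine (m [set x | f x < r]) - e <= fine (m_ n [set x | f x < r]).
Proof.
move=> mf f01 fj r1 e0.
have bf : bounded_mfun f.
  by split => //; exists 1 => x; have /andP[? ?] := f01 x; rewrite ger0_norm.
have -> : [set x | f x < r] = [set x | 1 - r < 1 - f x].
  by apply/seteqP; split => x /=; rewrite ltrD2l ltrN2.
apply: moments_liminf => //.
- exact: measurable_funB.
- by move=> x; have /andP[? ?] := f01 x; apply/andP; split; lra.
- move=> j.
  have E (n : probability T R) : \int[n]_x ((1 - f x) ^+ j) =
      \sum_(i < j.+1) ((-1) ^+ i *+ 'C(j, i)) * \int[n]_x (f x ^+ i).
    under eq_Rintegral do rewrite exprBn.
    rewrite mean_sum.
      apply: eq_bigr => i _; rewrite -meanZ; last exact: bounded_mfunX.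
      by apply: eq_Rintegral => x _; rewrite expr1n mulr1 mulrnAl.
    move=> i; under eq_fun do rewrite expr1n mulr1 -mulrnAl.
    apply: bounded_mfunM; first exact: bounded_mfun_cst.
    exact: bounded_mfunX.
  under eq_fun do rewrite E.
  rewrite E; apply: cvg_sumr => i.
  by apply: cvgM; [exact: cvg_cst|exact: fj].
- by rewrite subr_gt0.
Qed.

End moments.

(** * Distribution functions *)

Lemma mean_indic_cvg {d : measure_display} {T : measurableType d} {R : realType}
    (m : probability T R) (A : nat -> set T) (B : set T) :
  (forall n, measurable (A n)) -> measurable B ->
  (forall x, \forall n \near \oo, A n x <-> B x) ->
  fine (m (A n)) @[n --> \oo] --> fine (m B).
Proof.
move=> mA mB AB; rewrite -mean_indic//.
under eq_fun do rewrite -mean_indic//.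
apply: (@mean_bounded_cvg _ _ _ _ _ _ 1).
- by move=> n; exact: measurable_indic.
- by near=> n => x; rewrite indicE; case: (_ \in _); rewrite ?normr1 ?normr0.
- move=> x; apply: cvg_near_cst; have := AB x; apply: filterS => n ABn.
  rewrite !indicE; congr (_%:R); congr nat_of_bool.
  by apply/idP/idP; rewrite !inE => /ABn.
Unshelve. all: end_near. Qed.

Section probability_fine.
Context {d : measure_display} {T : measurableType d} {R : realType}.
Variable m : probability T R.
Implicit Types A B : set T.

Lemma prob_ge0 A : 0 <= fine (m A).
Proof. exact: fine_ge0. Qed.

Lemma prob_le A B : measurable A -> measurable B -> A `<=` B ->
  fine (m A) <= fine (m B).
Proof.
by move=> mA mB AB; rewrite fine_le ?fin_num_measure// le_measure ?inE.
Qed.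

Lemma prob_le1 A : measurable A -> fine (m A) <= 1.
Proof.
move=> mA; rewrite -lee_fin fineK ?fin_num_measure//; exact: probability_le1.
Qed.

Lemma prob_setT : fine (m setT) = 1.
Proof. by rewrite -[RHS]/(fine 1%E); congr fine; exact: probability_setT. Qed.

Lemma probU A B : measurable A -> measurable B -> A `&` B = set0 ->
  fine (m (A `|` B)) = fine (m A) + fine (m B).
Proof.
by move=> mA mB AB; rewrite measureU// fineD ?fin_num_measure.
Qed.

Lemma probC A : measurable A -> fine (m (~` A)) = 1 - fine (m A).
Proof.
move=> mA; rewrite -prob_setT -(setUv A) probU ?setICr//; first by ring.
exact: measurableC.
Qed.

End probability_fine.

(* Left-continuous distribution function; [dist_fun P Y] is the one of the law
   of [Y]. *)
Definition law_fun {R : realType} (m : probability R R) (x : R) : R :=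
  fine (m [set y | y < x]).

Definition atomless {R : realType} (m : probability R R) : Prop :=
  forall x, m [set x] = 0%E.

Section law_fun.
Context {R : realType}.
Implicit Types (m : probability R R) (x y : R).

Lemma setNlt x : [set y | y < x] = `]-oo, x[%classic.
Proof. by apply/seteqP; split => y /=; rewrite in_itv. Qed.

Lemma measurable_lt x : measurable [set y | y < x].
Proof. by rewrite setNlt. Qed.

Lemma measurable_gt x : measurable [set y : R | x < y].
Proof.
have -> : [set y | x < y] = `]x, +oo[%classic => //.
by apply/seteqP; split => y /=; rewrite in_itv/= ?andbT.
Qed.

Lemma atomless_fine m x : atomless m -> fine (m [set x]) = 0.
Proof. by move=> ->. Qed.

Lemma law_funE m x : atomless m -> law_fun m x = fine (m `]-oo, x]%classic).
Proof.
move=> ma; rewrite -(@setUitv1 _ _ _ _ true) ?bnd_simp// probU//; last first.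
  by apply/seteqP; split => // y /= [yx yE]; move: yx; rewrite yE in_itv/= ltxx.
by rewrite atomless_fine// addr0 /law_fun setNlt.
Qed.

Lemma prob_gtE m x : atomless m -> fine (m [set y | x < y]) = 1 - law_fun m x.
Proof.
move=> ma; rewrite law_funE// -probC//; congr (fine (m _)).
by rewrite setCitvl; apply/seteqP; split => y /=; rewrite in_itv/= andbT.
Qed.

Lemma prob_itv m x y : x <= y -> fine (m `[x, y[%classic) = law_fun m y - law_fun m x.
Proof.
move=> xy; have -> : law_fun m y = law_fun m x + fine (m `[x, y[%classic).
  rewrite /law_fun -probU//; last 2 first.
  - exact: measurable_lt.
  - apply/seteqP; split => // z /= [+]; rewrite in_itv/= => h /andP[+ _].
    by rewrite leNgt h.
  congr (fine (m _)); apply/seteqP; split => z /=; rewrite in_itv/=.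
    by move=> zy; have [|] := ltP z x; [left|right].
  by move=> [/lt_le_trans|/andP[]//]; exact.
by ring.
Qed.

Lemma law_fun_continuous m : atomless m -> continuous (law_fun m).
Proof.
move=> ma x; apply/(@cvg_nbhsP _ R^o) => u ux.
(* Deleting the null point [x] makes the indicators of [z < u n] converge everywhere; at [z = x]
   they could oscillate with the sign of [u n - x]. *)
have E y : law_fun m y = fine (m ([set z | z < y] `\ x)).
  rewrite /law_fun; have [xy|yx] := ltP x y; last first.
    congr (fine (m _)); apply/seteqP; split => z /=; last by case.
    by move=> zy; split => //; move=> zx; move: zy; rewrite zx ltNge yx.
  rewrite -[in LHS](@setDUK _ [set x] [set z | z < y]) ?setDE//; last by move=> z /= ->.
  rewrite -setDE probU ?atomless_fine ?add0r//.
    by apply: measurableD => //; exact: measurable_lt.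
  by rewrite setDE setIC -setIA [X in _ `&` X]setIC setICr setI0.
suff H : fine (m ([set z | z < u n] `\ x)) @[n --> \oo] -->
    fine (m ([set z | z < x] `\ x)).
  by move: H; rewrite -E; under eq_fun do rewrite -E.
apply: (@mean_indic_cvg _ _ _ m (fun n => [set z | z < u n] `\ x)).
- by move=> n; by apply: measurableD => //; exact: measurable_lt.
- by apply: measurableD => //; exact: measurable_lt.
- move=> z; have [zx|xz|->] := ltgtP z x.
  + have : \forall n \near \oo, z < u n by apply: cvgr_gt ux _ zx.
    apply: filterS => n zu; split => -[/= _ ?]; split => //=.
  + have : \forall n \near \oo, u n < z by apply: cvgr_lt ux _ xz.
    apply: filterS => n zu; split => -[/=] h; first by move: h; rewrite ltNge (ltW zu).
    by move: h; rewrite ltNge (ltW xz).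
  + by near=> n; split => -[_ /=].
Unshelve. all: end_near. Qed.

Lemma law_fun_ge1B m (e : R) : 0 < e -> exists2 A : nat, 1 - e <= law_fun m A%:R &
  law_fun m (- A%:R) <= e.
Proof.
move=> e0.
have c1 : fine (m [set y | y < n%:R]) @[n --> \oo] --> fine (m setT).
  apply: mean_indic_cvg => //; first by move=> n; exact: measurable_lt.
  by move=> y; near=> n; split => //= _; near: n; exact: nbhs_infty_gtr.
have c2 : fine (m [set y | y < - n%:R]) @[n --> \oo] --> fine (m set0).
  apply: mean_indic_cvg => //; first by move=> n; exact: measurable_lt.
  move=> y; near=> n; split => //=; rewrite ltNge => /negP; apply.
  by rewrite lerNl ltW//; near: n; exact: nbhs_infty_gtr.
move/cvgrPdist_le : c1 => /(_ _ e0) c1; move/cvgrPdist_le : c2 => /(_ _ e0) c2.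
near \oo => A; exists A.
- have /ler_normlP[_] : `|fine (m setT) - fine (m [set y | y < A%:R])| <= e.
    by near: A.
  by rewrite prob_setT /law_fun; lra.
- have /ler_normlP[+ _] : `|fine (m set0) - fine (m [set y | y < - A%:R])| <= e.
    by near: A.
  by rewrite measure0/= /law_fun sub0r opprK.
Unshelve. all: end_near. Qed.

Section step_approximation.
Variables (h : R -> R) (K B a del : R).
Hypothesis hK : forall x y, `|h x - h y| <= K * `|x - y|.
Hypothesis hB : forall x, `|h x| <= B.
Hypotheses (K0 : 0 <= K) (del0 : 0 <= del).

Let g i : R := a + i%:R * del.
Let s J (x : R) : R := \sum_(i < J) h (g i) * \1_(`[g i, g i.+1[%classic) x.

Let g_le i : g i <= g i.+1.
Proof. by rewrite /g lerD2l ler_wpM2r// ler_nat. Qed.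

Let g_ge i : a <= g i.
Proof. by rewrite /g lerDl mulr_ge0. Qed.

Let s_close J x : `|h x - s J x| <= K * del + B * (1 - \1_(`[a, g J[%classic) x).
Proof.
have [K1 B0] : 0 <= K * del /\ 0 <= B.
  by rewrite mulr_ge0//; split => //; exact: le_trans (hB 0).
have : (x \in `[a, g J[ -> `|h x - s J x| <= K * del) /\
       (x \notin `[a, g J[ -> s J x = 0).
  elim: J => [|J [ih1 ih2]].
    rewrite /s big_ord0; split => //; rewrite in_itv/= /g mul0r addr0.
    by move=> /andP[/le_lt_trans h1 /h1]; rewrite ltxx.
  rewrite /s big_ord_recr/= -/(s J x) indicE.
  have [xJ|Jx] := ltP x (g J).
    have -> : (x \in `[g J, g J.+1[%classic) = false.
      by apply/negbTE; rewrite notin_setE/= in_itv/= leNgt xJ.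
    rewrite mulr0 addr0; split => [xi|xi].
      by apply: ih1; move: xi; rewrite !in_itv/= xJ => /andP[->].
    apply: ih2; move: xi; rewrite !in_itv/= xJ andbT.
    by rewrite (lt_le_trans xJ)// andbT.
  have sJ : s J x = 0 by apply: ih2; rewrite in_itv/= ltNge Jx andbF.
  rewrite sJ add0r; split => [|xi].
    rewrite in_itv/= => /andP[ax xg].
    rewrite mem_set/= ?in_itv/= ?Jx// mulr1 (le_trans (hK _ _))//.
    rewrite ler_wpM2l// ger0_norm ?subr_ge0// lerBlDr.
    by move: xg; rewrite /g -natr1 => /ltW/le_trans; apply; lra.
  rewrite memNset ?mulr0//= in_itv/=; move: xi; rewrite in_itv/= (le_trans (g_ge J))//.
  by rewrite /= Jx/= => /negP.
move=> [h1 h2]; rewrite indicE; have [xi|xi] := boolP (x \in `[a, g J[).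
  by rewrite mem_set//= subrr mulr0 addr0 h1.
rewrite memNset//=; last exact/negP.
by rewrite h2// !subr0 mulr1 (le_trans (hB x))// lerDr.
Qed.

(** The mean of [h] is replaced by an expression in finitely many values of [law_fun m]. The step
    function takes the value of [h] at the left end of each cell: it errs by at most [K * del]
    inside the grid and by [B] outside. *)
Lemma step_approximation m J : measurable_fun setT h ->
  `|\int[m]_x h x - \sum_(i < J) h (g i) * (law_fun m (g i.+1) - law_fun m (g i))|
  <= K * del + B * (1 - (law_fun m (g J) - law_fun m a)).
Proof.
move=> mh.
have bh : bounded_mfun h by split => //; exists B.
have bI (x y : R) : bounded_mfun (\1_(`[x, y[%classic) : R -> R).
  exact: bounded_mfun_indic.
have bs i : bounded_mfun (fun x => h (g i) * \1_(`[g i, g i.+1[%classic) x).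
  by apply: bounded_mfunM => //; exact: bounded_mfun_cst.
have bS : bounded_mfun (s J) by exact: bounded_mfun_sum.
have -> : \sum_(i < J) h (g i) * (law_fun m (g i.+1) - law_fun m (g i)) =
    \int[m]_x s J x.
  rewrite mean_sum//; apply: eq_bigr => i _; rewrite meanZ// mean_indic//.
  by rewrite prob_itv.
rewrite -meanB// (le_trans (norm_mean _ (bounded_mfunB bh bS)))//.
have b1 : @bounded_mfun _ R R (fun=> 1) by exact: bounded_mfun_cst.
have b2 : bounded_mfun (fun x => B * (1 - \1_(`[a, g J[%classic) x)).
  apply: bounded_mfunM; first exact: bounded_mfun_cst.
  exact: bounded_mfunB.
have b3 : @bounded_mfun _ R R (fun=> K * del) by exact: bounded_mfun_cst.
apply: (@le_trans _ _ (\int[m]_x (K * del + B * (1 - \1_(`[a, g J[%classic) x)))).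
  apply: mean_le => //.
  - by apply: bounded_mfun_norm; exact: bounded_mfunB.
  - exact: bounded_mfunD.
rewrite meanD// mean_cst meanZ; last exact: bounded_mfunB.
by rewrite meanB// mean_cst mean_indic// prob_itv.
Qed.

End step_approximation.

(** The grid is fitted to the limit [m] alone; the mass that [m_ n] leaves outside it is controlled
    by convergence at its two end points. *)
Lemma law_fun_cvg_mean (m_ : nat -> probability R R) m (h : R -> R) (K B : R) :
  0 <= K ->
  (forall x y, `|h x - h y| <= K * `|x - y|) -> (forall x, `|h x| <= B) ->
  measurable_fun setT h ->
  (forall x, law_fun (m_ n) x @[n --> \oo] --> law_fun m x) ->
  \int[m_ n]_x h x @[n --> \oo] --> \int[m]_x h x.
Proof.
move=> K0 hK hB mh cF; apply/cvgrPdist_le => e e0.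
have B0 : 0 <= B by exact: le_trans (hB 0).
(* Error budget: [e / 16 + e / 4] for [m], [e / 16 + e / 2] for [m_ n], and [e / 8] between the two
   step sums, [e] in all. The tails of [m] weigh at most [2 * e'], those of [m_ n] at most
   [4 * e']. *)
pose e' := e / (8 * (B + 1)).
have e'0 : 0 < e' by rewrite divr_gt0// mulr_gt0// ltr_wpDl.
have Be' : B * e' <= e / 8.
  rewrite /e' mulrA ler_pdivrMr; last by rewrite mulr_gt0// ltr_wpDl.
  by rewrite mulrAC mulrCA mulrA; nra.
have [A A1 A2] := law_fun_ge1B m e'0.
(* Enough cells for [K] times the mesh [2 * A%:R / J%:R] to stay below [e / 16]. *)
pose J := (Num.truncn (32 * (A%:R * (K + 1)) / e)).+1.
have J0 : 0 < J%:R :> R by [].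
pose del := 2 * A%:R / J%:R : R.
have del0 : 0 <= del by rewrite divr_ge0// mulr_ge0.
have Kdel : K * del <= e / 16.
  rewrite /del mulrA ler_pdivrMr//.
  have : 32 * (A%:R * (K + 1)) / e < J%:R by rewrite /J truncnS_gt.
  rewrite ltr_pdivrMr// => h1.
  have : 0 <= A%:R :> R by [].
  by nra.
have gJ : - A%:R + J%:R * del = A%:R :> R.
  by rewrite /del mulrC divfK ?gt_eqF//; ring.
have S n := @step_approximation h K B (- A%:R) del hK hB K0 del0 n J mh.
rewrite gJ in S.
pose s (n : probability R R) := \sum_(i < J) h (- A%:R + i%:R * del) *
    (law_fun n (- A%:R + i.+1%:R * del) - law_fun n (- A%:R + i%:R * del)).
have cs : s (m_ n) @[n --> \oo] --> s m.
  apply: cvg_sumr => i; apply: cvgM; first exact: cvg_cst.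
  by apply: cvgB; exact: cF.
have e8 : 0 < e / 8 by rewrite divr_gt0.
move/cvgrPdist_le : cs => /(_ _ e8) cs.
move/cvgrPdist_le : (cF A%:R) => /(_ _ e'0) cA.
move/cvgrPdist_le : (cF (- A%:R)) => /(_ _ e'0) cA'.
near=> n.
have s1 : `|s m - s (m_ n)| <= e / 8 by near: n.
have s2 : `|law_fun m A%:R - law_fun (m_ n) A%:R| <= e' by near: n.
have s3 : `|law_fun m (- A%:R) - law_fun (m_ n) (- A%:R)| <= e' by near: n.
have h1 := S m; have h2 := S (m_ n); rewrite -/(s m) in h1; rewrite -/(s (m_ n)) in h2.
have h3 : B * (1 - (law_fun m A%:R - law_fun m (- A%:R))) <= e / 4.
  have : 1 - (law_fun m A%:R - law_fun m (- A%:R)) <= 2 * e' by lra.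
  by move=> /(ler_wpM2l B0) /le_trans; apply; lra.
have h4 : B * (1 - (law_fun (m_ n) A%:R - law_fun (m_ n) (- A%:R))) <= e / 2.
  have : 1 - (law_fun (m_ n) A%:R - law_fun (m_ n) (- A%:R)) <= 4 * e'.
    by move/ler_normlP : s2 => [? ?]; move/ler_normlP : s3 => [? ?]; lra.
  by move=> /(ler_wpM2l B0) /le_trans; apply; lra.
move/ler_normlP : h1 => [? ?]; move/ler_normlP : h2 => [? ?].
move/ler_normlP : s1 => [? ?].
by apply/ler_normlP; split; lra.
Unshelve. all: end_near. Qed.

End law_fun.

(** * The continuity theorem *)

Section continuity_theorem.
Context {R : realType}.
Variables (m_ : nat -> probability R R) (m : probability R R).
Hypothesis cvg_cos : forall u,
  \int[m_ n]_x cos (u * x) @[n --> \oo] --> \int[m]_x cos (u * x).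
Hypothesis cvg_sin : forall u,
  \int[m_ n]_x sin (u * x) @[n --> \oo] --> \int[m]_x sin (u * x).

Let bcos (u : R) : bounded_mfun (fun x : R => cos (u * x)).
Proof. by apply: bounded_mfun_cos; exact: measurable_funM. Qed.

Let bsin (u : R) : bounded_mfun (fun x : R => sin (u * x)).
Proof. by apply: bounded_mfun_sin; exact: measurable_funM. Qed.

Let mean_phase (n : probability R R) u c : \int[n]_x cos (u * x - c) =
  cos c * \int[n]_x cos (u * x) + sin c * \int[n]_x sin (u * x).
Proof.
rewrite -!meanZ// -meanD; last 2 first.
- by apply: bounded_mfunM => //; exact: bounded_mfun_cst.
- by apply: bounded_mfunM => //; exact: bounded_mfun_cst.
by apply: eq_Rintegral => x _; rewrite cosB; ring.
Qed.

(** The Gaussian factor is itself a Gaussian mean of cosines. By Fubini each side becomes a Gaussian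
    average of characteristic functions, to which bounded convergence applies. The factor
    [cos (t * x)] is there for the Laplace transforms further on. *)
Lemma cvg_gauss_bump s b t :
  \int[m_ n]_x (expR (- (2^-1 * (s * (x - b)) ^+ 2)) * cos (t * x)) @[n --> \oo] -->
  \int[m]_x (expR (- (2^-1 * (s * (x - b)) ^+ 2)) * cos (t * x)).
Proof.
pose k (p : R * R) := cos (s * (p.1 - b) * p.2) * cos (t * p.1).
have m1 : measurable_fun setT (fun p : R * R => s * (p.1 - b) * p.2).
  by apply: measurable_funM => //; apply: measurable_funM => //; exact: measurable_funB.
have m2 : measurable_fun setT (fun p : R * R => t * p.1).
  by apply: measurable_funM.
have bk : bounded_mfun k.
  by apply: bounded_mfunM; exact: bounded_mfun_cos.
have E (n : probability R R) :
    \int[n]_x (expR (- (2^-1 * (s * (x - b)) ^+ 2)) * cos (t * x)) =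
    \int[gauss R]_z (2^-1 * (\int[n]_x cos ((s * z + t) * x - s * b * z) +
                             \int[n]_x cos ((s * z - t) * x - s * b * z))).
  transitivity (\int[n]_x \int[gauss R]_z k (x, z)).
    apply: eq_Rintegral => x _; rewrite -mean_gauss_cos mulrC -meanZ//.
    by apply: eq_Rintegral => z _; rewrite /k /= mulrC.
  rewrite mean_fubini//; apply: eq_Rintegral => z _.
  have bc (u c : R) : bounded_mfun (fun x : R => cos (u * x - c)).
    by apply: bounded_mfun_cos; apply: measurable_funB => //; exact: measurable_funM.
  rewrite -meanD// -meanZ; last exact: bounded_mfunD.
  apply: eq_Rintegral => x _; rewrite /k /=.
  rewrite (_ : (s * z + t) * x - s * b * z = s * (x - b) * z + t * x); last by ring.
  rewrite (_ : (s * z - t) * x - s * b * z = s * (x - b) * z - t * x); last by ring.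
  by rewrite cosD cosB; field.
under eq_fun do rewrite E.
have mphi (n : probability R R) : measurable_fun setT (fun z : R =>
   2^-1 * (\int[n]_x cos ((s * z + t) * x - s * b * z) +
                             \int[n]_x cos ((s * z - t) * x - s * b * z))).
  have aux (v : R) : measurable_fun setT (fun z : R => \int[n]_x cos ((s * z + v) * x - s * b * z)).
    pose k' (p : R * R) := cos ((s * p.1 + v) * p.2 - s * b * p.1).
    have bk' : bounded_mfun k'.
      apply: bounded_mfun_cos; apply: measurable_funB.
        by apply: measurable_funM => //; apply: measurable_funD => //; exact: measurable_funM.
      exact: measurable_funM.
    by have [] := bounded_mfun_mean (gauss R) n bk'.
  by apply: measurable_funM => //; apply: measurable_funD; exact: aux.
rewrite E; apply: (@mean_bounded_cvg _ _ _ _ _ _ 1).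
- by move=> n; exact: mphi.
- near=> n => z.
  have B u c : `|\int[m_ n]_x cos (u * x - c)| <= 1.
    apply: mean_norm_le; last by move=> x; exact: cos_max.
    apply: measurableT_comp; first exact: measurable_cos.
    by apply: measurable_funB => //; exact: measurable_funM.
  have /ler_normlP[? ?] := B (s * z + t) (s * b * z).
  have /ler_normlP[? ?] := B (s * z - t) (s * b * z).
  by apply/ler_normlP; split; lra.
- move=> z; apply: cvgM; first exact: cvg_cst.
  have C u c : \int[m_ n]_x cos (u * x - c) @[n --> \oo] --> \int[m]_x cos (u * x - c).
    rewrite mean_phase; under eq_fun do rewrite mean_phase.
    by apply: cvgD; apply: cvgM => //; exact: cvg_cst.
  exact: cvgD.
Unshelve. all: end_near. Qed.

(** An open interval is a superlevel set of a Gaussian bump at its midpoint, and the j-th power of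
    that bump is a bump scaled by sqrt j: its moments converge by [cvg_gauss_bump]. *)
Let open_interval_liminf p q e : p < q -> 0 < e ->
  \forall n \near \oo,
    fine (m [set x | p < x < q]) - e <= fine (m_ n [set x | p < x < q]).
Proof.
move=> pq e0; pose b := (p + q) / 2; pose w := (q - p) / 2.
have w0 : 0 < w by rewrite divr_gt0// subr_gt0.
pose f x := expR (- (2^-1 * (x - b) ^+ 2)).
have -> : [set x | p < x < q] = [set x | expR (- (2^-1 * w ^+ 2)) < f x].
  have key x : (expR (- (2^-1 * w ^+ 2)) < f x) = (p < x < q).
    rewrite /f ltr_expR ltrN2 ltr_pM2l ?invr_gt0//.
    rewrite -(real_normK (num_real (x - b))) ltr_pXn2r ?nnegrE// ?ltW//.
    by rewrite ltr_distl /b /w; congr (_ && _); apply/idP/idP => ?; lra.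
  by apply/seteqP; split => x /=; rewrite key.
have mf : measurable_fun setT f.
  apply: measurableT_comp => //; apply: measurableT_comp => //.
  apply: measurable_funM => //; apply: measurable_funX; exact: measurable_funB.
apply: moments_liminf => //.
- move=> x; rewrite /f expR_ge0 expR_le1 oppr_le0 mulr_ge0 ?sqr_ge0//.
- move=> j; have E (n : probability R R) : \int[n]_x (f x ^+ j) =
      \int[n]_x (expR (- (2^-1 * (Num.sqrt j%:R * (x - b)) ^+ 2)) * cos (0 * x)).
    apply: eq_Rintegral => x _; rewrite mul0r cos0 mulr1 /f -expRM_natl.
    by congr expR; rewrite exprMn sqr_sqrtr//; ring.
  rewrite E; under eq_fun do rewrite E.
  exact: cvg_gauss_bump.
- exact: expR_gt0.
Qed.

Let measurable_oo (p q : R) : measurable [set x | p < x < q].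
Proof.
have -> : [set x | p < x < q] = `]p, q[%classic => //.
Qed.

(** Two long open intervals, ending and starting at [x], carry all but [e] of the mass of [m].
    Asymptotic lower bounds on both suffice, because their masses under [m_ n] add up to at most
    1. *)
Theorem continuity_theorem x : atomless m ->
  law_fun (m_ n) x @[n --> \oo] --> law_fun m x.
Proof.
move=> ma; apply/cvgrPdist_le => e e0.
have e2 : 0 < e / 2 by rewrite divr_gt0.
have cl : fine (m [set y | x - j.+1%:R < y < x]) @[j --> \oo] --> fine (m [set y | y < x]).
  apply: mean_indic_cvg => //; first exact: measurable_lt.
  move=> y; near=> j; split => /= [/andP[]//|yx]; rewrite yx andbT ltrBlDr -ltrBlDl.
  rewrite (@lt_trans _ _ j%:R) ?ltr_nat//.
  by near: j; exact: nbhs_infty_gtr.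
have cr : fine (m [set y | x < y < x + j.+1%:R]) @[j --> \oo] --> fine (m [set y | x < y]).
  apply: mean_indic_cvg => //; first exact: measurable_gt.
  move=> y; near=> j; split => /= [/andP[]//|yx]; rewrite yx/= -ltrBlDl.
  rewrite (@lt_trans _ _ j%:R) ?ltr_nat//.
  by near: j; exact: nbhs_infty_gtr.
move/cvgrPdist_le : cl => /(_ _ e2)[j _ /(_ j (leqnn _)) /ler_normlP[_ hl]].
move/cvgrPdist_le : cr => /(_ _ e2)[i _ /(_ i (leqnn _)) /ler_normlP[_ hr]].
have jx : x - j.+1%:R < x by rewrite ltrBlDr ltrDl.
have ix : x < x + i.+1%:R by rewrite ltrDl.
near=> n.
have h1 : fine (m [set y | x - j.+1%:R < y < x]) - e / 2 <=
    fine (m_ n [set y | x - j.+1%:R < y < x]).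
  by near: n; exact: open_interval_liminf.
have h2 : fine (m [set y | x < y < x + i.+1%:R]) - e / 2 <=
    fine (m_ n [set y | x < y < x + i.+1%:R]).
  by near: n; exact: open_interval_liminf.
have h3 : fine (m_ n [set y | x - j.+1%:R < y < x]) <= law_fun (m_ n) x.
  by apply: prob_le => //; [exact: measurable_lt|move=> y /= /andP[]].
have h4 : fine (m_ n [set y | x < y < x + i.+1%:R]) + law_fun (m_ n) x <= 1.
  rewrite /law_fun -probU//; last 2 first.
  - exact: measurable_lt.
  - by apply/seteqP; split => // y /= [/andP[xy _]]; rewrite ltNge (ltW xy).
  by apply: prob_le1; apply: measurableU => //; exact: measurable_lt.
rewrite prob_gtE// in hr; rewrite -/(law_fun m x) in hl.
by apply/ler_normlP; split; lra.
Unshelve. all: end_near. Qed.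

End continuity_theorem.

(** * Sums of independent variables *)

Lemma eq_measure_rectangles {d1 d2 : measure_display} {T1 : measurableType d1}
    {T2 : measurableType d2} {R : realType}
    (m1 m2 : {measure set (T1 * T2) -> \bar R}) :
  (m1 setT < +oo)%E ->
  (forall A B, measurable A -> measurable B -> m1 (A `*` B) = m2 (A `*` B)) ->
  forall Z, measurable Z -> m1 Z = m2 Z.
Proof.
move=> m1oo m12.
pose C : set (set (T1 * T2)) :=
  [set C | exists A, measurable A /\ exists B, measurable B /\ C = A `*` B].
have CI : setI_closed C.
  move=> /= _ _ [X1 [mX1 [X2 [mX2 ->]]]] [Y1 [mY1 [Y2 [mY2 ->]]]].
  rewrite -setXI; exists (X1 `&` Y1); split; first exact: measurableI.
  by exists (X2 `&` Y2); split => //; exact: measurableI.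
apply: (measure_unique C (fun=> setT)) => //.
- rewrite measurable_prod_measurableType //; congr (<<s _ >>).
  rewrite predeqE; split => [[A mA [B mB <-]]|[A [mA [B [mB ->]]]]].
    by exists A; split => //; exists B.
  by exists A => //; exists B.
- by move=> n; exists setT; split => //; exists setT; split => //; rewrite setXTT.
- by rewrite bigcup_const//; exists 0%N.
- by move=> A [A1 [mA1 [A2 [mA2 ->]]]]; exact: m12.
Qed.

Section partial_sums.
Context {d : measure_display} {T : measurableType d} {R : realType}.
Variables (P : probability T R) (X : nat -> {RV P >-> R}).

Lemma measurable_partial_sum k : measurable_fun setT (partial_sum X k).
Proof. by apply: measurable_sum => i; exact: measurable_funP. Qed.

HB.instance Definition _ k := isMeasurableFun.Build _ _ _ _
  (partial_sum X k) (measurable_partial_sum k).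

Lemma partial_sumS k w : partial_sum X k.+1 w = partial_sum X k w + X k w.
Proof. by rewrite /partial_sum big_ord_recr. Qed.

Lemma measurable_random_sum (N : {RV P >-> nat}) :
  measurable_fun setT (fun w => partial_sum X (N w) w).
Proof.
move=> _ A mA; rewrite setTI.
have -> : (fun w => partial_sum X (N w) w) @^-1` A =
    \bigcup_k ((N @^-1` [set k]) `&` (partial_sum X k @^-1` A)).
  apply/seteqP; split => w /=; first by move=> h; exists (N w).
  by move=> [k _ [/= <-]].
apply: bigcup_measurable => k _; apply: measurableI.
  by rewrite -[X in measurable X]setTI; exact: measurable_funP.
by rewrite -[X in measurable X]setTI; exact: measurable_partial_sum.
Qed.

Definition sum_law k : probability R R := distribution P (partial_sum X k).

Variable N : {RV P >-> nat}.
Hypothesis indep : mutually_independent P (sigma_family N X).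

Let event (s : seq (option nat)) (E : option nat -> set T) :=
  \bigcap_(i in [set` s]) E i.

Let sigma_familyP i (A : set T) : sigma_family N X i A -> measurable A.
Proof.
case: i => [j|] [B mB <-]; rewrite setTI.
  by rewrite -[X in measurable X]setTI; exact: measurable_funP.
by rewrite -[X in measurable X]setTI; exact: measurable_funP.
Qed.

Let measurable_event s E : (forall i, i \in s -> sigma_family N X i (E i)) ->
  measurable (event s E).
Proof.
move=> sE; apply: fin_bigcap_measurable => [|i /= si]; first exact: finite_seq.
by apply: sigma_familyP; exact: sE.
Qed.

Let sigma_family_some j (B : set R) : measurable B ->
  sigma_family N X (Some j) (X j @^-1` B).
Proof. by move=> mB; exists B => //; rewrite setTI. Qed.

Let event_cons s E j (A : set T) : Some j \notin s ->
  event (Some j :: s) (fun i => if i == Some j then A else E i) = event s E `&` A.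
Proof.
move=> js; apply/seteqP; split => w /=.
  move=> h; split.
    move=> i /= si; have := h i; rewrite /= inE si orbT => /(_ isT).
    by case: eqP => // ij; move: si; rewrite ij (negbTE js).
  by have := h (Some j); rewrite /= inE eqxx => /(_ isT).
move=> [h wA] i /=; rewrite inE => /orP[/eqP ->|si]; first by rewrite eqxx.
by case: eqP => // _; exact: h.
Qed.

Let sigma_family_cons s E j (B : set R) : measurable B ->
  (forall i, i \in s -> sigma_family N X i (E i)) ->
  forall i, i \in Some j :: s -> sigma_family N X i
    ((fun i => if i == Some j then X j @^-1` B else E i) i).
Proof.
move=> mB sE i; rewrite inE; case: eqP => [-> _|_ /= si]; last exact: sE.
exact: sigma_family_some.
Qed.

Let event_indep s E j (B : set R) : measurable B -> uniq s -> Some j \notin s ->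
  (forall i, i \in s -> sigma_family N X i (E i)) ->
  P (event s E `&` X j @^-1` B) = (P (event s E) * P (X j @^-1` B))%E.
Proof.
move=> mB us js sE; rewrite -(@event_cons _ _ j)// /event.
rewrite indep/=; last 2 first.
- by rewrite js.
- exact: sigma_family_cons.
rewrite big_cons eqxx muleC; congr (_ * _)%E.
rewrite indep//; apply: eq_big_seq => i si.
by case: eqP => // ij; move: si; rewrite ij (negbTE js).
Qed.

(** With [A] fixed, both sides are finite measures in [Z]: the image of [P] restricted to [A], and
    the product law scaled by [P A]. Agreement on rectangles therefore suffices. *)
Let joint_law (A : set T) (mA : measurable A) k (Z : set (R * R)) : measurable Z ->
  (forall B C, measurable B -> measurable C ->
    P (A `&` (partial_sum X k @^-1` B `&` X k @^-1` C)) =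
    (P A * (P (partial_sum X k @^-1` B) * P (X k @^-1` C)))%E) ->
  P (A `&` [set w | Z (partial_sum X k w, X k w)]) =
  (P A * (sum_law k \x distribution P (X k)) Z)%E.
Proof.
move=> mZ H.
have mp : measurable_fun setT (fun w => (partial_sum X k w, X k w)).
  by apply/measurable_fun_pairP; split => //; exact: measurable_partial_sum.
pose p : {mfun T >-> (R * R)%type} := HB.pack (fun w => (partial_sum X k w, X k w))
  (isMeasurableFun.Build _ _ _ _ _ mp).
have c0 : 0 <= fine (P A) by exact: prob_ge0.
pose m2 := mscale (NngNum c0) (sum_law k \x distribution P (X k))%E.
have Zx := @eq_measure_rectangles _ _ R R R
  [the measure _ _ of pushforward (mrestr P mA) p] [the measure _ _ of m2].
have PA : P A = (fine (P A))%:E by rewrite fineK// fin_num_measure.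
transitivity (pushforward (mrestr P mA) p Z).
  by rewrite /pushforward /mrestr setIC.
rewrite Zx//.
- by rewrite /m2 /= /mscale /= -PA.
- apply: (@le_lt_trans _ _ 1%E); last by rewrite ltry.
  rewrite /= /pushforward /mrestr; apply: probability_le1.
  by rewrite preimage_setT setTI.
- move=> B C mB mC; rewrite /m2 /= /mscale /= -PA product_measure1E// -H//.
  by rewrite /pushforward /mrestr setIC.
Qed.

(** [mutually_independent] speaks only of events on single variables, so summands enter the sum one
    by one. The statement is general in the event, which may involve any variables not yet summed:
    the induction step moves a condition on [X k] into it. *)
Let indep_from k s (E : option nat -> set T) (B : set R) :
  uniq s -> (forall i, i \in s -> sigma_family N X i (E i)) ->
  (forall j, Some j \in s -> (k <= j)%N) -> measurable B ->
  P (event s E `&` partial_sum X k @^-1` B) =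
  (P (event s E) * P (partial_sum X k @^-1` B))%E.
Proof.
elim: k s E B => [|k ih] s E B us sE sk mB.
  have S0 w : partial_sum X 0 w = 0 by rewrite /partial_sum big_ord0.
  have [B0|B0] := pselect (B 0).
    have -> : partial_sum X 0 @^-1` B = setT.
      by apply/seteqP; split => w //= _; rewrite S0.
    by rewrite setIT (_ : P setT = 1%E) ?mule1//; exact: probability_setT.
  have -> : partial_sum X 0 @^-1` B = set0.
    by apply/seteqP; split => w //=; rewrite S0.
  by rewrite setI0 measure0 mule0.
have ks : Some k \notin s by apply/negP => /sk; rewrite ltnn.
have mE : measurable (event s E) by exact: measurable_event.
have add_meas : measurable [set z : R * R | B (z.1 + z.2)].
  rewrite -[X in measurable X]setTI.
  have : measurable_fun setT (fun z : R * R => z.1 + z.2) by exact: measurable_funD.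
  exact.
have SE : partial_sum X k.+1 @^-1` B =
    [set w | [set z : R * R | B (z.1 + z.2)] (partial_sum X k w, X k w)].
  by apply/seteqP; split => w /=; rewrite partial_sumS.
have H (s' : seq (option nat)) (E' : option nat -> set T) : uniq s' ->
    (forall i, i \in s' -> sigma_family N X i (E' i)) ->
    (forall j, Some j \in s' -> (k < j)%N) ->
  P (event s' E' `&` partial_sum X k.+1 @^-1` B) =
  (P (event s' E') *
    (sum_law k \x distribution P (X k)) [set z : R * R | B (z.1 + z.2)%R]%classic)%E.
  move=> us' sE' sk'.
  have ks' : Some k \notin s' by apply/negP => /sk'; rewrite ltnn.
  rewrite SE joint_law//; first exact: measurable_event.
  move=> C D mC mD; rewrite setIA setIAC -(@event_cons _ _ k)// ih//.
  - rewrite event_cons// event_indep// -muleA; congr (_ * _)%E; exact: muleC.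
  - by rewrite /= ks'.
  - exact: sigma_family_cons.
  - move=> j; rewrite inE => /orP[/eqP[->]//|/sk']; exact: ltnW.
rewrite H//; congr (_ * _)%E.
(* The empty event identifies the product-law factor as the probability that the sum lies in [B]. *)
have := H [::] E isT; rewrite /event set_nil bigcap_set0 setTI.
rewrite (_ : P setT = 1%E) ?mul1e; last exact: probability_setT.
by move=> ->.
Qed.

Lemma indep_count_sum (B : set nat) k (D : set R) : measurable D ->
  P (N @^-1` B `&` partial_sum X k @^-1` D) =
  (P (N @^-1` B) * P (partial_sum X k @^-1` D))%E.
Proof.
move=> mD; have := @indep_from k [:: None] (fun=> N @^-1` B) D.
rewrite /event set_cons1 bigcap_set1; apply => //.
by move=> i; rewrite inE => /eqP ->; exists B => //; rewrite setTI.
Qed.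

Lemma sum_lawS k (D : set R) : measurable D ->
  sum_law k.+1 D =
  (sum_law k \x distribution P (X k))%E [set z : R * R | D (z.1 + z.2)].
Proof.
move=> mD.
have add_meas : measurable [set z : R * R | D (z.1 + z.2)].
  rewrite -[X in measurable X]setTI.
  have : measurable_fun setT (fun z : R * R => z.1 + z.2) by exact: measurable_funD.
  exact.
have PT : P setT = 1%E by exact: probability_setT.
have := @joint_law setT measurableT k _ add_meas; rewrite PT mul1e setTI.
move=> <-.
  rewrite /sum_law /distribution /pushforward; congr (P _).
  by apply/seteqP; split => w /=; rewrite partial_sumS.
move=> B C mB mC; rewrite mul1e.
have := @indep_from k [:: Some k] (fun=> X k @^-1` C) B.
rewrite /event set_cons1 bigcap_set1 setTI => h.
rewrite setIC h//; first exact: muleC.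
- by move=> i; rewrite inE => /eqP ->; exact: sigma_family_some.
- by move=> j; rewrite inE => /eqP[->].
Qed.

End partial_sums.

Lemma mean_distribution {d d' : measure_display} {T : measurableType d}
    {T' : measurableType d'} {R : realType} (P : probability T R)
    (Y : {mfun T >-> T'}) (f : T' -> R) : bounded_mfun f ->
  \int[distribution P Y]_y f y = \int[P]_w f (Y w).
Proof.
move=> bf; rewrite /Rintegral integral_distribution//.
- by apply/measurable_EFinP; case: bf.
- apply: (@bounded_integrable _ _ _ _ (fun w => f (Y w))).
  by apply: (bounded_mfun_comp bf); exact: measurable_funP.
Qed.

Lemma eq_mean {d : measure_display} {T : measurableType d} {R : realType}
    (m m' : {measure set T -> \bar R}) (f : T -> R) :
  (forall A, measurable A -> m A = m' A) -> \int[m]_x f x = \int[m']_x f x.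
Proof.
by move=> mm'; congr fine; apply: eq_measure_integral => A mA _; exact: mm'.
Qed.

Section random_sum_mean.
Context {d : measure_display} {T : measurableType d} {R : realType}.
Variables (P : probability T R) (X : nat -> {RV P >-> R}) (N : {RV P >-> nat}).
Hypothesis indep : mutually_independent P (sigma_family N X).

Lemma mean_sum_law0 (f : R -> R) : bounded_mfun f ->
  \int[sum_law X 0]_x f x = f 0.
Proof.
move=> bf; rewrite mean_distribution//.
rewrite -[RHS](mean_cst P); apply: eq_Rintegral => w _.
by rewrite /= /partial_sum big_ord0.
Qed.

Lemma mean_sum_lawS k (f : R -> R) : bounded_mfun f ->
  \int[sum_law X k.+1]_x f x =
  \int[sum_law X k]_x \int[distribution P (X k)]_y f (x + y).
Proof.
move=> bf.
have madd : measurable_fun setT (fun z : R * R => z.1 + z.2) by exact: measurable_funD.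
pose add : {mfun (R * R)%type >-> R} := HB.pack (fun z : R * R => z.1 + z.2)
  (isMeasurableFun.Build _ _ _ _ _ madd).
have bfa : bounded_mfun (fun z : R * R => f (z.1 + z.2)).
  exact: (bounded_mfun_comp bf).
rewrite -(mean_prod _ _ bfa).
rewrite (@eq_mean _ _ _ _ [the measure _ _ of
  pushforward (sum_law X k \x distribution P (X k))%E add]); last first.
  by move=> A mA; exact: (sum_lawS indep).
rewrite /Rintegral integral_pushforward//.
- by apply/measurable_EFinP; case: bf.
- exact: (bounded_integrable_prod _ _ bfa).
Qed.

Let mean_count_sum k (f : R -> R) : bounded_mfun f ->
  \int[P]_w (\1_[set k] (N w) * f (partial_sum X k w)) =
  fine (P (N @^-1` [set k])) * \int[sum_law X k]_x f x.
Proof.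
move=> bf.
have mp : measurable_fun setT (fun w => (N w, partial_sum X k w)).
  apply/measurable_fun_pairP; split; first exact: measurable_funP.
  exact: measurable_partial_sum.
pose p : {mfun T >-> (nat * R)%type} := HB.pack (fun w => (N w, partial_sum X k w))
  (isMeasurableFun.Build _ _ _ _ _ mp).
pose h (z : nat * R) := \1_[set k] z.1 * f z.2.
have bh : bounded_mfun h.
  apply: bounded_mfunM.
    apply: (bounded_mfun_comp (f := \1_[set k] : nat -> R) (h := fst)) => //.
    exact: bounded_mfun_indic.
  exact: (bounded_mfun_comp bf).
rewrite -(mean_distribution P p bh).
rewrite (@eq_mean _ _ _ _ [the measure _ _ of
  (distribution P N \x sum_law X k)%E]); last first.
  apply: eq_measure_rectangles => [|B D mB mD].
    by rewrite (_ : _ setT = 1%E) ?ltry//; exact: probability_setT.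
  apply: eq_trans (esym (product_measure1E _ _ mB mD)).
  exact: (indep_count_sum indep).
rewrite /= {1}/Rintegral mean_prod// /h /=.
under eq_Rintegral do rewrite meanZ//.
rewrite RintegralZr//; last first.
  by apply: bounded_integrable; exact: bounded_mfun_indic.
by congr (_ * _); exact: mean_indic.
Qed.

(** Conditioning on [N]: on the event [N < K] this is a finite sum of instances of [mean_count_sum],
    and [K] tends to infinity by bounded convergence. *)
Lemma mean_random_sum (f : R -> R) : bounded_mfun f ->
  \int[P]_w f (partial_sum X (N w) w) = \int[P]_w \int[sum_law X (N w)]_x f x.
Proof.
move=> bf; have [mf [C fC]] := bf.
have C0 : 0 <= C by exact: le_trans (fC 0).
have b1 k : bounded_mfun (fun w => \1_[set k] (N w) : R).
  apply: (bounded_mfun_comp (f := \1_[set k] : nat -> R)) => //.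
  exact: bounded_mfun_indic.
have b2 k : bounded_mfun (fun w => f (partial_sum X k w)).
  by apply: (bounded_mfun_comp bf); exact: measurable_partial_sum.
have b3 k : bounded_mfun (fun w => \1_[set k] (N w) * f (partial_sum X k w)).
  exact: bounded_mfunM.
have b4 k : bounded_mfun (fun w => \1_[set k] (N w) * \int[sum_law X k]_x f x).
  by apply: bounded_mfunM => //; exact: bounded_mfun_cst.
have sumE (F : nat -> R) K n : \sum_(k < K) (\1_[set nat_of_ord k] n : R) * F k =
    if (n < K)%N then F n else 0.
  case: ifPn => nK.
    rewrite (bigD1 (Ordinal nK))//= big1 ?addr0; last first.
      move=> i /eqP iK; rewrite indicE memNset ?mul0r//= => ni; apply: iK.
      by apply: val_inj => /=.
    by rewrite indicE mem_set// mul1r.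
  rewrite big1// => i _; rewrite indicE memNset ?mul0r//= => ni.
  by move: nK; rewrite ni ltn_ord.
have lim (F : T -> nat -> R) : (forall K, measurable_fun setT
    (fun w => \sum_(k < K) \1_[set nat_of_ord k] (N w) * F w k)) ->
    (forall w k, `|F w k| <= C) ->
  \int[P]_w (\sum_(k < K) \1_[set nat_of_ord k] (N w) * F w k) @[K --> \oo] -->
  \int[P]_w F w (N w).
  move=> mF FC; apply: (@mean_bounded_cvg _ _ _ _ _ _ C).
  - exact: mF.
  - near=> K => w; rewrite (sumE (F w)); case: ifP => // _.
    by rewrite normr0.
  - move=> w; apply: cvg_near_cst; near=> K; rewrite (sumE (F w)) ifT//.
    by near: K; exact: nbhs_infty_gt.
have l1 := lim (fun w k => f (partial_sum X k w)).
have l2 := lim (fun w k => \int[sum_law X k]_x f x).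
have {}l1 := l1 (fun K => (@bounded_mfun_sum _ _ _ _ (index_enum 'I_K)
  (fun (i : 'I_K) w => \1_[set nat_of_ord i] (N w) * f (partial_sum X i w))
  (fun i => b3 i)).1) (fun w k => fC _).
have {}l2 := l2 (fun K => (@bounded_mfun_sum _ _ _ _ (index_enum 'I_K)
  (fun (i : 'I_K) w => \1_[set nat_of_ord i] (N w) * \int[sum_law X i]_x f x)
  (fun i => b4 i)).1) (fun w k => mean_norm_le _ mf fC).
have E K : \int[P]_w (\sum_(k < K) \1_[set nat_of_ord k] (N w) * f (partial_sum X k w)) =
    \int[P]_w (\sum_(k < K) \1_[set nat_of_ord k] (N w) * \int[sum_law X k]_x f x).
  rewrite !mean_sum//; apply: eq_bigr => k _.
  rewrite mean_count_sum// RintegralZr//; last exact: bounded_integrable.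
  congr (_ * _); rewrite -mean_indic; first exact: eq_Rintegral.
  by rewrite -[X in measurable X]setTI; exact: measurable_funP.
rewrite (eq_cvg _ _ E) in l1.
exact: (cvg_unique _ l1 l2).
Unshelve. all: end_near. Qed.

End random_sum_mean.

(** * Characteristic functions *)

Section elementary.
Context {R : realType}.
Implicit Types x y t w eta : R.

Lemma norm_sin_le x : `|sin x| <= `|x|.
Proof.
wlog x0 : x / 0 <= x.
  move=> H; have [/H//|x0] := leP 0 x.
  by rewrite -normrN -sinN -[leRHS]normrN H// oppr_ge0 ltW.
have [c _] := @MVT_segment R sin cos 0 x x0 (fun y _ => is_derive_sin y)
  (continuous_subspaceT (@continuous_sin R)).
rewrite sin0 !subr0 => ->; rewrite normrM ler_piMl//; exact: cos_max.
Qed.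

Lemma cos_double x : cos x = 1 - 2 * sin (x / 2) ^+ 2.
Proof.
have {1}-> : x = (x / 2) *+ 2 by rewrite mulr2n; field.
by rewrite cos_mulr2n cos2sin2 mulr2n; ring.
Qed.

Lemma onem_cos_le x : 1 - cos x <= x ^+ 2 / 2.
Proof.
rewrite cos_double; have := norm_sin_le (x / 2).
rewrite -ler_sqr ?nnegrE// !real_normK ?num_real// => h.
have -> : x ^+ 2 / 2 = 2 * (x / 2) ^+ 2 by field.
by lra.
Qed.

Lemma sin_cubic x : `|sin x - x| <= `|x| ^+ 3.
Proof.
wlog x0 : x / 0 <= x.
  move=> H; have [/H//|x0] := leP 0 x.
  have -> : sin x - x = - (sin (- x) - - x) by rewrite sinN; ring.
  by rewrite normrN -(normrN x) H// oppr_ge0 ltW.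
have df (y : R) : is_derive y 1 (fun z : R => sin z - z) (cos y - 1).
  exact: is_deriveB.
have cf : continuous (fun z : R => sin z - z).
  by move=> z; apply: cvgB; [exact: continuous_sin|exact: cvg_id].
have [c] := @MVT_segment R _ (fun y => cos y - 1) 0 x x0 (fun y _ => df y)
  (continuous_subspaceT cf).
rewrite in_itv/= => /andP[c0 cx]; rewrite sin0 !subr0 => ->.
rewrite normrM exprSr ler_wpM2r// distrC ger0_norm ?subr_ge0 ?cos_le1//.
rewrite (le_trans (onem_cos_le c))// ger0_norm//.
have : c ^+ 2 <= x ^+ 2 by rewrite ler_sqr ?nnegrE.
by have := sqr_ge0 x; lra.
Qed.

Lemma norm_sin_natmul_le n x : `|sin (n%:R * x)| <= n%:R * `|sin x|.
Proof.
elim: n => [|n ih]; first by rewrite !mul0r sin0 normr0.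
rewrite -natr1 mulrDl mul1r sinD mulrDl mul1r (le_trans (ler_normD _ _))//.
rewrite !normrM lerD//.
  by apply: le_trans ih; rewrite ler_piMr// cos_max.
by rewrite ler_piMl// cos_max.
Qed.

(** The half-angle form of [norm_sin_natmul_le]. Once integrated, it carries bounds on 1 - |cf|^2
    from a neighbourhood of 0 to the whole line at a quadratic price. *)
Lemma onem_cos_natmul_le n x : 1 - cos (n%:R * x) <= n%:R ^+ 2 * (1 - cos x).
Proof.
rewrite cos_double [cos x]cos_double -mulrA.
have := norm_sin_natmul_le n (x / 2).
rewrite -ler_sqr ?nnegrE ?mulr_ge0// exprMn !real_normK ?num_real// => h.
by lra.
Qed.

(* A smooth substitute for [minr 1 (w ^+ 2)], linked to characteristic
   functions by [mean_gauss_cos]. *)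
Definition gbump w : R := 1 - expR (- (2^-1 * w ^+ 2)).

Lemma gbump_ge0 w : 0 <= gbump w.
Proof. by rewrite subr_ge0 expR_le1 oppr_le0 mulr_ge0 ?sqr_ge0 ?invr_ge0. Qed.

Lemma gbump_le1 w : gbump w <= 1.
Proof. by rewrite lerBlDr lerDl expR_ge0. Qed.

(** Follows from exp(w^2 / 2) >= 1 + w^2 / 2. *)
Lemma gbump_ge w : w ^+ 2 <= gbump w * (2 + w ^+ 2).
Proof.
rewrite /gbump expRN; have := expR_ge1Dx (2^-1 * w ^+ 2).
have : 0 <= w ^+ 2 by exact: sqr_ge0.
have e0 : 0 < expR (2^-1 * w ^+ 2) by exact: expR_gt0.
set z := w ^+ 2 => z0 h.
have h2 : (expR (2^-1 * z))^-1 <= (1 + 2^-1 * z)^-1 by rewrite lef_pV2 ?posrE//; lra.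
have h3 : (1 + 2^-1 * z)^-1 * (2 + z) = 2 by field; lra.
have := ler_wpM2r (_ : 0 <= 2 + z) h2; rewrite h3 => /(_ ltac:(lra)).
by rewrite mulrBl; lra.
Qed.

Lemma gbump_mono x y : `|x| <= `|y| -> gbump x <= gbump y.
Proof.
rewrite -ler_sqr ?nnegrE// !real_normK ?num_real// => h.
by rewrite lerD2l lerN2 ler_expR lerN2 ler_pM2l ?invr_gt0.
Qed.

Lemma gbump_gt0 x : x != 0 -> 0 < gbump x.
Proof.
by move=> x0; rewrite subr_gt0 expR_lt1 oppr_lt0 mulr_gt0 ?invr_gt0// exprn_even_gt0.
Qed.

Lemma onem_cos_gbump1 t w : `|t| <= `|w| -> 1 - cos t <= 4 * gbump w.
Proof.
rewrite -ler_sqr ?nnegrE// !real_normK ?num_real// => tw.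
have h1 := onem_cos_le t; have h2 := cos_geN1 t; have h3 := gbump_ge w.
have h4 := gbump_ge0 w.
set z := w ^+ 2 in tw h3; have z0 : 0 <= z by rewrite sqr_ge0.
have [z2|z2] := leP z 2; nra.
Qed.

Lemma onem_cos_gbump t w : 1 - cos (t * w) <= 4 * (1 + t ^+ 2) * gbump w.
Proof.
have h1 := onem_cos_le (t * w); have h2 := cos_geN1 (t * w).
have h3 := gbump_ge w; have h4 := gbump_ge0 w; rewrite exprMn in h1.
have t0 := sqr_ge0 t; have w0 := sqr_ge0 w.
set z := w ^+ 2 in h1 h3 w0 *; set s := t ^+ 2 in h1 t0 *.
have h5 : 0 <= s * gbump w by rewrite mulr_ge0.
have [z2|z2] := leP z 2.
  have h6 : z <= 4 * gbump w by nra.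
  have : s * z <= s * (4 * gbump w) by exact: ler_wpM2l.
  by lra.
have h6 : 1 <= 2 * gbump w by nra.
by lra.
Qed.

(** The left side vanishes to third order at w = 0, so it is at most a constant times gbump w
    min(|w|, 1). The minimum is at most eta when |w| <= eta, and otherwise at most gbump w / gbump
    eta; this leaves a square of gbump, whose mean is negligible. *)
Lemma sin_linear_gbump t w eta : 0 < eta <= 1 ->
  `|sin (t * w) - t * sin w| <=
  3 * (1 + `|t| + `|t| ^+ 3) * (gbump w * (eta + gbump w / gbump eta)).
Proof.
move=> /andP[eta0 eta1].
set C := 1 + `|t| + `|t| ^+ 3.
have C0 : 0 <= C by rewrite !addr_ge0.
have be : 0 < gbump eta by apply: gbump_gt0; rewrite gt_eqF.
have b0 := gbump_ge0 w.
have E : `|sin (t * w) - t * sin w| <= `|sin (t * w) - t * w| + `|t| * `|sin w - w|.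
  rewrite -normrM -[X in _ <= _ + X]normrN (le_trans _ (ler_normD _ _))//.
  by rewrite le_eqVlt; apply/orP; left; apply/eqP; congr (`|_|); ring.
have key : `|sin (t * w) - t * sin w| <= 3 * C * (gbump w * Num.min `|w| 1).
  have [w1|w1] := leP `|w| 1.
    apply: le_trans E _.
    apply: (@le_trans _ _ (C * `|w| ^+ 3)).
      have h1 := sin_cubic (t * w).
      have h2 := ler_wpM2l (normr_ge0 t) (sin_cubic w).
      rewrite normrM exprMn in h1.
      have : 0 <= `|w| ^+ 3 by rewrite exprn_ge0.
      by rewrite /C; lra.
    rewrite [leRHS](_ : _ = C * (3 * gbump w * `|w|)); last by ring.
    rewrite ler_wpM2l// exprSr ler_wpM2r//.
    have := gbump_ge w; rewrite -(real_normK (num_real w)).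
    have : `|w| ^+ 2 <= 1 by rewrite exprn_ile1.
    by nra.
  rewrite mulr1.
  have h1 : `|sin (t * w) - t * sin w| <= C.
    apply: le_trans (ler_normB _ _) _; rewrite normrM /C.
    have := sin_max (t * w); have := ler_wpM2l (normr_ge0 t) (sin_max w).
    have : 0 <= `|t| ^+ 3 by rewrite exprn_ge0.
    by lra.
  have h2 : 1 <= 3 * gbump w.
    have := gbump_ge w; rewrite -(real_normK (num_real w)).
    have : 1 <= `|w| ^+ 2 by rewrite exprn_ege1// ltW.
    by nra.
  apply: le_trans h1 _; rewrite -[leLHS]mulr1 [leRHS](_ : _ = C * (3 * gbump w)); last by ring.
  exact: ler_wpM2l.
apply: le_trans key _; rewrite ler_wpM2l ?mulr_ge0//; apply: ler_wpM2l => //.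
have [we|ew] := leP `|w| eta.
  by rewrite ge_min (le_trans we)// lerDl divr_ge0// ltW.
rewrite ge_min; apply/orP; right.
have : 1 <= gbump w / gbump eta.
  by rewrite ler_pdivlMr// mul1r gbump_mono// (gtr0_norm eta0) ltW.
by lra.
Qed.

End elementary.

(** * Limits at the scale [1 / k n] *)

Section real_sequences.
Context {R : realType}.
Implicit Types (a b x y : nat -> R) (k : nat -> nat) (s : R).

Definition tends_infty k := forall K, \forall n \near \oo, (K <= k n)%N.

Lemma cvg0_bounded_mul x y (B : R) : (\forall n \near \oo, `|x n| <= B) ->
  y n @[n --> \oo] --> 0 -> x n * y n @[n --> \oo] --> 0.
Proof.
move=> xB y0; apply/cvgrPdist_le => e e0.
have B1 : 0 < `|B| + 1 by rewrite ltr_wpDl.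
have e1 : 0 < e / (`|B| + 1) by rewrite divr_gt0.
move/cvgrPdist_le : y0 => /(_ _ e1) y0; near=> n.
have h1 : `|x n| <= `|B| + 1.
  rewrite (@le_trans _ _ B)//; first by near: n.
  by rewrite (le_trans (ler_norm _))// lerDl.
have h2 : `|0 - y n| <= e / (`|B| + 1) by near: n.
rewrite sub0r normrN in h2; rewrite sub0r normrN normrM.
have -> : e = (`|B| + 1) * (e / (`|B| + 1)) by rewrite mulrC divfK// gt_eqF.
exact: ler_pM.
Unshelve. all: end_near. Qed.

Lemma tends_infty_inv k : tends_infty k -> (k n)%:R^-1 @[n --> \oo] --> (0 : R).
Proof.
move=> koo; apply/cvgrPdist_le => e e0.
near=> n; rewrite sub0r normrN ger0_norm ?invr_ge0//.
have h : ((Num.truncn e^-1).+1 <= k n)%N by near: n; exact: koo.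
have h2 : e^-1 < (k n)%:R.
  by rewrite (lt_le_trans (truncnS_gt _))// ler_nat.
by rewrite -[leRHS]invrK lef_pV2 ?posrE ?ltW// ?invr_gt0// (lt_trans _ h2)// invr_gt0.
Unshelve. all: end_near. Qed.

Lemma tends_infty_cvg0 k x (B : R) : tends_infty k ->
  (\forall n \near \oo, `|(k n)%:R * x n| <= B) -> x n @[n --> \oo] --> 0.
Proof.
move=> koo kx; have h := cvg0_bounded_mul kx (tends_infty_inv koo).
apply: cvg_trans h; apply: near_eq_cvg; near=> n.
have k0 : (0 < k n)%N by near: n; exact: koo.
by rewrite mulrC mulrA mulVf ?mul1r// pnatr_eq0 -lt0n.
Unshelve. all: end_near. Qed.

(** Taking logarithms, - k ln a tends to s, hence a tends to 1; and 1 - a lies between - a ln a and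
    - ln a. *)
Lemma onem_root_cvg a k s : tends_infty k -> (forall n, 0 <= a n <= 1) ->
  a n ^+ k n @[n --> \oo] --> expR (- s) ->
  (k n)%:R * (1 - a n) @[n --> \oo] --> s.
Proof.
move=> koo a01 akc.
have ak0 : \forall n \near \oo, 0 < a n ^+ k n.
  by apply: cvgr_gt akc _ (expR_gt0 _).
have a0 : \forall n \near \oo, 0 < a n.
  near=> n; have /andP[an _] := a01 n; rewrite lt_neqAle an andbT eq_sym.
  apply/eqP => an0; have : 0 < a n ^+ k n by near: n.
  rewrite an0 expr0n.
  have k0 : (0 < k n)%N by near: n; exact: koo.
  by rewrite gtn_eqF//= ltxx.
have kl : (k n)%:R * - ln (a n) @[n --> \oo] --> s.
  have : - ln (a n ^+ k n) @[n --> \oo] --> - ln (expR (- s)).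
    apply: cvgN; apply: continuous_cvg akc.
    by apply: continuous_ln; exact: expR_gt0.
  rewrite expRK opprK; apply: cvg_trans; apply: near_eq_cvg; near=> n.
  by rewrite lnXn ?mulrN ?mulr_natl//; near: n.
have kl_le : \forall n \near \oo, `|(k n)%:R * - ln (a n)| <= `|s| + 1.
  by apply: cvgr_norm_le kl _ _; rewrite ltrDl.
have l0 := tends_infty_cvg0 koo kl_le.
have a1 : a n @[n --> \oo] --> (1 : R).
  have : expR (- - ln (a n)) @[n --> \oo] --> expR (- 0).
    by apply: continuous_cvg; [exact: continuous_expR|exact: cvgN].
  rewrite oppr0 expR0; apply: cvg_trans; apply: near_eq_cvg; near=> n.
  by rewrite opprK lnK// posrE; near: n.
have lo : a n * ((k n)%:R * - ln (a n)) @[n --> \oo] --> s.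
  by rewrite -[X in _ --> X]mul1r; exact: cvgM.
apply: squeeze_cvgr lo kl; near=> n.
have an0 : 0 < a n by near: n.
have an : a n = expR (ln (a n)) by rewrite lnK.
have h1 : ln (a n) <= a n - 1 by have := expR_ge1Dx (ln (a n)); rewrite -an; lra.
have h2 : - ln (a n) <= (a n)^-1 - 1.
  by have := expR_ge1Dx (- ln (a n)); rewrite expRN -an; lra.
apply/andP; split; last by rewrite ler_wpM2l//; lra.
rewrite mulrCA ler_wpM2l//.
have := ler_wpM2l (ltW an0) h2.
by rewrite mulrBr mulfV ?gt_eqF// mulr1.
Unshelve. all: end_near. Qed.

End real_sequences.

Section product_law.
Context {d1 d2 : measure_display} {T1 : measurableType d1} {T2 : measurableType d2}.
Context {R : realType} (m1 : probability T1 R) (m2 : probability T2 R).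

(** The product measure gets a name so as to carry a probability structure, which [distribution]
    then passes on to images. *)
Definition prod_law : set (T1 * T2) -> \bar R := (m1 \x m2)%E.

HB.instance Definition _ := Measure.on prod_law.

Let prod_law_setT : prod_law setT = 1%E.
Proof.
rewrite /prod_law -setXTT product_measure1E//.
by rewrite [X in (X * _)%E]probability_setT [X in (_ * X)%E]probability_setT mule1.
Qed.

HB.instance Definition _ := Measure_isProbability.Build _ _ _ prod_law prod_law_setT.

Lemma mean_prod_law d' (T' : measurableType d') (h : {mfun (T1 * T2)%type >-> T'})
    (f : T' -> R) : bounded_mfun f ->
  \int[distribution prod_law h]_z f z = \int[m1]_x \int[m2]_y f (h (x, y)).
Proof.
move=> bf; rewrite mean_distribution//.
by rewrite -(mean_prod _ _ (bounded_mfun_comp bf (measurable_funP h))).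
Qed.

End product_law.

Lemma mean_lincomb {d : measure_display} {T : measurableType d} {R : realType}
    (m : probability T R) (a b : R) (f g : T -> R) :
  bounded_mfun f -> bounded_mfun g ->
  \int[m]_x (a * f x + b * g x) = a * \int[m]_x f x + b * \int[m]_x g x.
Proof.
move=> bf bg; rewrite -!meanZ// -meanD//.
- by apply: bounded_mfunM => //; exact: bounded_mfun_cst.
- by apply: bounded_mfunM => //; exact: bounded_mfun_cst.
Qed.

Section characteristic_function.
Context {R : realType}.
Implicit Types (m : probability R R) (t u x y z : R).

Definition cf_re m t : R := \int[m]_x cos (t * x).
Definition cf_im m t : R := \int[m]_x sin (t * x).
Definition cf_mod2 m t : R := cf_re m t ^+ 2 + cf_im m t ^+ 2.

Let sub_pair (p : R * R) : R := p.1 - p.2.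

Let measurable_sub_pair : measurable_fun setT sub_pair.
Proof. exact: measurable_funB. Qed.

HB.instance Definition _ := isMeasurableFun.Build _ _ _ _ sub_pair measurable_sub_pair.

(** Symmetrization, by the difference of two independent copies: the characteristic function becomes
    the real number |cf|^2, which forgets the unknown phase. *)
Definition diff_law m : probability R R := distribution (prod_law m m) sub_pair.

Lemma mean_diff_law m (f : R -> R) : bounded_mfun f ->
  \int[diff_law m]_w f w = \int[m]_x \int[m]_y f (x - y).
Proof. by move=> bf; rewrite mean_prod_law. Qed.

Lemma bounded_cos t : bounded_mfun (fun x : R => cos (t * x)).
Proof. by apply: bounded_mfun_cos; exact: measurable_funM. Qed.

Lemma bounded_sin t : bounded_mfun (fun x : R => sin (t * x)).
Proof. by apply: bounded_mfun_sin; exact: measurable_funM. Qed.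

Lemma bounded_gbump t : bounded_mfun (fun x : R => gbump (t * x)).
Proof.
split; last by exists 1 => x; rewrite ger0_norm ?gbump_ge0// gbump_le1.
apply: measurable_funB => //; apply: measurableT_comp => //; apply: measurableT_comp => //.
apply: measurable_funM => //; apply: measurable_funX; exact: measurable_funM.
Qed.

Lemma measurable_gbump : measurable_fun setT (@gbump R).
Proof.
by have [+ _] := bounded_gbump 1; under eq_fun do rewrite mul1r.
Qed.

Lemma measurable_cf_re m : measurable_fun setT (cf_re m).
Proof.
pose f (p : R * R) := cos (p.1 * p.2).
have bf : bounded_mfun f by apply: bounded_mfun_cos; exact: measurable_funM.
by have [] := bounded_mfun_mean m m bf.
Qed.

Lemma measurable_cf_im m : measurable_fun setT (cf_im m).
Proof.
pose f (p : R * R) := sin (p.1 * p.2).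
have bf : bounded_mfun f by apply: bounded_mfun_sin; exact: measurable_funM.
by have [] := bounded_mfun_mean m m bf.
Qed.

Lemma norm_cf_re_le m t : `|cf_re m t| <= 1.
Proof. by have [mc _] := bounded_cos t; apply: mean_norm_le => // x; exact: cos_max. Qed.

Lemma norm_cf_im_le m t : `|cf_im m t| <= 1.
Proof. by have [mc _] := bounded_sin t; apply: mean_norm_le => // x; exact: sin_max. Qed.

Lemma cf_shift_re m t u : \int[m]_x cos (t * (x - u)) =
  cos (t * u) * cf_re m t + sin (t * u) * cf_im m t.
Proof.
rewrite -mean_lincomb; [|exact: bounded_cos|exact: bounded_sin].
by apply: eq_Rintegral => x _; rewrite mulrBr cosB; ring.
Qed.

Lemma cf_shift_im m t u : \int[m]_x sin (t * (x - u)) =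
  cos (t * u) * cf_im m t - sin (t * u) * cf_re m t.
Proof.
rewrite -mulNr -mean_lincomb; [|exact: bounded_sin|exact: bounded_cos].
by apply: eq_Rintegral => x _; rewrite mulrBr sinB; ring.
Qed.

Lemma cf_mod2E m t : cf_mod2 m t = \int[diff_law m]_w cos (t * w).
Proof.
rewrite mean_diff_law; last exact: bounded_cos.
rewrite /cf_mod2 !expr2 -mean_lincomb; [|exact: bounded_cos|exact: bounded_sin].
apply: eq_Rintegral => x _.
rewrite -[RHS](_ : \int[m]_y cos (t * (y - x)) = _); last first.
  by apply: eq_Rintegral => y _; rewrite -cosN -mulrN opprB.
by rewrite cf_shift_re; ring.
Qed.

Lemma cf_mod2_itv m t : 0 <= cf_mod2 m t <= 1.
Proof.
apply/andP; split; first by rewrite addr_ge0// sqr_ge0.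
rewrite cf_mod2E (le_trans (ler_norm _))//.
by have [mc _] := bounded_cos t; apply: mean_norm_le => // x; exact: cos_max.
Qed.

Lemma measurable_cf_mod2 m : measurable_fun setT (cf_mod2 m).
Proof.
by apply: measurable_funD; apply: measurable_funX;
  [exact: measurable_cf_re|exact: measurable_cf_im].
Qed.

Lemma onem_cf_mod2E m t : 1 - cf_mod2 m t = \int[diff_law m]_w (1 - cos (t * w)).
Proof.
rewrite meanB; [|exact: bounded_mfun_cst|exact: bounded_cos].
by rewrite mean_cst cf_mod2E.
Qed.

Lemma gbump_gaussE w : gbump w = \int[gauss R]_z (1 - cos (z * w)).
Proof.
rewrite meanB; first last.
- by apply: bounded_mfun_cos; exact: measurable_funM.
- exact: bounded_mfun_cst.
rewrite mean_cst /gbump -mean_gauss_cos; congr (_ - _).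
by apply: eq_Rintegral => z _; rewrite mulrC.
Qed.

(** Averaging 1 - |cf|^2 over Gaussian frequencies yields a truncated second moment of the
    symmetrized law: knowledge of characteristic functions is exchanged for knowledge of spread. *)
Lemma gauss_onem_cf_mod2 m (del : R) :
  \int[gauss R]_z (1 - cf_mod2 m (del * z)) = \int[diff_law m]_w gbump (del * w).
Proof.
pose f (p : R * R) := 1 - cos (del * p.1 * p.2).
have bf : bounded_mfun f.
  apply: bounded_mfunB; first exact: bounded_mfun_cst.
  by apply: bounded_mfun_cos; apply: measurable_funM => //; exact: measurable_funM.
under eq_Rintegral do rewrite onem_cf_mod2E.
rewrite (mean_fubini (gauss R) (diff_law m) bf).
apply: eq_Rintegral => w _; rewrite gbump_gaussE; apply: eq_Rintegral => z _.
by rewrite /f /=; congr (_ - cos _); ring.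
Qed.

Lemma onem_cf_mod2_gbump m (t del : R) : `|t| <= `|del| ->
  1 - cf_mod2 m t <= 4 * \int[diff_law m]_w gbump (del * w).
Proof.
move=> td; rewrite onem_cf_mod2E -meanZ; last exact: bounded_gbump.
apply: mean_le => [||w].
- by apply: bounded_mfunB; [exact: bounded_mfun_cst|exact: bounded_cos].
- by apply: bounded_mfunM; [exact: bounded_mfun_cst|exact: bounded_gbump].
by apply: onem_cos_gbump1; rewrite !normrM ler_wpM2r.
Qed.

Lemma onem_cf_mod2_natmul m (n : nat) t :
  1 - cf_mod2 m (n%:R * t) <= n%:R ^+ 2 * (1 - cf_mod2 m t).
Proof.
have b u : bounded_mfun (fun w : R => 1 - cos (u * w)).
  by apply: bounded_mfunB; [exact: bounded_mfun_cst|exact: bounded_cos].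
rewrite !onem_cf_mod2E -meanZ//.
apply: mean_le => // [|w]; first by apply: bounded_mfunM => //; exact: bounded_mfun_cst.
by rewrite -mulrA; exact: onem_cos_natmul_le.
Qed.

(** Jensen's inequality for [gbump] as a Gaussian mean of 1 - cos, with the identity (1 - cos x)^2 =
    2 (1 - cos x) - (1 - cos(2 x)) / 2. The right side is a second difference that annihilates
    quadratic functions of z. *)
Lemma mean_gbump_sqr_le m :
  \int[diff_law m]_w (gbump w ^+ 2) <=
  \int[gauss R]_z (2 * (1 - cf_mod2 m z) - (1 - cf_mod2 m (2 * z)) / 2).
Proof.
pose f (p : R * R) := (1 - cos (p.1 * p.2)) ^+ 2.
have bf : bounded_mfun f.
  apply: bounded_mfunX.
  apply: bounded_mfunB; first exact: bounded_mfun_cst.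
  by apply: bounded_mfun_cos; exact: measurable_funM.
have fE z w : f (z, w) = 2 * (1 - cos (z * w)) - (1 - cos (2 * z * w)) / 2.
  rewrite /f /= (_ : 2 * z * w = (z * w) *+ 2); last by rewrite mulr2n; ring.
  by rewrite cos_mulr2n mulr2n; field.
have b u : bounded_mfun (fun w : R => 1 - cos (u * w)).
  by apply: bounded_mfunB; [exact: bounded_mfun_cst|exact: bounded_cos].
have -> : \int[gauss R]_z (2 * (1 - cf_mod2 m z) - (1 - cf_mod2 m (2 * z)) / 2) =
    \int[gauss R]_z \int[diff_law m]_w f (z, w).
  apply: eq_Rintegral => z _; rewrite !onem_cf_mod2E mulrC [_ / 2]mulrC mulrC -!meanZ// -meanB.
  - by apply: eq_Rintegral => w _; rewrite fE [_ / 2]mulrC.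
  - by apply: bounded_mfunM => //; exact: bounded_mfun_cst.
  - by apply: bounded_mfunM => //; exact: bounded_mfun_cst.
rewrite (mean_fubini (gauss R) (diff_law m) bf).
apply: mean_le => [||w].
- apply: bounded_mfunX; split; first exact: measurable_gbump.
  by exists 1 => x; rewrite ger0_norm ?gbump_ge0// gbump_le1.
- pose f' (p : R * R) := f (p.2, p.1).
  have bf' : bounded_mfun f'.
    by apply: (bounded_mfun_comp bf); exact: measurable_swap.
  exact: (bounded_mfun_mean (diff_law m) (gauss R) bf').
- rewrite gbump_gaussE; apply: mean_sqr_le.
  apply: bounded_mfunB; first exact: bounded_mfun_cst.
  by apply: bounded_mfun_cos; exact: measurable_funM.
Qed.

End characteristic_function.

Lemma gauss_integrable_sqr {R : realType} (c : R) : 0 <= c ->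
  (gauss R).-integrable setT (EFin \o (fun z => (1 + `|z| * c) ^+ 2)).
Proof.
move=> c0.
pose G (z : R) := expR (1 * z) + expR (-1 * z).
have iG : (gauss R).-integrable setT (EFin \o (fun z => (2 + 4 * c ^+ 2) * G z)).
  have -> : EFin \o (fun z => (2 + 4 * c ^+ 2) * G z) =
      (fun z => (2 + 4 * c ^+ 2)%:E * ((expR (1 * z))%:E + (expR (-1 * z))%:E))%E by [].
  apply: integrableZl => //; apply: integrableD => //; exact: gauss_integrable_expR.
apply: (@le_integrable _ _ _ _ _ measurableT _ _ _ _ iG) => //.
  apply/measurable_EFinP; apply: measurable_funX; apply: measurable_funD => //.
  by apply: measurable_funM => //; exact: measurableT_comp.
move=> z _; rewrite /= lee_fin [leLHS]ger0_norm ?sqr_ge0// (le_trans _ (ler_norm _))//.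
have h : 1 + `|z| ^+ 2 / 2 <= expR `|z|.
  by have := @expR_ge1Dxn _ `|z| 1 (normr_ge0 z); rewrite (_ : 2`!%:R = 2).
have hG : expR `|z| <= G z.
  rewrite /G mul1r mulN1r; have [z0|z0] := leP 0 z.
    by rewrite ger0_norm// lerDl expR_ge0.
  by rewrite ltr0_norm// lerDr expR_ge0.
have c2 : 0 <= c ^+ 2 by exact: sqr_ge0.
have z2 : 0 <= `|z| ^+ 2 by exact: sqr_ge0.
have hz : (1 + `|z| * c) ^+ 2 <= 2 + 2 * `|z| ^+ 2 * c ^+ 2.
  by have := sqr_ge0 (1 - `|z| * c); rewrite -subr_ge0 => h'; rewrite -subr_ge0; lra.
have h1 : 1 + `|z| ^+ 2 / 2 <= G z by apply: le_trans hG.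
apply: le_trans hz _; apply: (@le_trans _ _ ((2 + 4 * c ^+ 2) * (1 + `|z| ^+ 2 / 2))).
  by nra.
by apply: ler_wpM2l => //; nra.
Qed.

(** * Rows of null arrays *)

Section null_array.
Context {R : realType}.
(** [lam n m] stands for the law of a sum of [m] summands of law [nu n]; it enters through the
    multiplicativity of characteristic functions, which [reS] and [imS] spell out as a complex
    product. *)
Variables (nu : nat -> probability R R) (lam : nat -> nat -> probability R R).
Variables (k : nat -> nat) (mu sigma : R).
Hypothesis re0 : forall n t, cf_re (lam n 0) t = 1.
Hypothesis im0 : forall n t, cf_im (lam n 0) t = 0.
Hypothesis reS : forall n m t, cf_re (lam n m.+1) t =
  cf_re (lam n m) t * cf_re (nu n) t - cf_im (lam n m) t * cf_im (nu n) t.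
Hypothesis imS : forall n m t, cf_im (lam n m.+1) t =
  cf_im (lam n m) t * cf_re (nu n) t + cf_re (lam n m) t * cf_im (nu n) t.
Hypothesis re_lim : forall t, cf_re (lam n (k n)) t @[n --> \oo] -->
  expR (- (2^-1 * (sigma * t) ^+ 2)) * cos (mu * t).
Hypothesis im_lim : forall t, cf_im (lam n (k n)) t @[n --> \oo] -->
  expR (- (2^-1 * (sigma * t) ^+ 2)) * sin (mu * t).

Lemma cf_mod2_sum n m t : cf_mod2 (lam n m) t = cf_mod2 (nu n) t ^+ m.
Proof.
elim: m => [|m ih]; first by rewrite /cf_mod2 re0 im0 expr0 expr1n expr0n/= addr0.
by rewrite exprSr -ih /cf_mod2 reS imS; ring.
Qed.

Lemma cf_mod2_pow_lim t :
  cf_mod2 (nu n) t ^+ k n @[n --> \oo] --> expR (- (sigma * t) ^+ 2).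
Proof.
under eq_fun do rewrite -cf_mod2_sum /cf_mod2.
have -> : expR (- (sigma * t) ^+ 2) =
   (expR (- (2^-1 * (sigma * t) ^+ 2)) * cos (mu * t)) ^+ 2 +
   (expR (- (2^-1 * (sigma * t) ^+ 2)) * sin (mu * t)) ^+ 2.
  rewrite !exprMn -mulrDr cos2Dsin2 mulr1 -expRM_natl; congr expR; by field.
have sq (f : nat -> R) (l : R) : f n @[n --> \oo] --> l -> f n ^+ 2 @[n --> \oo] --> l ^+ 2.
  by move=> fl; exact: cvgM.
by apply: cvgD; apply: sq; [exact: re_lim|exact: im_lim].
Qed.

Hypothesis koo : tends_infty k.

Let u n t := 1 - cf_mod2 (nu n) t.

Let u_itv n t : 0 <= u n t <= 1.
Proof. by have /andP[? ?] := cf_mod2_itv (nu n) t; rewrite /u; apply/andP; split; lra. Qed.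

Lemma onem_cf_mod2_lim t :
  (k n)%:R * (1 - cf_mod2 (nu n) t) @[n --> \oo] --> (sigma * t) ^+ 2.
Proof.
apply: onem_root_cvg => // [n|]; first exact: cf_mod2_itv.
exact: cf_mod2_pow_lim.
Qed.

Let bounded_onem_cf_mod2 (m : probability R R) (del : R) :
  bounded_mfun (fun z : R => 1 - cf_mod2 m (del * z)).
Proof.
split.
  apply: measurable_funB => //; apply: measurableT_comp; first exact: measurable_cf_mod2.
  exact: measurable_funM.
exists 1 => z; have /andP[? ?] := cf_mod2_itv m (del * z).
by rewrite ger0_norm; lra.
Qed.

(** Turns pointwise limits into a bound uniform in t: averages over frequencies of order [del] show
    that 1 - |cf|^2 of the row sum is at most 1/2 for all |t| <= del, and Bernoulli's inequality
    divides the exponent [k n] out. *)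
Let ku_near0 : exists2 del : R, 0 < del & \forall n \near \oo,
  forall t, `|t| <= del -> (k n)%:R * u n t <= 1.
Proof.
(* Two errors of 1/16, multiplied by the factor 4 of [onem_cf_mod2_gbump], make 1/2. *)
have e16 : 0 < 16^-1 :> R by [].
have mexp (c : R) : measurable_fun setT (fun z : R => 1 - expR (- (sigma * (c * z)) ^+ 2)).
  apply: measurable_funB => //; apply: measurableT_comp => //; apply: measurableT_comp => //.
  apply: measurable_funX; apply: measurable_funM => //; exact: measurable_funM.
have expB (c z : R) : `|1 - expR (- (sigma * (c * z)) ^+ 2)| <= 1.
  rewrite ger0_norm; first by rewrite lerBlDr lerDl expR_ge0.
  by rewrite subr_ge0 expR_le1 oppr_le0 sqr_ge0.
have c1 : \int[gauss R]_z (1 - expR (- (sigma * (j.+1%:R^-1 * z)) ^+ 2)) @[j --> \oo] -->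
    \int[gauss R]_z (1 - expR (- (sigma * (0 * z)) ^+ 2)).
  apply: (@mean_bounded_cvg _ _ _ _ _ _ 1).
  - by move=> j; exact: mexp.
  - by near=> j => z; exact: expB.
  - move=> z; apply: cvgB; first exact: cvg_cst.
    apply: continuous_cvg; first exact: continuous_expR.
    apply: cvgN; rewrite expr2; under eq_fun do rewrite expr2.
    suff h : sigma * (j.+1%:R^-1 * z) @[j --> \oo] --> sigma * (0 * z) by exact: cvgM.
    apply: cvgM; first exact: cvg_cst.
    by apply: cvgM; [exact: cvg_harmonic|exact: cvg_cst].
move: c1; rewrite (_ : \int[gauss R]_z (1 - expR (- (sigma * (0 * z)) ^+ 2)) = 0); last first.
  under eq_Rintegral do rewrite mul0r mulr0 expr0n oppr0 expR0 subrr.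
  exact: mean_cst.
move=> /cvgrPdist_le /(_ _ e16) [j _ /(_ j (leqnn _))].
set del := j.+1%:R^-1 => hj.
have del0 : 0 < del by rewrite invr_gt0.
exists del => //.
have c2 : \int[gauss R]_z (1 - cf_mod2 (lam n (k n)) (del * z)) @[n --> \oo] -->
    \int[gauss R]_z (1 - expR (- (sigma * (del * z)) ^+ 2)).
  apply: (@mean_bounded_cvg _ _ _ _ _ _ 1).
  - by move=> n; case: (bounded_onem_cf_mod2 (lam n (k n)) del).
  - near=> n => z; have /andP[? ?] := cf_mod2_itv (lam n (k n)) (del * z).
    by rewrite ger0_norm; lra.
  - move=> z; apply: cvgB; first exact: cvg_cst.
    under eq_fun do rewrite cf_mod2_sum.
    exact: cf_mod2_pow_lim.
move/cvgrPdist_le : c2 => /(_ _ e16) c2; near=> n => t td.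
have h2 : `|\int[gauss R]_z (1 - expR (- (sigma * (del * z)) ^+ 2)) -
  \int[gauss R]_z (1 - cf_mod2 (lam n (k n)) (del * z))| <= 16^-1 by near: n.
rewrite gauss_onem_cf_mod2 in h2.
have h3 : 1 - cf_mod2 (lam n (k n)) t <= 2^-1.
  apply: (le_trans (@onem_cf_mod2_gbump _ _ t del _)); first by rewrite (gtr0_norm del0).
  rewrite sub0r normrN in hj.
  by have := ler_norm (\int[gauss R]_z (1 - expR (- (sigma * (del * z)) ^+ 2)));
    move/ler_normlP : h2 => [? ?]; lra.
rewrite cf_mod2_sum in h3.
have := bernoulli_inv_le (k n) (u_itv n t).
rewrite {1}/u opprB addrC subrK => h4.
have /andP[u0 _] := u_itv n t.
have ku0 : 0 <= (k n)%:R * u n t by rewrite mulr_ge0.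
nra.
Unshelve. all: end_near. Qed.

(** Divide t by an integer L just above |t| / del to land where [ku_near0] applies, and come back at
    the price L^2. The bound is an envelope integrable under [gauss]. *)
Let ku_bound : exists2 c : R, 0 < c & \forall n \near \oo,
  forall t, (k n)%:R * u n t <= (1 + `|t| * c) ^+ 2.
Proof.
have [del del0 H] := ku_near0; exists del^-1; first by rewrite invr_gt0.
apply: filterS H => n H t.
set L := (Num.truncn (`|t| / del)).+1.
have td0 : 0 <= `|t| / del by rewrite divr_ge0// ltW.
have /andP[L1 L2] := truncn_itv td0.
have L0 : 0 < L%:R :> R by [].
have h := @onem_cf_mod2_natmul _ (nu n) L (t / L%:R).
rewrite mulrC divfK ?gt_eqF// in h.
have h1 : (k n)%:R * u n (t / L%:R) <= 1.
  apply: H; rewrite normrM normfV (ger0_norm (ltW L0)) ler_pdivrMr// mulrC.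
  by rewrite -ler_pdivrMr// ltW.
have h2 : (k n)%:R * u n t <= L%:R ^+ 2 * ((k n)%:R * u n (t / L%:R)).
  by rewrite mulrCA ler_wpM2l.
apply: le_trans h2 _; apply: (@le_trans _ _ (L%:R ^+ 2 * 1)).
  by rewrite ler_wpM2l// sqr_ge0.
rewrite mulr1 lerXn2r ?nnegrE ?addr_ge0 ?(ltW L0)//.
by rewrite /L -natr1 addrC lerD2l.
Qed.

Lemma mean_gbump_bounded : exists2 A : R, 0 <= A & \forall n \near \oo,
  (k n)%:R * \int[diff_law (nu n)]_w gbump w <= A.
Proof.
have [c c0 H] := ku_bound.
exists (\int[gauss R]_z (1 + `|z| * c) ^+ 2).
  by apply: mean_ge0 => z; exact: sqr_ge0.
apply: filterS H => n H.
have -> : \int[diff_law (nu n)]_w gbump w = \int[gauss R]_z (1 - cf_mod2 (nu n) (1 * z)).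
  by rewrite gauss_onem_cf_mod2; apply: eq_Rintegral => w _; rewrite mul1r.
rewrite -meanZ; last exact: bounded_onem_cf_mod2.
apply: le_Rintegral => //.
- apply: (@bounded_integrable _ _ _ _
    (fun z : R => (k n)%:R * (1 - cf_mod2 (nu n) (1 * z)))).
  apply: bounded_mfunM; first exact: bounded_mfun_cst.
  exact: bounded_onem_cf_mod2.
- exact: (gauss_integrable_sqr (ltW c0)).
- by move=> z _; rewrite mul1r; exact: H.
Qed.

(** Negligibility of single summands. In the bound of [mean_gbump_sqr_le], [k n] times 1 - |cf(z)|^2
    tends to sigma^2 z^2, and 2 sigma^2 z^2 - sigma^2 (2 z)^2 / 2 = 0. *)
Lemma mean_gbump_sqr_lim :
  (k n)%:R * \int[diff_law (nu n)]_w (gbump w ^+ 2) @[n --> \oo] --> 0.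
Proof.
have [c c0 H] := ku_bound.
have b (del : R) n := bounded_onem_cf_mod2 (nu n) del.
pose F n (z : R) := (k n)%:R * (2 * u n z - u n (2 * z) / 2).
have bu n : bounded_mfun (u n).
  by have := b 1 n; under eq_fun do rewrite mul1r.
have bF n : bounded_mfun (F n).
  apply: bounded_mfunM; first exact: bounded_mfun_cst.
  apply: bounded_mfunB.
    by apply: bounded_mfunM => //; exact: bounded_mfun_cst.
  by apply: bounded_mfunM; [exact: b|exact: bounded_mfun_cst].
have cF : \int[gauss R]_z F n z @[n --> \oo] --> \int[gauss R]_z 0.
  apply: (@mean_dominated_cvg _ _ _ (gauss R) F (fun=> 0) (fun z => 4 * (1 + `|z| * c) ^+ 2)).
  - by move=> n; case: (bF n).
  - have -> : EFin \o (fun z : R => 4 * (1 + `|z| * c) ^+ 2) =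
      (fun z => 4%:E * ((1 + `|z| * c) ^+ 2)%:E)%E by [].
    by apply: integrableZl => //; exact: (gauss_integrable_sqr (ltW c0)).
  - apply: filterS H => n H z.
    have h1 := H z; have h2 := H (2 * z).
    have /andP[u0 _] := u_itv n z; have /andP[v0 _] := u_itv n (2 * z).
    have k0 : 0 <= (k n)%:R :> R by [].
    have h3 : 0 <= (k n)%:R * u n z by rewrite mulr_ge0.
    have h4 : 0 <= (k n)%:R * u n (2 * z) by rewrite mulr_ge0.
    have h5 : (1 + `|2 * z| * c) ^+ 2 <= 4 * (1 + `|z| * c) ^+ 2.
      rewrite (_ : 4 * _ = (2 * (1 + `|z| * c)) ^+ 2); last by ring.
      rewrite normrM (gtr0_norm (_ : 0 < 2 :> R))//.
      have zc : 0 <= `|z| * c by rewrite mulr_ge0// ltW.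
      by rewrite lerXn2r ?nnegrE; lra.
    by rewrite /F; apply/ler_normlP; split; lra.
  - move=> z; rewrite /F; under eq_fun do rewrite mulrBr mulrCA mulrA -[_ * _ * _]mulrA.
    have -> : 0 = 2 * (sigma * z) ^+ 2 - (sigma * (2 * z)) ^+ 2 / 2 by field.
    apply: cvgB.
      by apply: cvgM; [exact: cvg_cst|exact: onem_cf_mod2_lim].
    under eq_fun do rewrite mulrA.
    by apply: cvgM; [exact: onem_cf_mod2_lim|exact: cvg_cst].
rewrite mean_cst in cF.
apply: squeeze_cvgr (cvg_cst 0) cF; near=> n; apply/andP; split.
  by rewrite mulr_ge0// mean_ge0// => w; exact: sqr_ge0.
rewrite /F meanZ; last first.
  apply: bounded_mfunB.
    by apply: bounded_mfunM => //; exact: bounded_mfun_cst.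
  by apply: bounded_mfunM; [exact: b|exact: bounded_mfun_cst].
by rewrite ler_wpM2l//; exact: mean_gbump_sqr_le.
Unshelve. all: end_near. Qed.

End null_array.

Lemma exists_le_mean {d : measure_display} {T : measurableType d} {R : realType}
    (m : probability T R) (f : T -> R) : bounded_mfun f ->
  exists x, f x <= \int[m]_x f x + 1.
Proof.
move=> bf; apply: contrapT => /forallNP h.
have b1 : @bounded_mfun _ T R (fun=> \int[m]_x f x + 1).
  exact: bounded_mfun_cst.
have := mean_le m b1 bf; rewrite mean_cst => H.
suff : \int[m]_x f x + 1 <= \int[m]_x f x by lra.
by apply: H => x; apply/ltW; rewrite ltNge; apply/negP; exact: h.
Qed.

(** * Centring the summands *)

Section centering.
Context {R : realType}.
Variables (nu : nat -> probability R R) (k : nat -> nat) (sigma A : R).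
Hypothesis koo : tends_infty k.
Hypothesis onem_lim : forall t,
  (k n)%:R * (1 - cf_mod2 (nu n) t) @[n --> \oo] --> (sigma * t) ^+ 2.
Hypothesis A0 : 0 <= A.
Hypothesis gbump_bounded : \forall n \near \oo,
  (k n)%:R * \int[diff_law (nu n)]_w gbump w <= A.
Hypothesis gbump_sqr_lim :
  (k n)%:R * \int[diff_law (nu n)]_w (gbump w ^+ 2) @[n --> \oo] --> 0.

(** The harmonic term keeps [B n] positive, so that [near_center] may divide by it. *)
Let B n : R := (k n)%:R * \int[diff_law (nu n)]_w (gbump w ^+ 2) + n.+1%:R^-1.

Let B_lim : B n @[n --> \oo] --> 0.
Proof. by rewrite -[X in _ --> X]addr0; apply: cvgD => //; exact: cvg_harmonic. Qed.

Let bgb : bounded_mfun (@gbump R).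
Proof.
split; first exact: measurable_gbump.
by exists 1 => x; rewrite ger0_norm ?gbump_ge0// gbump_le1.
Qed.

Let bgb_shift y : bounded_mfun (fun x : R => gbump (x - y)).
Proof. by apply: (bounded_mfun_comp bgb); exact: measurable_funB. Qed.

Let B_gt0 n : 0 < B n.
Proof.
rewrite ltr_wpDl ?invr_gt0// mulr_ge0// mean_ge0// => w; exact: sqr_ge0.
Qed.

(** Desymmetrization by averaging. Both truncated moments about y, normalized so that each has mean
    at most 1 when y is drawn from [nu n], have a sum of mean at most 2. Some y gives at most 2 + 1
    = 3, hence the constant. *)
Let near_center : \forall n \near \oo, exists y,
  (k n)%:R * \int[nu n]_x gbump (x - y) <= 3 * (A + 1) /\
  (k n)%:R * \int[nu n]_x (gbump (x - y) ^+ 2) <= 3 * B n.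
Proof.
apply: filterS gbump_bounded => n gA.
have A1 : 0 < A + 1 by rewrite ltr_wpDl.
have Bn := B_gt0 n.
pose a := (k n)%:R / (A + 1); pose b := (k n)%:R / B n.
pose f (w : R) := a * gbump w + b * gbump w ^+ 2.
have bsq : bounded_mfun (fun w : R => gbump w ^+ 2) := bounded_mfunX _ bgb.
have bf : bounded_mfun f.
  by apply: bounded_mfunD; apply: bounded_mfunM => //;
    exact: bounded_mfun_cst.
have fN w : f (- w) = f w by rewrite /f /gbump sqrrN.
have bf2 : bounded_mfun (fun p : R * R => f (p.1 - p.2)).
  by apply: (bounded_mfun_comp bf); exact: measurable_funB.
have [y hy] := exists_le_mean (nu n) (bounded_mfun_mean (nu n) (nu n) bf2).
rewrite /= -mean_diff_law// in hy.
have hm : \int[diff_law (nu n)]_w f w <= 2.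
  rewrite mean_lincomb//.
  have h1 : a * \int[diff_law (nu n)]_w gbump w <= 1.
    by rewrite /a mulrAC ler_pdivrMr// mul1r (le_trans gA)// lerDl.
  have h2 : b * \int[diff_law (nu n)]_w gbump w ^+ 2 <= 1.
    by rewrite /b mulrAC ler_pdivrMr// mul1r /B lerDl invr_ge0.
  by lra.
have {}hy : a * \int[nu n]_x gbump (x - y) + b * \int[nu n]_x (gbump (x - y) ^+ 2) <= 3.
  have bs := bgb_shift y.
  rewrite -mean_lincomb//; last exact: bounded_mfunX.
  rewrite (_ : \int[nu n]_x _ = \int[nu n]_x f (y - x)); first by lra.
  by apply: eq_Rintegral => x _; rewrite -[RHS]fN opprB.
have g1 : 0 <= \int[nu n]_x gbump (x - y) by apply: mean_ge0 => x; exact: gbump_ge0.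
have g2 : 0 <= \int[nu n]_x (gbump (x - y) ^+ 2).
  by apply: mean_ge0 => x; exact: sqr_ge0.
have a0 : 0 <= a by rewrite divr_ge0// ltW.
have b0 : 0 <= b by rewrite divr_ge0// ltW.
have i1 : 0 <= a * \int[nu n]_x gbump (x - y) by rewrite mulr_ge0.
have i2 : 0 <= b * \int[nu n]_x (gbump (x - y) ^+ 2) by rewrite mulr_ge0.
exists y; split.
  have : a * \int[nu n]_x gbump (x - y) <= 3 by lra.
  by rewrite /a mulrAC ler_pdivrMr.
have : b * \int[nu n]_x (gbump (x - y) ^+ 2) <= 3 by lra.
by rewrite /b mulrAC ler_pdivrMr.
Qed.

(* [y n] almost minimizes the spread of [nu n] about a point; adding the mean
   of [sin (x - y n)] makes the imaginary part of the centred characteristic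
   function negligible. *)
Let y n := xget 0 [set y | (k n)%:R * \int[nu n]_x gbump (x - y) <= 3 * (A + 1) /\
  (k n)%:R * \int[nu n]_x (gbump (x - y) ^+ 2) <= 3 * B n].

Let yP : \forall n \near \oo,
  (k n)%:R * \int[nu n]_x gbump (x - y n) <= 3 * (A + 1) /\
  (k n)%:R * \int[nu n]_x (gbump (x - y n) ^+ 2) <= 3 * B n.
Proof. by apply: filterS near_center => n [z hz]; rewrite /y; case: xgetP => [w -> //|/(_ z)]. Qed.

Let p1 t n := 1 - \int[nu n]_x cos (t * (x - y n)).
Let q1 t n := \int[nu n]_x sin (t * (x - y n)).
Let al n := q1 1 n.

Let bcos n t : bounded_mfun (fun x : R => cos (t * (x - y n))).
Proof.
by apply: bounded_mfun_cos; apply: measurable_funM => //; exact: measurable_funB.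
Qed.

Let bsin n t : bounded_mfun (fun x : R => sin (t * (x - y n))).
Proof.
by apply: bounded_mfun_sin; apply: measurable_funM => //; exact: measurable_funB.
Qed.

Let p1E t n : p1 t n = \int[nu n]_x (1 - cos (t * (x - y n))).
Proof. by rewrite meanB ?mean_cst//; exact: bounded_mfun_cst. Qed.

Let p1_ge0 t n : 0 <= p1 t n.
Proof. by rewrite p1E; apply: mean_ge0 => x; rewrite subr_ge0 cos_le1. Qed.

Let kp1_bounded t : \forall n \near \oo,
  `|(k n)%:R * p1 t n| <= 4 * (1 + t ^+ 2) * (3 * (A + 1)).
Proof.
apply: filterS yP => n [h _]; rewrite ger0_norm ?mulr_ge0//.
have c0 : 0 <= 4 * (1 + t ^+ 2) by rewrite mulr_ge0// addr_ge0// sqr_ge0.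
apply: le_trans (ler_wpM2l c0 h); rewrite mulrCA ler_wpM2l//.
rewrite p1E -meanZ//; apply: mean_le => [||x].
- by apply: bounded_mfunB => //; exact: bounded_mfun_cst.
- by apply: bounded_mfunM => //; exact: bounded_mfun_cst.
- exact: onem_cos_gbump.
Qed.

(** Uses [mean_sqr_le] and sin^2 <= 2 (1 - cos). It only gives al = O(k^(-1/2)), so the imaginary
    part about [y n] is not yet known to be o(1 / k). *)
Let kal_bounded : \forall n \near \oo,
  `|(k n)%:R * (al n * al n)| <= 2 * (4 * (1 + 1 ^+ 2) * (3 * (A + 1))).
Proof.
apply: filterS (kp1_bounded 1) => n h.
have sq : al n ^+ 2 <= 2 * p1 1 n.
  rewrite /al /q1 (le_trans (mean_sqr_le _ (bsin n 1)))//.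
  rewrite p1E -meanZ; last by apply: bounded_mfunB => //; exact: bounded_mfun_cst.
  apply: mean_le => [||x].
  - exact: bounded_mfunX.
  - apply: bounded_mfunM; first exact: bounded_mfun_cst.
    by apply: bounded_mfunB => //; exact: bounded_mfun_cst.
  - rewrite sin2cos2; have := cos_le1 (1 * (x - y n)); have := cos_geN1 (1 * (x - y n)).
    by nra.
have k0 : 0 <= (k n)%:R :> R by [].
rewrite ger0_norm -expr2; last by rewrite mulr_ge0// sqr_ge0.
have := ler_wpM2l k0 sq; have := ler_norm ((k n)%:R * p1 1 n).
by lra.
Qed.

Let al_lim : al n @[n --> \oo] --> 0.
Proof.
have h := tends_infty_cvg0 koo kal_bounded.
apply/cvgrPdist_le => e e0.
have e2 : 0 < e ^+ 2 by rewrite exprn_gt0.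
move/cvgrPdist_le : h => /(_ _ e2); apply: filterS => n.
rewrite !sub0r !normrN -expr2 normrX => h.
by rewrite -ler_sqr ?nnegrE ?(ltW e0).
Qed.

(** Up to o(1 / k) the imaginary part is linear in t, so one further shift, by [al n], corrects it
    at every t. In the bound of [sin_linear_gbump] the first term is small by the choice of [eta],
    the second because [B n] tends to 0. *)
Let kq1_lim t : (k n)%:R * (q1 t n - t * al n) @[n --> \oo] --> 0.
Proof.
apply/cvgrPdist_le => e e0.
pose C := 3 * (1 + `|t| + `|t| ^+ 3).
have C0 : 0 < C by rewrite mulr_gt0// ltr_wpDr// ?ltr_wpDr.
have A3 : 0 < 3 * (A + 1) by rewrite mulr_gt0// ltr_wpDl.
pose eta := Num.min 1 (e / (2 * C * (3 * (A + 1)))).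
have eta0 : 0 < eta by rewrite lt_min ltr01/= divr_gt0// mulr_gt0// mulr_gt0.
have eta1 : eta <= 1 by rewrite ge_min lexx.
have etae : C * (3 * (A + 1)) * eta <= e / 2.
  have : eta <= e / (2 * C * (3 * (A + 1))) by rewrite ge_min lexx orbT.
  rewrite ler_pdivlMr; last by rewrite mulr_gt0// mulr_gt0.
  by move=> h; lra.
have ge0 : 0 < gbump eta by apply: gbump_gt0; rewrite gt_eqF.
have h2 : C * (3 * B n / gbump eta) @[n --> \oo] --> 0.
  rewrite -[X in _ --> X](mulr0 C); apply: cvgM; first exact: cvg_cst.
  rewrite -[X in _ --> X](mul0r (gbump eta)^-1); apply: cvgM; last exact: cvg_cst.
  by rewrite -[X in _ --> X](mulr0 3); apply: cvgM => //; exact: cvg_cst.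
have e2 : 0 < e / 2 by rewrite divr_gt0.
move/cvgrPdist_le : h2 => /(_ _ e2) h2.
near=> n; rewrite sub0r normrN normrM ger0_norm//.
have [g1 g2] : (k n)%:R * \int[nu n]_x gbump (x - y n) <= 3 * (A + 1) /\
  (k n)%:R * \int[nu n]_x (gbump (x - y n) ^+ 2) <= 3 * B n by near: n.
have h3 : `|0 - C * (3 * B n / gbump eta)| <= e / 2 by near: n.
have bs := bgb_shift (y n).
have bs2 : bounded_mfun (fun x : R => gbump (x - y n) ^+ 2) := bounded_mfunX _ bs.
have hq : `|q1 t n - t * al n| <= C * eta * \int[nu n]_x gbump (x - y n) +
    C / gbump eta * \int[nu n]_x (gbump (x - y n) ^+ 2).
  rewrite /al /q1 -meanZ// -meanB//; last first.
    by apply: bounded_mfunM => //; exact: bounded_mfun_cst.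
  have bd : bounded_mfun (fun x : R => sin (t * (x - y n)) - t * sin (1 * (x - y n))).
    apply: bounded_mfunB => //.
    by apply: bounded_mfunM => //; exact: bounded_mfun_cst.
  apply: (le_trans (norm_mean _ bd)); rewrite -mean_lincomb//.
  apply: mean_le => [||x].
  - exact: bounded_mfun_norm.
  - by apply: bounded_mfunD; apply: bounded_mfunM => //;
      exact: bounded_mfun_cst.
  - rewrite mul1r; have etai : 0 < eta <= 1 by rewrite eta0.
    apply: (le_trans (sin_linear_gbump t (x - y n) etai)).
    by rewrite -/C le_eqVlt; apply/orP; left; apply/eqP; ring.
have k0 : 0 <= (k n)%:R :> R by [].
apply: (le_trans (ler_wpM2l k0 hq)).
have C1 : 0 <= C * eta by rewrite mulr_ge0// ltW.
have C2 : 0 <= C / gbump eta by rewrite divr_ge0// ltW.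
have i1 := ler_wpM2l C1 g1; have i2 := ler_wpM2l C2 g2.
have i3 : C / gbump eta * (3 * B n) <= e / 2.
  rewrite sub0r normrN in h3; apply: le_trans (le_trans (ler_norm _) h3).
  by rewrite le_eqVlt; apply/orP; left; apply/eqP; ring.
by lra.
Unshelve. all: end_near. Qed.

(** Moving the centre from y to y + al rotates the characteristic function by the angle th = t al,
    whose square is O(1 / k). This cancels the imaginary part up to o(1 / k); the real part is then
    read off from the modulus. *)
Lemma null_array_center : exists c : nat -> R, forall t,
  (k n)%:R * (1 - (cos (t * c n) * cf_re (nu n) t + sin (t * c n) * cf_im (nu n) t))
    @[n --> \oo] --> (sigma * t) ^+ 2 / 2 /\
  (k n)%:R * (cos (t * c n) * cf_im (nu n) t - sin (t * c n) * cf_re (nu n) t)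
    @[n --> \oo] --> 0.
Proof.
exists (fun n => y n + al n) => t.
have [th thE] : exists th : nat -> R, forall n, th n = t * al n by exists (fun n => t * al n).
pose p0 n := 1 - ((1 - p1 t n) * cos (th n) + q1 t n * sin (th n)).
pose q0 n := q1 t n * cos (th n) - (1 - p1 t n) * sin (th n).
have p0E n : 1 - (cos (t * (y n + al n)) * cf_re (nu n) t +
    sin (t * (y n + al n)) * cf_im (nu n) t) = p0 n.
  rewrite /p0 /p1 /q1 cf_shift_re cf_shift_im mulrDr cosD sinD -thE; ring.
have q0E n : cos (t * (y n + al n)) * cf_im (nu n) t -
    sin (t * (y n + al n)) * cf_re (nu n) t = q0 n.
  rewrite /q0 /p1 /q1 cf_shift_re cf_shift_im mulrDr cosD sinD -thE; ring.
suff [kp kq] : (k n)%:R * p0 n @[n --> \oo] --> (sigma * t) ^+ 2 / 2 /\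
    (k n)%:R * q0 n @[n --> \oo] --> 0.
  by split; [under eq_fun do rewrite p0E|under eq_fun do rewrite q0E].
have th_lim : th n @[n --> \oo] --> 0.
  rewrite (_ : th = fun n => t * al n); last exact/funext.
  by rewrite -[X in _ --> X](mulr0 t); apply: cvgM => //; exact: cvg_cst.
pose D := t ^+ 2 * (2 * (4 * (1 + 1 ^+ 2) * (3 * (A + 1)))).
have kth : \forall n \near \oo, `|(k n)%:R * th n ^+ 2| <= D.
  apply: filterS kal_bounded => n h.
  rewrite (_ : _ * th n ^+ 2 = t ^+ 2 * ((k n)%:R * (al n * al n))); last by rewrite thE; ring.
  by rewrite normrM (ger0_norm (sqr_ge0 t)) ler_wpM2l ?sqr_ge0.
have kr' : (k n)%:R * (q1 t n - th n) @[n --> \oo] --> 0.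
  under eq_fun do rewrite thE.
  exact: kq1_lim.
have nth_lim : `|th n| @[n --> \oo] --> 0.
  by rewrite -(@normr0 _ R); exact: cvg_norm.
have kth_th : (k n)%:R * th n ^+ 2 * `|th n| @[n --> \oo] --> 0.
  exact: cvg0_bounded_mul kth nth_lim.
have kp_th : (k n)%:R * p1 t n * `|th n| @[n --> \oo] --> 0.
  exact: cvg0_bounded_mul (kp1_bounded t) nth_lim.
have nkr : `|(k n)%:R * (q1 t n - th n)| @[n --> \oo] --> 0.
  by rewrite -(@normr0 _ R); exact: cvg_norm.
have kq0 : (k n)%:R * q0 n @[n --> \oo] --> 0.
  have u0 : `|(k n)%:R * (q1 t n - th n)| + 2 * ((k n)%:R * th n ^+ 2 * `|th n|) +
     (k n)%:R * p1 t n * `|th n| @[n --> \oo] --> 0.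
    have -> : 0 = 0 + 2 * 0 + 0 :> R by ring.
    apply: cvgD => //; apply: cvgD => //; apply: cvgM => //; exact: cvg_cst.
  apply: norm_cvg0; apply: squeeze_cvgr (cvg_cst 0) u0; near=> n.
  rewrite normr_ge0/=.
  have -> : (k n)%:R * q0 n = (k n)%:R * (q1 t n - th n) * cos (th n) +
     (k n)%:R * (th n * (cos (th n) - 1) - (sin (th n) - th n)) +
     (k n)%:R * p1 t n * sin (th n) by rewrite /q0; ring.
  rewrite (le_trans (ler_normD _ _))// lerD//; last first.
    rewrite !normrM (ger0_norm (p1_ge0 _ _)) [X in X * _ * _]ger0_norm//.
    by rewrite ler_wpM2l ?mulr_ge0// norm_sin_le.
  rewrite (le_trans (ler_normD _ _))// lerD//.
    by rewrite normrM ler_piMr// cos_max.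
  rewrite normrM [X in X * _]ger0_norm// -!mulrA mulrCA ler_wpM2l//.
  have h1 : `|th n * (cos (th n) - 1)| <= th n ^+ 2 * `|th n|.
    rewrite normrM mulrC ler_wpM2r// distrC ger0_norm ?subr_ge0 ?cos_le1//.
    by have := onem_cos_le (th n); have := sqr_ge0 (th n); lra.
  have h2 : `|sin (th n) - th n| <= th n ^+ 2 * `|th n|.
    by rewrite -(real_normK (num_real (th n))) -exprSr sin_cubic.
  by apply: (le_trans (ler_normB _ _)); lra.
split; last exact: kq0.
(* Boundedness of [(k n)%:R * p0 n] comes first: it makes [p0 n] tend to 0, so that [p0 n ^+ 2] is
   negligible at the scale [1 / k n]. *)
have kp0b : \forall n \near \oo,
    `|(k n)%:R * p0 n| <= D + 4 * (1 + t ^+ 2) * (3 * (A + 1)) + D + 1.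
  have nk1 : \forall n \near \oo, `|(k n)%:R * (q1 t n - th n)| <= 1.
    move/cvgrPdist_le : kr' => /(_ _ ltr01); apply: filterS => n.
    by rewrite sub0r normrN.
  near=> n.
  have h0 : `|(k n)%:R * (q1 t n - th n)| <= 1 by near: n.
  have h1 : `|(k n)%:R * th n ^+ 2| <= D by near: n.
  have h2 : `|(k n)%:R * p1 t n| <= 4 * (1 + t ^+ 2) * (3 * (A + 1)).
    by near: n; exact: kp1_bounded.
  have -> : (k n)%:R * p0 n = (k n)%:R * (1 - cos (th n)) + (k n)%:R * p1 t n * cos (th n)
     - (k n)%:R * th n * sin (th n) - (k n)%:R * (q1 t n - th n) * sin (th n).
    by rewrite /p0; ring.
  rewrite (le_trans (ler_normB _ _))// lerD//; last first.
    by rewrite normrM (le_trans _ h0)// ler_piMr// sin_max.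
  rewrite (le_trans (ler_normB _ _))// lerD//; last first.
    rewrite (le_trans _ h1)// -mulrA !normrM ler_wpM2l//.
    by rewrite ler_wpM2l// norm_sin_le.
  rewrite (le_trans (ler_normD _ _))// lerD//; last first.
    by rewrite normrM (le_trans _ h2)// ler_piMr// cos_max.
  rewrite (le_trans _ h1)// !normrM ler_wpM2l//.
  rewrite ger0_norm ?subr_ge0 ?cos_le1// -normrM -expr2 [leRHS]ger0_norm ?sqr_ge0//.
  by have := onem_cos_le (th n); have := sqr_ge0 (th n); lra.
have p0_lim := tends_infty_cvg0 koo kp0b.
have kp0p0 : (k n)%:R * p0 n * p0 n @[n --> \oo] --> 0 by exact: cvg0_bounded_mul kp0b p0_lim.
have q0_lim : q0 n @[n --> \oo] --> 0.
  apply: (tends_infty_cvg0 koo (B := 1)).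
  move/cvgrPdist_le : kq0 => /(_ _ ltr01); apply: filterS => n.
  by rewrite sub0r normrN.
have kq0q0 : (k n)%:R * q0 n * q0 n @[n --> \oo] --> 0.
  by rewrite -[X in _ --> X](mulr0 0); exact: cvgM.
(* A rotation leaves the modulus unchanged: |cf|^2 = (1 - p0)^2 + q0^2, solved for the linear term
   in p0. *)
have modE n : (k n)%:R * p0 n = ((k n)%:R * (1 - cf_mod2 (nu n) t) +
   (k n)%:R * p0 n * p0 n + (k n)%:R * q0 n * q0 n) / 2.
  have -> : cf_mod2 (nu n) t = (1 - p0 n) ^+ 2 + q0 n ^+ 2.
    rewrite -p0E -q0E /cf_mod2; have := cos2Dsin2 (t * (y n + al n)).
    set c := cos _; set s := sin _; set a := cf_re _ _; set b := cf_im _ _ => cs.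
    transitivity ((c ^+ 2 + s ^+ 2) * (a ^+ 2 + b ^+ 2)); first by rewrite cs mul1r.
    by ring.
  by field.
under eq_fun do rewrite modE.
apply: cvgM; last exact: cvg_cst.
rewrite -[X in _ --> X]addr0; apply: cvgD => //.
by rewrite -[X in _ --> X]addr0; apply: cvgD.
Unshelve. all: end_near. Qed.

End centering.

Section lipschitz_trigo.
Context {R : realType}.
Implicit Types x y : R.

Lemma cos_lipschitz x y : `|cos x - cos y| <= `|x - y|.
Proof.
wlog xy : x y / y <= x.
  by move=> H; have [/H//|/ltW yx] := leP y x; rewrite distrC [leRHS]distrC H.
have [c _ ->] := @MVT_segment R cos (fun z => - sin z) y x xy (fun z _ => is_derive_cos z)
  (continuous_subspaceT (@continuous_cos R)).
by rewrite normrM normrN ler_piMl// sin_max.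
Qed.

Lemma sin_lipschitz x y : `|sin x - sin y| <= `|x - y|.
Proof.
wlog xy : x y / y <= x.
  by move=> H; have [/H//|/ltW yx] := leP y x; rewrite distrC [leRHS]distrC H.
have [c _ ->] := @MVT_segment R sin cos y x xy (fun z _ => is_derive_sin z)
  (continuous_subspaceT (@continuous_sin R)).
by rewrite normrM ler_piMl// cos_max.
Qed.

End lipschitz_trigo.

(* Powers of a complex number [C1 + i S1] of the unit disk, compared with the
   powers of a real [b]. *)
Lemma near_real_power {R : realType} (C S : nat -> R) (C1 S1 b : R) :
  C 0%N = 1 -> S 0%N = 0 ->
  (forall m, C m.+1 = C m * C1 - S m * S1) ->
  (forall m, S m.+1 = S m * C1 + C m * S1) ->
  (forall m, `|C m| <= 1) -> `|C1| <= 1 -> 0 <= b <= 1 ->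
  forall m, `|S m| <= m%:R * `|S1| /\
    `|C m - b ^+ m| <= m%:R * `|C1 - b| + m%:R ^+ 2 * S1 ^+ 2.
Proof.
move=> C0 S0 CS SS Cle C1le /andP[b0 b1]; elim=> [|m [ihS ihC]].
  by rewrite C0 S0 expr0 subrr !normr0 expr0n/=; split; lra.
split.
  rewrite SS -natr1 mulrDl mul1r (le_trans (ler_normD _ _))// lerD// normrM.
    by apply: le_trans ihS; rewrite ler_piMr.
  by rewrite ler_piMl.
have -> : C m.+1 - b ^+ m.+1 = C m * (C1 - b) + (C m - b ^+ m) * b - S m * S1.
  by rewrite CS exprSr; ring.
have h1 : `|C m * (C1 - b)| <= `|C1 - b| by rewrite normrM ler_piMl.
have h2 : `|(C m - b ^+ m) * b| <= `|C m - b ^+ m|.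
  by rewrite normrM ler_piMr// ger0_norm.
have h3 : `|S m * S1| <= m%:R * S1 ^+ 2.
  rewrite normrM -(real_normK (num_real S1)) expr2 mulrA.
  by rewrite ler_wpM2r.
rewrite (le_trans (ler_normB _ _))//.
have h4 := ler_normD (C m * (C1 - b)) ((C m - b ^+ m) * b).
have m0 : 0 <= m%:R :> R by [].
have s0 : 0 <= S1 ^+ 2 by exact: sqr_ge0.
have h5 : 0 <= m%:R * S1 ^+ 2 by rewrite mulr_ge0.
by rewrite -natr1 sqrrD; lra.
Qed.

(** * Uniform approximation of the characteristic functions of the sums *)

Section array_limit.
Context {R : realType}.
Variables (nu : nat -> probability R R) (lam : nat -> nat -> probability R R).
Variables (k : nat -> nat) (mu sigma : R).
Hypothesis re0 : forall n t, cf_re (lam n 0) t = 1.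
Hypothesis im0 : forall n t, cf_im (lam n 0) t = 0.
Hypothesis reS : forall n m t, cf_re (lam n m.+1) t =
  cf_re (lam n m) t * cf_re (nu n) t - cf_im (lam n m) t * cf_im (nu n) t.
Hypothesis imS : forall n m t, cf_im (lam n m.+1) t =
  cf_im (lam n m) t * cf_re (nu n) t + cf_re (lam n m) t * cf_im (nu n) t.
Hypothesis re_lim : forall t, cf_re (lam n (k n)) t @[n --> \oo] -->
  expR (- (2^-1 * (sigma * t) ^+ 2)) * cos (mu * t).
Hypothesis im_lim : forall t, cf_im (lam n (k n)) t @[n --> \oo] -->
  expR (- (2^-1 * (sigma * t) ^+ 2)) * sin (mu * t).
Hypothesis koo : tends_infty k.

Let center : exists c : nat -> R, forall t,
  (k n)%:R * (1 - (cos (t * c n) * cf_re (nu n) t + sin (t * c n) * cf_im (nu n) t))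
    @[n --> \oo] --> (sigma * t) ^+ 2 / 2 /\
  (k n)%:R * (cos (t * c n) * cf_im (nu n) t - sin (t * c n) * cf_re (nu n) t)
    @[n --> \oo] --> 0.
Proof.
have [A A0 gA] := mean_gbump_bounded re0 im0 reS imS re_lim im_lim.
apply: (@null_array_center _ nu k sigma A koo) => //.
- by move=> t; apply: (@onem_cf_mod2_lim _ nu lam k mu sigma).
- by apply: (@mean_gbump_sqr_lim _ nu lam k mu sigma).
Qed.

(** After rotation by the centring, one summand has a characteristic function within o(1 / k) of the
    real number exp(- sigma^2 t^2 / (2 k)), and at most M k factors accumulate an error o(1). The
    rotation is undone with k c tending to mu. *)
Lemma array_limit t (M : nat) (e : R) : 0 < e -> \forall n \near \oo,
  forall m, (m <= M * k n)%N ->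
  `|cf_re (lam n m) t - expR (- (2^-1 * (sigma * t) ^+ 2 * (m%:R / (k n)%:R))) *
      cos (mu * t * (m%:R / (k n)%:R))| <= e /\
  `|cf_im (lam n m) t - expR (- (2^-1 * (sigma * t) ^+ 2 * (m%:R / (k n)%:R))) *
      sin (mu * t * (m%:R / (k n)%:R))| <= e.
Proof.
move=> e0; have [c cP] := center.
have cc (x : R) : (fun=> x : R) @ \oo --> x by exact: cvg_cst.
pose C1 n u := cos (u * c n) * cf_re (nu n) u + sin (u * c n) * cf_im (nu n) u.
pose S1 n u := cos (u * c n) * cf_im (nu n) u - sin (u * c n) * cf_re (nu n) u.
pose C n u (m : nat) := cos (u * (m%:R * c n)) * cf_re (lam n m) u +
  sin (u * (m%:R * c n)) * cf_im (lam n m) u.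
pose S n u (m : nat) := cos (u * (m%:R * c n)) * cf_im (lam n m) u -
  sin (u * (m%:R * c n)) * cf_re (lam n m) u.
pose b n u := expR (- (2^-1 * (sigma * u) ^+ 2 / (k n)%:R)).
have b01 n u : 0 <= b n u <= 1.
  rewrite expR_ge0 expR_le1 oppr_le0 divr_ge0// mulr_ge0 ?invr_ge0//.
  exact: sqr_ge0.
have bX n u m : b n u ^+ m = expR (- (2^-1 * (sigma * u) ^+ 2 * (m%:R / (k n)%:R))).
  by rewrite /b -expRM_natl; congr expR; ring.
have rot_le (x p q : R) : p ^+ 2 + q ^+ 2 <= 1 -> `|cos x * p + sin x * q| <= 1.
  move=> pq; rewrite -(@expr_le1 _ 2)// -normrX ger0_norm ?sqr_ge0//.
  apply: le_trans pq; have cs := cos2Dsin2 x; have := sqr_ge0 (sin x * p - cos x * q).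
  have -> : p ^+ 2 + q ^+ 2 = (cos x ^+ 2 + sin x ^+ 2) * (p ^+ 2 + q ^+ 2) by rewrite cs mul1r.
  lra.
have Cle n u m : `|C n u m| <= 1.
  by apply: rot_le; have /andP[] := cf_mod2_itv (lam n m) u.
have C1le n u : `|C1 n u| <= 1.
  by apply: rot_le; have /andP[] := cf_mod2_itv (nu n) u.
have NR n u := @near_real_power _ (C n u) (S n u) (C1 n u) (S1 n u) (b n u).
have {}NR n u m : `|S n u m| <= m%:R * `|S1 n u| /\
    `|C n u m - b n u ^+ m| <= m%:R * `|C1 n u - b n u| + m%:R ^+ 2 * S1 n u ^+ 2.
  apply: NR => //.
  - by rewrite /C mul0r mulr0 cos0 sin0 re0; ring.
  - by rewrite /S mul0r mulr0 cos0 sin0 im0; ring.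
  - move=> j; rewrite /C /S /C1 /S1 reS imS -natr1 mulrDl mul1r mulrDr cosD sinD.
    by ring.
  - move=> j; rewrite /C /S /C1 /S1 reS imS -natr1 mulrDl mul1r mulrDr cosD sinD.
    by ring.
(* [M.+1] instead of [M], so that the case [m = k n], where the limit is given, is covered even if
   [M = 0]. *)
pose err u n : R := M.+1%:R * `|(k n)%:R * (C1 n u - b n u)| +
  (M.+1%:R * `|(k n)%:R * S1 n u|) ^+ 2 + M.+1%:R * `|(k n)%:R * S1 n u|.
have kb u : (k n)%:R * (1 - b n u) @[n --> \oo] --> (sigma * u) ^+ 2 / 2.
  rewrite mulrC; apply: onem_root_cvg => //.
  apply: cvg_near_cst; near=> n; rewrite bX divff ?mulr1 1?mulrC//.
  rewrite pnatr_eq0 -lt0n; near: n; exact: koo.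
have kCb u : (k n)%:R * (C1 n u - b n u) @[n --> \oo] --> 0.
  have [h1 _] := cP u.
  rewrite -(subrr ((sigma * u) ^+ 2 / 2)).
  rewrite (_ : (fun n => _) = fun n => (k n)%:R * (1 - b n u) - (k n)%:R * (1 - C1 n u)).
    exact: cvgB (kb u) h1.
  by apply/funext => n; ring.
have kS u : (k n)%:R * S1 n u @[n --> \oo] --> 0 by have [] := cP u.
have err0 u : err u n @[n --> \oo] --> 0.
  have nC : `|(k n)%:R * (C1 n u - b n u)| @[n --> \oo] --> 0.
    by rewrite -(@normr0 _ R); exact: cvg_norm.
  have nS : M.+1%:R * `|(k n)%:R * S1 n u| @[n --> \oo] --> 0.
    rewrite -[X in _ --> X](mulr0 M.+1%:R); apply: cvgM; first exact: cvg_cst.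
    by rewrite -(@normr0 _ R); exact: cvg_norm.
  have H := cvgD (cvgD (cvgM (cc M.+1%:R) nC) (cvgM nS nS)) nS.
  by rewrite !mulr0 !addr0 in H; exact: H.
have errP u n m : (m <= M.+1 * k n)%N ->
    `|C n u m - b n u ^+ m| <= err u n /\ `|S n u m| <= err u n.
  move=> mM; have [h1 h2] := NR n u m.
  have mk : m%:R <= M.+1%:R * (k n)%:R :> R by rewrite -natrM ler_nat.
  have k0 : 0 <= (k n)%:R :> R by [].
  have m0 : 0 <= m%:R :> R by [].
  have s0 : m%:R * `|S1 n u| <= M.+1%:R * `|(k n)%:R * S1 n u|.
    by rewrite normrM (ger0_norm k0) mulrA ler_wpM2r.
  have c0 : m%:R * `|C1 n u - b n u| <= M.+1%:R * `|(k n)%:R * (C1 n u - b n u)|.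
    by rewrite normrM (ger0_norm k0) mulrA ler_wpM2r.
  have s2 : m%:R ^+ 2 * S1 n u ^+ 2 <= (M.+1%:R * `|(k n)%:R * S1 n u|) ^+ 2.
    rewrite -(real_normK (num_real (S1 n u))) -exprMn lerXn2r// nnegrE.
      by rewrite mulr_ge0.
    by rewrite mulr_ge0.
  have z1 : 0 <= M.+1%:R * `|(k n)%:R * (C1 n u - b n u)| by rewrite mulr_ge0.
  have z2 : 0 <= (M.+1%:R * `|(k n)%:R * S1 n u|) ^+ 2 by rewrite sqr_ge0.
  have z3 : 0 <= M.+1%:R * `|(k n)%:R * S1 n u| by rewrite mulr_ge0.
  by rewrite /err; split; lra.
pose beta u := expR (- (2^-1 * (sigma * u) ^+ 2)).
(* For [m = k n] there are two limits for the same characteristic function; comparing them compares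
   the phases mu u and k c u. *)
have cos1 u : cos (u * (mu - (k n)%:R * c n)) @[n --> \oo] --> (1 : R).
  have beta0 : 0 < beta u by exact: expR_gt0.
  have l0 : `|cf_re (lam n (k n)) u - beta u * cos (mu * u)| +
      `|cf_im (lam n (k n)) u - beta u * sin (mu * u)| + err u n @[n --> \oo] --> 0.
    have z (x : nat -> R) l : x n @[n --> \oo] --> l -> `|x n - l| @[n --> \oo] --> 0.
      move=> xl; rewrite -(@normr0 _ R) -(subrr l).
      by apply: cvg_norm; apply: cvgB => //; exact: cvg_cst.
    rewrite -[X in _ --> X]addr0; apply: cvgD => //.
    by rewrite -[X in _ --> X]addr0; apply: cvgD; apply: z; [exact: re_lim|exact: im_lim].
  have l1 : beta u * (cos (u * (mu - (k n)%:R * c n)) - 1) @[n --> \oo] --> 0.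
    apply: norm_cvg0; apply: squeeze_cvgr (cvg_cst 0) l0; near=> n.
    rewrite normr_ge0/=.
    have kM : (k n <= M.+1 * k n)%N by rewrite leq_pmull.
    have [h _] := errP u n (k n) kM.
    have k0 : (k n)%:R != 0 :> R by rewrite pnatr_eq0 -lt0n; near: n; exact: koo.
    rewrite bX divff// mulr1 -/(beta u) in h.
    set x := u * ((k n)%:R * c n).
    have -> : beta u * (cos (u * (mu - (k n)%:R * c n)) - 1) =
      - (cos x * (cf_re (lam n (k n)) u - beta u * cos (mu * u)) +
         sin x * (cf_im (lam n (k n)) u - beta u * sin (mu * u))) + (C n u (k n) - beta u).
      rewrite [u * (mu - _)]mulrBr -/x cosB /C -/x [mu * u]mulrC; ring.
    rewrite (le_trans (ler_normD _ _))// lerD// normrN.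
    rewrite (le_trans (ler_normD _ _))// lerD//.
      by rewrite normrM ler_piMl// cos_max.
    by rewrite normrM ler_piMl// sin_max.
  rewrite (_ : (fun n => _) = fun n => (beta u)^-1 *
      (beta u * (cos (u * (mu - (k n)%:R * c n)) - 1)) + 1).
    have H := cvgD (cvgM (cc (beta u)^-1) l1) (cc 1).
    by rewrite mulr0 add0r in H; exact: H.
  by apply/funext => n; rewrite mulKf ?gt_eqF// subrK.
(* A single u would fix the difference only modulo 2 pi / u. Averaging over Gaussian u makes [gbump]
   of the difference tend to 0. *)
have kc : (k n)%:R * c n @[n --> \oo] --> mu.
  have g0 : gbump (mu - (k n)%:R * c n) @[n --> \oo] --> 0.
    have : \int[gauss R]_z (1 - cos (z * (mu - (k n)%:R * c n))) @[n --> \oo] -->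
        \int[gauss R]_z (1 - 1).
      apply: (@mean_bounded_cvg _ _ _ _ _ _ 2).
      - move=> n; apply: measurable_funB => //; apply: measurableT_comp.
          exact: measurable_cos.
        exact: measurable_funM.
      - near=> n => z; have := cos_le1 (z * (mu - (k n)%:R * c n)).
        have := cos_geN1 (z * (mu - (k n)%:R * c n)) => ? ?.
        by rewrite ger0_norm; lra.
      - by move=> z; apply: cvgB; [exact: cvg_cst|exact: cos1].
    under eq_fun do rewrite -gbump_gaussE.
    by under eq_Rintegral do rewrite subrr; rewrite mean_cst.
  have h2 : 0 < 2^-1 :> R by rewrite invr_gt0.
  apply/cvgrPdist_le => e' e'0.
  (* When [gbump dn <= 2^-1], [gbump_ge] gives [dn ^+ 2 <= 4 * gbump dn]. *)
  have e2 : 0 < e' ^+ 2 / 4 by rewrite divr_gt0// exprn_gt0.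
  move/cvgrPdist_le : (g0) => /(_ _ h2) g1.
  move/cvgrPdist_le : (g0) => /(_ _ e2) g2.
  near=> n.
  have d1 : `|0 - gbump (mu - (k n)%:R * c n)| <= 2^-1 by near: n.
  have d2 : `|0 - gbump (mu - (k n)%:R * c n)| <= e' ^+ 2 / 4 by near: n.
  move: d1 d2; set dn := mu - _ => d1 d2.
  rewrite sub0r normrN ger0_norm ?gbump_ge0// in d1 d2.
  rewrite -ler_sqr ?nnegrE ?(ltW e'0)// real_normK ?num_real//.
  have := gbump_ge dn; have := sqr_ge0 dn; have := gbump_ge0 dn.
  by nra.
have e3 : 0 < e / 3 by rewrite divr_gt0.
have tM : `|t| * M%:R * `|mu - (k n)%:R * c n| @[n --> \oo] --> 0.
  rewrite -[X in _ --> X](mulr0 (`|t| * M%:R)); apply: cvgM; first exact: cvg_cst.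
  rewrite -(@normr0 _ R) -(subrr mu); apply: cvg_norm; apply: cvgB => //; exact: cvg_cst.
move/cvgrPdist_le : tM => /(_ _ e3) tM.
move/cvgrPdist_le : (err0 t) => /(_ _ e3) errt.
near=> n => m mM.
have mM1 : (m <= M.+1 * k n)%N by rewrite (leq_trans mM)// leq_mul.
have [hC hS] := errP t n m mM1; rewrite bX in hC.
have he : `|0 - err t n| <= e / 3 by near: n.
have ht : `|0 - `|t| * M%:R * `|mu - (k n)%:R * c n| | <= e / 3 by near: n.
rewrite !sub0r !normrN in he ht.
have he' := le_trans (ler_norm _) he; have ht' := le_trans (ler_norm _) ht.
have k0 : 0 < (k n)%:R :> R by rewrite ltr0n; near: n; exact: koo.
set x := t * (m%:R * c n); set w := mu * t * (m%:R / (k n)%:R).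
have xw : `|x - w| <= e / 3.
  apply: le_trans ht'.
  have -> : x - w = - (t * (m%:R / (k n)%:R) * (mu - (k n)%:R * c n)).
    by rewrite /x /w; field; rewrite gt_eqF.
  rewrite normrN 2!normrM ler_wpM2r// ler_wpM2l// ger0_norm ?divr_ge0//.
  by rewrite ler_pdivrMr// -natrM ler_nat.
set g := expR _ in hC *.
have g01 : `|g| <= 1.
  by rewrite /g ger0_norm ?expR_ge0// -bX; have /andP[? ?] := b01 n t; exact: exprn_ile1.
have [r1 r2] : cf_re (lam n m) t = cos x * C n t m - sin x * S n t m /\
    cf_im (lam n m) t = sin x * C n t m + cos x * S n t m.
  have cs := cos2Dsin2 x; rewrite /C /S -/x.
  set p := cf_re _ _; set q := cf_im _ _; split.
    by rewrite -[LHS]mul1r -cs; ring.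
  by rewrite -[LHS]mul1r -cs; ring.
have hC' := le_trans hC he'; have hS' := le_trans hS he'.
have close (p q r : R) : `|p| <= 1 -> `|q| <= 1 -> `|p - r| <= `|x - w| ->
    `|p * C n t m + q * S n t m - g * r| <= e.
  move=> p1 q1 pr.
  have -> : p * C n t m + q * S n t m - g * r =
    p * (C n t m - g) + g * (p - r) + q * S n t m by ring.
  have i1 : `|p * (C n t m - g)| <= e / 3.
    by apply: le_trans hC'; rewrite normrM ler_piMl.
  have i2 : `|g * (p - r)| <= e / 3.
    by apply: (le_trans _ xw); rewrite normrM (le_trans _ pr)// ler_piMl.
  have i3 : `|q * S n t m| <= e / 3 by apply: le_trans hS'; rewrite normrM ler_piMl.
  have := ler_normD (p * (C n t m - g) + g * (p - r)) (q * S n t m).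
  by have := ler_normD (p * (C n t m - g)) (g * (p - r)); lra.
by rewrite r1 r2 -mulNr; split; apply: close;
  rewrite ?normrN ?cos_max ?sin_max ?cos_lipschitz ?sin_lipschitz.
Unshelve. all: end_near. Qed.

End array_limit.

(** * Normal variance-mean mixtures *)

Section normal_laws.
Context {R : realType}.
Implicit Types (x t u z : R).

Lemma gauss_atomless : atomless (gauss R).
Proof.
move=> x.
have := @normal_prob_dominates R 0 1.
move/null_content_dominatesP => /(_ [set x]); apply => //.
exact: lebesgue_measure_set1.
Qed.

Lemma PhiE x : Phi x = law_fun (gauss R) x.
Proof. by rewrite law_funE//; exact: gauss_atomless. Qed.

Let affine (mu sigma : R) (y : R) : R := mu + sigma * y.

Let measurable_affine mu sigma : measurable_fun setT (affine mu sigma).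
Proof. by apply: measurable_funD => //; exact: measurable_funM. Qed.

HB.instance Definition _ mu sigma :=
  isMeasurableFun.Build _ _ _ _ (affine mu sigma) (measurable_affine mu sigma).

Definition normal_law mu sigma : probability R R := distribution (gauss R) (affine mu sigma).

Lemma law_fun_normal mu sigma x : 0 < sigma ->
  law_fun (normal_law mu sigma) x = Phi ((x - mu) / sigma).
Proof.
move=> s0; rewrite PhiE /law_fun; congr (fine (gauss R _)).
by apply/seteqP; split => y /=; rewrite /affine ltr_pdivlMr// ltrBrDl mulrC.
Qed.

Lemma normal_law_atomless mu sigma : 0 < sigma -> atomless (normal_law mu sigma).
Proof.
move=> s0 x; rewrite -[RHS](gauss_atomless ((x - mu) / sigma)).
congr (gauss R _); apply/seteqP; split => y /=; rewrite /affine.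
  by move=> <-; rewrite addrC addKr mulrC mulKf// gt_eqF.
by move=> ->; rewrite mulrC divfK ?gt_eqF// addrC subrK.
Qed.

Lemma mean_gauss_cos_affine a b :
  \int[gauss R]_y cos (a + b * y) = expR (- (2^-1 * b ^+ 2)) * cos a.
Proof.
transitivity (\int[gauss R]_y (cos a * cos (b * y) + (- sin a) * sin (b * y))).
  by apply: eq_Rintegral => y _; rewrite cosD mulNr.
rewrite mean_lincomb; [|exact: bounded_cos|exact: bounded_sin].
by rewrite mean_gauss_cos mean_gauss_sin; ring.
Qed.

Lemma mean_gauss_sin_affine a b :
  \int[gauss R]_y sin (a + b * y) = expR (- (2^-1 * b ^+ 2)) * sin a.
Proof.
transitivity (\int[gauss R]_y (sin a * cos (b * y) + cos a * sin (b * y))).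
  by apply: eq_Rintegral => y _; rewrite sinD.
rewrite mean_lincomb; [|exact: bounded_cos|exact: bounded_sin].
by rewrite mean_gauss_cos mean_gauss_sin; ring.
Qed.

Lemma cf_re_normal mu sigma t : cf_re (normal_law mu sigma) t =
  expR (- (2^-1 * (sigma * t) ^+ 2)) * cos (mu * t).
Proof.
rewrite /cf_re mean_distribution; last exact: bounded_cos.
rewrite -mean_gauss_cos_affine; apply: eq_Rintegral => y _.
by congr cos; rewrite /= /affine; ring.
Qed.

Lemma cf_im_normal mu sigma t : cf_im (normal_law mu sigma) t =
  expR (- (2^-1 * (sigma * t) ^+ 2)) * sin (mu * t).
Proof.
rewrite /cf_im mean_distribution; last exact: bounded_sin.
rewrite -mean_gauss_sin_affine; apply: eq_Rintegral => y _.
by congr sin; rewrite /= /affine; ring.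
Qed.

End normal_laws.

Section law_fun_cf.
Context {R : realType}.
Variables (m_ : nat -> probability R R) (m : probability R R).
Hypothesis cvg_law : forall x, law_fun (m_ n) x @[n --> \oo] --> law_fun m x.

Lemma law_fun_cvg_cf_re u : cf_re (m_ n) u @[n --> \oo] --> cf_re m u.
Proof.
apply: (@law_fun_cvg_mean _ m_ m (fun x => cos (u * x)) `|u| 1) => //.
- by move=> x y; rewrite -normrM mulrBr cos_lipschitz.
- by move=> x; exact: cos_max.
- by case: (bounded_cos u).
Qed.

Lemma law_fun_cvg_cf_im u : cf_im (m_ n) u @[n --> \oo] --> cf_im m u.
Proof.
apply: (@law_fun_cvg_mean _ m_ m (fun x => sin (u * x)) `|u| 1) => //.
- by move=> x y; rewrite -normrM mulrBr sin_lipschitz.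
- by move=> x; exact: sin_max.
- by case: (bounded_sin u).
Qed.

End law_fun_cf.

Section mixture.
Context {R : realType}.
Variables (mu sigma : R).
Implicit Types (V : probability R R) (u x z : R).

(* The positive part of [z], since [Num.sqrt z = 0] for negative [z]. *)
Definition pos_part z : R := Num.sqrt z ^+ 2.

Lemma pos_part_ge0 z : 0 <= pos_part z. Proof. exact: sqr_ge0. Qed.

Lemma pos_part_id z : 0 <= z -> pos_part z = z.
Proof. by move=> z0; rewrite /pos_part sqr_sqrtr. Qed.

Lemma pos_part0 z : z <= 0 -> pos_part z = 0.
Proof. by move=> z0; rewrite /pos_part ler0_sqrtr// expr0n. Qed.

Lemma pos_part_lipschitz x z : `|pos_part x - pos_part z| <= `|x - z|.
Proof.
wlog xz : x z / z <= x.
  by move=> H; have [/H//|/ltW h] := leP z x; rewrite distrC [leRHS]distrC H.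
have [z0|z0] := leP 0 z; first by rewrite !pos_part_id// (le_trans z0).
rewrite [pos_part z](pos_part0 (ltW z0)) subr0 [leRHS]ger0_norm ?subr_ge0//.
have [x0|x0] := leP 0 x; last by rewrite (pos_part0 (ltW x0)) normr0 subr_ge0.
by rewrite pos_part_id// ger0_norm// lerDl oppr_ge0 (ltW z0).
Qed.

Lemma measurable_sqrtr : measurable_fun setT (@Num.sqrt R).
Proof. by apply: continuous_measurable_fun; exact: sqrt_continuous. Qed.

Lemma measurable_pos_part : measurable_fun setT pos_part.
Proof. by apply: measurable_funX; exact: measurable_sqrtr. Qed.

Definition mixture_map (p : R * R) : R :=
  mu * pos_part p.1 + sigma * Num.sqrt p.1 * p.2.

Lemma measurable_mixture_map : measurable_fun setT mixture_map.
Proof.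
apply: measurable_funD.
  by apply: measurable_funM => //; apply: measurableT_comp => //; exact: measurable_pos_part.
apply: measurable_funM => //; apply: measurable_funM => //.
by apply: measurableT_comp => //; exact: measurable_sqrtr.
Qed.

HB.instance Definition _ :=
  isMeasurableFun.Build _ _ _ _ mixture_map measurable_mixture_map.

(* Law of [mu V + sigma sqrt(V) Z] with [Z] standard normal and independent of
   the nonnegative variable [V]. *)
Definition mixture V : probability R R := distribution (prod_law V (gauss R)) mixture_map.

Lemma mean_mixture V (f : R -> R) : bounded_mfun f ->
  \int[mixture V]_x f x =
  \int[V]_z \int[gauss R]_y f (mu * pos_part z + sigma * Num.sqrt z * y).
Proof. by move=> bf; rewrite mean_prod_law. Qed.

(** With [mixture_im], the two parts of exp((i mu u - sigma^2 u^2 / 2) z), the characteristic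
    function of the mixture given V = z. *)
Definition mixture_re u z : R :=
  expR (- (2^-1 * (sigma * u) ^+ 2 * pos_part z)) * cos (mu * u * pos_part z).

Definition mixture_im u z : R :=
  expR (- (2^-1 * (sigma * u) ^+ 2 * pos_part z)) * sin (mu * u * pos_part z).

Lemma cf_re_mixture V u : cf_re (mixture V) u = \int[V]_z mixture_re u z.
Proof.
rewrite /cf_re mean_mixture; last exact: bounded_cos.
apply: eq_Rintegral => z _.
transitivity (\int[gauss R]_y cos (mu * u * pos_part z + sigma * u * Num.sqrt z * y)).
  by apply: eq_Rintegral => y _; congr cos; ring.
by rewrite mean_gauss_cos_affine /mixture_re /pos_part; congr (expR _ * _); ring.
Qed.

Lemma cf_im_mixture V u : cf_im (mixture V) u = \int[V]_z mixture_im u z.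
Proof.
rewrite /cf_im mean_mixture; last exact: bounded_sin.
apply: eq_Rintegral => z _.
transitivity (\int[gauss R]_y sin (mu * u * pos_part z + sigma * u * Num.sqrt z * y)).
  by apply: eq_Rintegral => y _; congr sin; ring.
by rewrite mean_gauss_sin_affine /mixture_im /pos_part; congr (expR _ * _); ring.
Qed.

Let exp_lipschitz (a x z : R) : 0 <= a ->
  `|expR (- (a * pos_part x)) - expR (- (a * pos_part z))| <= a * `|x - z|.
Proof.
move=> a0; have P := pos_part_lipschitz.
wlog xz : x z / pos_part z <= pos_part x.
  by move=> H; have [/H//|/ltW h] := leP (pos_part z) (pos_part x);
     rewrite distrC [`|x - z|]distrC H.
rewrite distrC ger0_norm; last by rewrite subr_ge0 ler_expR lerN2 ler_wpM2l.
apply: (@le_trans _ _ (a * (pos_part x - pos_part z))); last first.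
  by rewrite ler_wpM2l// (le_trans (ler_norm _)).
have -> : - (a * pos_part x) = - (a * pos_part z) - a * (pos_part x - pos_part z) by ring.
rewrite expRD; set e := expR (- (a * pos_part z)).
have e1 : e <= 1 by rewrite expR_le1 oppr_le0 mulr_ge0// pos_part_ge0.
have e0 : 0 <= e by exact: expR_ge0.
have d0 : 0 <= a * (pos_part x - pos_part z) by rewrite mulr_ge0// subr_ge0.
have := expR_ge1Dx (- (a * (pos_part x - pos_part z))).
set y := a * _ in d0 *; set g := expR (- y) => h.
have g1 : g <= 1 by rewrite expR_le1 oppr_le0.
by nra.
Qed.

Let e_le1 u z : `|expR (- (2^-1 * (sigma * u) ^+ 2 * pos_part z))| <= 1.
Proof.
rewrite ger0_norm ?expR_ge0// expR_le1 oppr_le0 mulr_ge0 ?pos_part_ge0//.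
by rewrite mulr_ge0 ?sqr_ge0// invr_ge0.
Qed.

Let c_ge0 u : 0 <= 2^-1 * (sigma * u) ^+ 2.
Proof. by rewrite mulr_ge0 ?sqr_ge0// invr_ge0. Qed.

Let damped_lipschitz (f : R -> R) u x z : (forall p, `|f p| <= 1) ->
  (forall p q, `|f p - f q| <= `|p - q|) ->
  let h y := expR (- (2^-1 * (sigma * u) ^+ 2 * pos_part y)) * f (mu * u * pos_part y) in
  `|h x - h z| <= (2^-1 * (sigma * u) ^+ 2 + `|mu * u|) * `|x - z|.
Proof.
move=> f1 fL /=; set ex := expR _; set ez := expR _; set fx := f _; set fz := f _.
have -> : ex * fx - ez * fz = (ex - ez) * fx + ez * (fx - fz) by ring.
rewrite [leRHS]mulrDl (le_trans (ler_normD _ _))// lerD// normrM.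
  by rewrite (le_trans _ (exp_lipschitz _ _ (c_ge0 u)))// ler_piMr// f1.
rewrite (@le_trans _ _ `|fx - fz|)//; first by rewrite ler_piMl// e_le1.
rewrite (le_trans (fL _ _))// -mulrBr normrM ler_wpM2l//.
exact: pos_part_lipschitz.
Qed.

Lemma mixture_re_lipschitz u x z : `|mixture_re u x - mixture_re u z| <=
  (2^-1 * (sigma * u) ^+ 2 + `|mu * u|) * `|x - z|.
Proof. exact: (damped_lipschitz u x z (@cos_max R) (@cos_lipschitz R)). Qed.

Lemma mixture_im_lipschitz u x z : `|mixture_im u x - mixture_im u z| <=
  (2^-1 * (sigma * u) ^+ 2 + `|mu * u|) * `|x - z|.
Proof. exact: (damped_lipschitz u x z (@sin_max R) (@sin_lipschitz R)). Qed.

Let bounded_damping u :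
  bounded_mfun (fun z => expR (- (2^-1 * (sigma * u) ^+ 2 * pos_part z))).
Proof.
apply: bounded_mfun_expR => [|z].
  by apply: measurableT_comp => //; apply: measurable_funM => //; exact: measurable_pos_part.
by rewrite oppr_le0 mulr_ge0 ?pos_part_ge0.
Qed.

Lemma bounded_mixture_re u : bounded_mfun (mixture_re u).
Proof.
apply: bounded_mfunM; first exact: bounded_damping.
apply: bounded_mfun_cos.
by apply: measurable_funM => //; exact: measurable_pos_part.
Qed.

Lemma bounded_mixture_im u : bounded_mfun (mixture_im u).
Proof.
apply: bounded_mfunM; first exact: bounded_damping.
apply: bounded_mfun_sin.
by apply: measurable_funM => //; exact: measurable_pos_part.
Qed.

Lemma mixture_re_le1 u z : `|mixture_re u z| <= 1.
Proof. by rewrite normrM mulr_ile1// ?cos_max// e_le1. Qed.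

Lemma mixture_im_le1 u z : `|mixture_im u z| <= 1.
Proof. by rewrite normrM mulr_ile1// ?sin_max// e_le1. Qed.

(** Once the normal variable is integrated out, only z is left and not sqrt z; the integrand is then
    Lipschitz, as [law_fun_cvg_mean] demands. *)
Lemma mixture_cvg_cf (V_ : nat -> probability R R) V :
  (forall x, law_fun (V_ n) x @[n --> \oo] --> law_fun V x) ->
  forall u, cf_re (mixture (V_ n)) u @[n --> \oo] --> cf_re (mixture V) u /\
    cf_im (mixture (V_ n)) u @[n --> \oo] --> cf_im (mixture V) u.
Proof.
move=> cV u; have K0 : 0 <= 2^-1 * (sigma * u) ^+ 2 + `|mu * u| by rewrite addr_ge0.
rewrite cf_re_mixture cf_im_mixture; split.
  under eq_fun do rewrite cf_re_mixture.
  apply: (law_fun_cvg_mean K0 _ (mixture_re_le1 u)) => //.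
  - by move=> x y; exact: mixture_re_lipschitz.
  - by case: (bounded_mixture_re u).
under eq_fun do rewrite cf_im_mixture.
apply: (law_fun_cvg_mean K0 _ (mixture_im_le1 u)) => //.
- by move=> x y; exact: mixture_im_lipschitz.
- by case: (bounded_mixture_im u).
Qed.

End mixture.

(** * Random sums *)

Section random_sum_law.
Context {d : measure_display} {T : measurableType d} {R : realType}.
Variables (P : probability T R) (X : nat -> {RV P >-> R}) (N : {RV P >-> nat}).

Definition random_sum (w : T) : R := partial_sum X (N w) w.

HB.instance Definition _ := isMeasurableFun.Build _ _ _ _
  random_sum (measurable_random_sum X N).

Definition random_sum_law : probability R R := distribution P random_sum.

Hypothesis X_iid : iid X.
Hypothesis indep : mutually_independent P (sigma_family N X).

Let nu : probability R R := distribution P (X 0%N).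

Lemma mean_step_law j (f : R -> R) :
  \int[distribution P (X j)]_x f x = \int[nu]_x f x.
Proof. by apply: eq_mean => A mA; exact: (proj2 X_iid). Qed.

Lemma sum_cf_re0 t : cf_re (sum_law X 0) t = 1.
Proof. by rewrite /cf_re (mean_sum_law0 X); [rewrite mulr0 cos0|exact: bounded_cos]. Qed.

Lemma sum_cf_im0 t : cf_im (sum_law X 0) t = 0.
Proof. by rewrite /cf_im (mean_sum_law0 X); [rewrite mulr0 sin0|exact: bounded_sin]. Qed.

Lemma sum_cf_reS j t : cf_re (sum_law X j.+1) t =
  cf_re (sum_law X j) t * cf_re nu t - cf_im (sum_law X j) t * cf_im nu t.
Proof.
rewrite {1}/cf_re (mean_sum_lawS indep); last exact: bounded_cos.
transitivity (\int[sum_law X j]_x (cf_re nu t * cos (t * x) + (- cf_im nu t) * sin (t * x))).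
  apply: eq_Rintegral => x _; rewrite mean_step_law.
  transitivity (\int[nu]_y (cos (t * x) * cos (t * y) + (- sin (t * x)) * sin (t * y))).
    by apply: eq_Rintegral => y _; rewrite mulrDr cosD mulNr.
  rewrite mean_lincomb; [|exact: bounded_cos|exact: bounded_sin].
  by rewrite -/(cf_re nu t) -/(cf_im nu t); ring.
rewrite mean_lincomb; [|exact: bounded_cos|exact: bounded_sin].
by rewrite -/(cf_re _ t) -/(cf_im _ t); ring.
Qed.

Lemma sum_cf_imS j t : cf_im (sum_law X j.+1) t =
  cf_im (sum_law X j) t * cf_re nu t + cf_re (sum_law X j) t * cf_im nu t.
Proof.
rewrite {1}/cf_im (mean_sum_lawS indep); last exact: bounded_sin.
transitivity (\int[sum_law X j]_x (cf_re nu t * sin (t * x) + cf_im nu t * cos (t * x))).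
  apply: eq_Rintegral => x _; rewrite mean_step_law.
  transitivity (\int[nu]_y (sin (t * x) * cos (t * y) + cos (t * x) * sin (t * y))).
    by apply: eq_Rintegral => y _; rewrite mulrDr sinD.
  rewrite mean_lincomb; [|exact: bounded_cos|exact: bounded_sin].
  by rewrite -/(cf_re nu t) -/(cf_im nu t); ring.
rewrite mean_lincomb; [|exact: bounded_sin|exact: bounded_cos].
by rewrite -/(cf_re _ t) -/(cf_im _ t); ring.
Qed.

Lemma bounded_count (f : nat -> R) (C : R) : (forall j, `|f j| <= C) ->
  bounded_mfun (fun w => f (N w)).
Proof.
move=> fC; split; last by exists C.
by apply: measurableT_comp => //; exact: measurable_funP.
Qed.

Lemma cf_re_random_sum t : cf_re random_sum_law t = \int[P]_w cf_re (sum_law X (N w)) t.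
Proof.
rewrite /cf_re mean_distribution; last exact: bounded_cos.
exact: (mean_random_sum indep (bounded_cos t)).
Qed.

Lemma cf_im_random_sum t : cf_im random_sum_law t = \int[P]_w cf_im (sum_law X (N w)) t.
Proof.
rewrite /cf_im mean_distribution; last exact: bounded_sin.
exact: (mean_random_sum indep (bounded_sin t)).
Qed.

Lemma measurable_count (A : set nat) : measurable (N @^-1` A).
Proof. by rewrite -[X in measurable X]setTI; exact: measurable_funP. Qed.

(* For more than [2 i k] summands the characteristic function of the sum has
   modulus at most that of a sum of [2 i k] summands. *)
Lemma random_sum_concentration (c : R) (i k : nat) :
  \int[random_sum_law]_x expR (- (2^-1 * (c * x) ^+ 2)) <=
  fine (P [set w | (N w <= i.*2 * k)%N]) +
  \int[gauss R]_z (cf_mod2 nu (c * z) ^+ k) ^+ i.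
Proof.
have mod2E j t : cf_mod2 (sum_law X j) t = cf_mod2 nu t ^+ j.
  elim: j => [|j ih].
    by rewrite /cf_mod2 sum_cf_re0 sum_cf_im0 expr0 expr1n expr0n/= addr0.
  by rewrite exprSr -ih /cf_mod2 sum_cf_reS sum_cf_imS; ring.
pose B z := (cf_mod2 nu (c * z) ^+ k) ^+ i.
have m01 z : 0 <= cf_mod2 nu (c * z) <= 1 by exact: cf_mod2_itv.
have B0 z : 0 <= B z by have /andP[? ?] := m01 z; rewrite !exprn_ge0.
have B1 z : B z <= 1.
  by have /andP[? ?] := m01 z; rewrite /B exprn_ile1 ?exprn_ge0 ?exprn_ile1.
have bB : bounded_mfun B.
  split; last by exists 1 => z; rewrite ger0_norm.
  apply: measurable_funX; apply: measurable_funX.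
  by apply: measurableT_comp; [exact: measurable_cf_mod2|exact: measurable_funM].
have mA : measurable [set w | (N w <= i.*2 * k)%N].
  exact: (measurable_count [set j | (j <= i.*2 * k)%N]).
pose A := [set w | (N w <= i.*2 * k)%N].
have H z : cf_re random_sum_law (c * z) <= fine (P A) + B z.
  rewrite cf_re_random_sum -(mean_indic P mA) -(mean_cst P (B z)) -meanD; last 2 first.
  - exact: bounded_mfun_indic.
  - exact: bounded_mfun_cst.
  apply: mean_le => [||w].
  - by apply: (@bounded_count (fun j => cf_re (sum_law X j) (c * z)) 1) => j; exact: norm_cf_re_le.
  - by apply: bounded_mfunD; [exact: bounded_mfun_indic|exact: bounded_mfun_cst].
  rewrite indicE; have [Nw|Nw] := leqP (N w) (i.*2 * k).
    rewrite mem_set//= (le_trans (ler_norm _))// (le_trans (norm_cf_re_le _ _))//.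
    by rewrite lerDl.
  rewrite memNset/=; last by rewrite /A /=; apply/negP; rewrite -ltnNge.
  (* [cf_mod2] is a squared modulus, so squares are compared; this is what doubles [i]. *)
  rewrite add0r (le_trans (ler_norm _))// -ler_sqr ?nnegrE// real_normK ?num_real//.
  have h1 : cf_re (sum_law X (N w)) (c * z) ^+ 2 <= cf_mod2 (sum_law X (N w)) (c * z).
    by rewrite /cf_mod2 lerDl sqr_ge0.
  apply: (le_trans h1); rewrite mod2E /B -!exprM.
  have /andP[q0 q1] := m01 z.
  rewrite (_ : (k * i * 2 = i.*2 * k)%N); last by rewrite -muln2; lia.
  by apply: ler_wiXn2l => //; exact: ltnW.
have swap : \int[random_sum_law]_x expR (- (2^-1 * (c * x) ^+ 2)) =
    \int[gauss R]_z cf_re random_sum_law (c * z).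
  pose f (p : R * R) := cos (c * p.2 * p.1).
  have bf : bounded_mfun f.
    by apply: bounded_mfun_cos; apply: measurable_funM => //; exact: measurable_funM.
  transitivity (\int[random_sum_law]_x \int[gauss R]_z f (x, z)).
    apply: eq_Rintegral => x _; rewrite -mean_gauss_cos.
    by apply: eq_Rintegral => z _; rewrite /f /=; congr cos; ring.
  by rewrite mean_fubini.
rewrite swap -/A -(mean_cst (gauss R) (fine (P A))) -meanD//; last exact: bounded_mfun_cst.
apply: mean_le => //.
- split; last by exists 1 => z; exact: norm_cf_re_le.
  by apply: measurableT_comp; [exact: measurable_cf_re|exact: measurable_funM].
- by apply: bounded_mfunD => //; exact: bounded_mfun_cst.
Qed.

End random_sum_law.

Section random_sums.
Context {d : measure_display} {T : measurableType d} {R : realType}.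
Variables (P : probability T R).
Variables (X : nat -> nat -> {RV P >-> R}) (N : nat -> {RV P >-> nat}).
Hypothesis X_iid : forall n, iid (X n).
Hypothesis indep : forall n, mutually_independent P (sigma_family (N n) (X n)).
Variables (k : nat -> nat) (mu sigma : R).
Hypothesis sigma_gt0 : 0 < sigma.
Hypothesis re_lim : forall t, cf_re (sum_law (X n) (k n)) t @[n --> \oo] -->
  expR (- (2^-1 * (sigma * t) ^+ 2)) * cos (mu * t).
Hypothesis im_lim : forall t, cf_im (sum_law (X n) (k n)) t @[n --> \oo] -->
  expR (- (2^-1 * (sigma * t) ^+ 2)) * sin (mu * t).

Let nu n : probability R R := distribution P (X n 0%N).
Let lam n := sum_law (X n).

Let re0 n t : cf_re (lam n 0) t = 1. Proof. exact: sum_cf_re0. Qed.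
Let im0 n t : cf_im (lam n 0) t = 0. Proof. exact: sum_cf_im0. Qed.
Let reS n m t := sum_cf_reS (X_iid n) (@indep n) m t.
Let imS n m t := sum_cf_imS (X_iid n) (@indep n) m t.

Lemma step_cf_mod2_lim t :
  cf_mod2 (nu n) t ^+ k n @[n --> \oo] --> expR (- (sigma * t) ^+ 2).
Proof. exact: (@cf_mod2_pow_lim _ nu lam k mu sigma re0 im0 reS imS re_lim im_lim). Qed.

(** An empty sum has characteristic function 1, whereas the limit has modulus below 1 at [t = 1]. *)
Lemma norming_gt0 : \forall n \near \oo, (0 < k n)%N.
Proof.
have h : expR (- (sigma * 1) ^+ 2) < 1.
  by rewrite mulr1 expR_lt1 oppr_lt0 exprn_even_gt0//= gt_eqF.
have : \forall n \near \oo, cf_mod2 (nu n) 1 ^+ k n < 1.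
  exact: (cvgr_lt _ (@step_cf_mod2_lim 1) _ h).
apply: filterS => n; rewrite lt0n; apply: contraTneq => ->.
by rewrite expr0 ltxx.
Qed.

Let residual (c : R) i : R := \int[gauss R]_z expR (- (sigma * (c * z)) ^+ 2) ^+ i.

Let residual_lim c i :
  \int[gauss R]_z (cf_mod2 (nu n) (c * z) ^+ k n) ^+ i @[n --> \oo] --> residual c i.
Proof.
apply: (@mean_bounded_cvg _ _ _ _ _ _ 1).
- move=> n; apply: measurable_funX; apply: measurable_funX.
  by apply: measurableT_comp; [exact: measurable_cf_mod2|exact: measurable_funM].
- near=> n => z; have /andP[? ?] := cf_mod2_itv (nu n) (c * z).
  by rewrite ger0_norm ?exprn_ge0// exprn_ile1 ?exprn_ge0// exprn_ile1.
- move=> z; have h := @step_cf_mod2_lim (c * z).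
  elim: i => [|i ih]; first by under eq_fun do rewrite expr0; rewrite expr0; exact: cvg_cst.
  by rewrite exprS; under eq_fun do rewrite exprS; exact: cvgM.
Unshelve. all: end_near. Qed.

Let residual0 c : 0 < c -> residual c i @[i --> \oo] --> 0.
Proof.
(* The powers tend to 0 except at [z = 0], a null set for [gauss]. *)
move=> c0; rewrite -[X in _ --> X](_ : \int[gauss R]_z \1_[set 0] z = 0); last first.
  by rewrite mean_indic// atomless_fine//; exact: gauss_atomless.
apply: (@mean_bounded_cvg _ _ _ _ _ _ 1).
- move=> i; apply: measurable_funX; apply: measurableT_comp => //.
  apply: measurableT_comp => //; apply: measurable_funX.
  by apply: measurable_funM => //; exact: measurable_funM.
- near=> i => z; rewrite ger0_norm ?exprn_ge0 ?expR_ge0//.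
  by rewrite exprn_ile1 ?expR_ge0// expR_le1 oppr_le0 sqr_ge0.
- move=> z; have [->|z0] := eqVneq z 0.
    rewrite indicE mem_set//=; under eq_fun do rewrite !mulr0 expr0n oppr0 expR0 expr1n.
    exact: cvg_cst.
  rewrite indicE memNset/=; last exact/eqP.
  apply: cvg_expr; rewrite ger0_norm ?expR_ge0// expR_lt1 oppr_lt0 exprn_even_gt0//=.
  by rewrite !mulf_neq0// gt_eqF.
Unshelve. all: end_near. Qed.

(** Tightness of the ratios [N n / k n], in product form so that it makes sense when [k n = 0]. *)
Definition tight_counts := forall e : R, 0 < e -> exists M : nat,
  \forall n \near \oo, fine (P [set w | (M * k n < N n w)%N]) <= e.

Let measurable_gtN n j : measurable [set w | (j < N n w)%N].
Proof. exact: (measurable_count (N n) [set i | (j < i)%N]). Qed.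

(** Choose c so small that the limit law keeps the mean of exp(- (c x)^2 / 2) within e / 4 of 1,
    then i so large that [residual c i] is below e / 4. [random_sum_concentration] then bounds the
    probability of at most 2 i k summands from below. *)
Lemma tight_counts_of_cvg (m : probability R R) :
  (forall t, cf_re (random_sum_law (X n) (N n)) t @[n --> \oo] --> cf_re m t) ->
  (forall t, cf_im (random_sum_law (X n) (N n)) t @[n --> \oo] --> cf_im m t) ->
  tight_counts.
Proof.
move=> cre cim e e0.
have e4 : 0 < e / 4 by rewrite divr_gt0.
have g1 : \int[m]_x expR (- (2^-1 * (j.+1%:R^-1 * x) ^+ 2)) @[j --> \oo] --> (1 : R).
  rewrite -[X in _ --> X](mean_cst m); apply: (@mean_bounded_cvg _ _ _ _ _ _ 1).
  - move=> j; apply: measurableT_comp => //; apply: measurableT_comp => //.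
    apply: measurable_funM => //; apply: measurable_funX; exact: measurable_funM.
  - near=> j => x; rewrite ger0_norm ?expR_ge0// expR_le1 oppr_le0 mulr_ge0 ?sqr_ge0//.
  - move=> x; rewrite -[X in _ --> X](@expR0 R); apply: continuous_cvg.
      exact: continuous_expR.
    rewrite -[X in _ --> X]oppr0; apply: cvgN; rewrite -[X in _ --> X](mulr0 2^-1).
    apply: cvgM; first exact: cvg_cst.
    have h : j.+1%:R^-1 * x @[j --> \oo] --> 0.
      rewrite -[X in _ --> X](mul0r x); apply: cvgM; last exact: cvg_cst.
      exact: cvg_harmonic.
    by rewrite -[X in _ --> X](mulr0 0); exact: (cvgM h h).
move/cvgrPdist_le : g1 => /(_ _ e4)[j _ /(_ j (leqnn _))].
set c := j.+1%:R^-1 => /ler_normlP[_ gc].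
have c0 : 0 < c by rewrite invr_gt0.
move/cvgrPdist_le : (residual0 c0) => /(_ _ e4)[i _ /(_ i (leqnn _))].
rewrite sub0r normrN => /(le_trans (ler_norm _)) ri.
exists (i.*2).
have c1 := @cvg_gauss_bump _ _ _ cre cim c 0 0.
have E (n : probability R R) :
    \int[n]_x (expR (- (2^-1 * (c * (x - 0)) ^+ 2)) * cos (0 * x)) =
    \int[n]_x expR (- (2^-1 * (c * x) ^+ 2)).
  by apply: eq_Rintegral => x _; rewrite subr0 mul0r cos0 mulr1.
rewrite E in c1; move: c1; under eq_fun do rewrite E.
move=> /cvgrPdist_le /(_ _ e4) c1.
move/cvgrPdist_le : (@residual_lim c i) => /(_ _ e4) c2.
near=> n.
have h1 : `|\int[m]_x expR (- (2^-1 * (c * x) ^+ 2)) -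
  \int[random_sum_law (X n) (N n)]_x expR (- (2^-1 * (c * x) ^+ 2))| <= e / 4 by near: n.
have h2 : `|residual c i - \int[gauss R]_z (cf_mod2 (nu n) (c * z) ^+ k n) ^+ i| <= e / 4.
  by near: n.
have h3 := random_sum_concentration (X_iid n) (@indep n) c i (k n).
have h4 : fine (P [set w | (i.*2 * k n < N n w)%N]) =
    1 - fine (P [set w | (N n w <= i.*2 * k n)%N]).
  rewrite -probC; last exact: (measurable_count (N n) [set j | (j <= i.*2 * k n)%N]).
  by congr (fine (P _)); apply/seteqP; split => w /=; rewrite ltnNge => /negP.
move/ler_normlP : h1 => [? ?]; move/ler_normlP : h2 => [? ?].
by rewrite h4; lra.
Unshelve. all: end_near. Qed.

(** If [k n < K], the event [M * K < N n], eventually of probability at least 3/4, lies in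
    [M * k n < N n], of probability at most 1/2. *)
Lemma tight_counts_infty : cvg_infty_in_prob N -> tight_counts -> tends_infty k.
Proof.
move=> Noo tc K; have h2 : 0 < 2^-1 :> R by rewrite invr_gt0.
have [M HM] := tc _ h2.
have h4 : 0 < 4^-1 :> R by rewrite invr_gt0.
move/cvgrPdist_le : (Noo (M * K)%N) => /(_ _ h4) h.
near=> n; rewrite leqNgt; apply/negP => kK.
have h1 : fine (P [set w | (M * k n < N n w)%N]) <= 2^-1 by near: n.
have : `|1 - fine (P [set w | (M * K < N n w)%N])| <= 4^-1 by near: n.
move/ler_normlP => [_ h3].
have : fine (P [set w | (M * K < N n w)%N]) <= fine (P [set w | (M * k n < N n w)%N]).
  apply: prob_le; do ?exact: measurable_gtN.
  by move=> w /=; apply: leq_ltn_trans; rewrite leq_mul2l (ltnW kK) orbT.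
by lra.
Unshelve. all: end_near. Qed.

(* Identically [0] when [k n = 0]. *)
Let ratio n (w : T) : R := (N n w)%:R / (k n)%:R.

Let measurable_ratio n : measurable_fun setT (ratio n).
Proof.
apply: (measurableT_comp (f := fun j : nat => j%:R / (k n)%:R : R)) => //.
Qed.

HB.instance Definition _ n := isMeasurableFun.Build _ _ _ _ (ratio n) (measurable_ratio n).

Definition ratio_law n : probability R R := distribution P (ratio n).

Lemma ratio_law_fun n x : (0 < k n)%N ->
  law_fun (ratio_law n) x = fine (P [set w | (N n w)%:R < x * (k n)%:R]).
Proof.
move=> k0; rewrite /law_fun; congr (fine (P _)).
by apply/seteqP; split => w /=; rewrite /ratio ltr_pdivrMr// ltr0n.
Qed.

Lemma ratio_law_tail n (M : nat) : (0 < k n)%N ->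
  fine (ratio_law n [set z | M%:R < z]) = fine (P [set w | (M * k n < N n w)%N]).
Proof.
move=> k0; congr (fine (P _)); apply/seteqP; split => w /=; rewrite /ratio.
  by rewrite ltr_pdivlMr ?ltr0n// -natrM ltr_nat.
by rewrite ltr_pdivlMr ?ltr0n// -natrM ltr_nat.
Qed.

(** Where [N n] is at most [M * k n], [array_limit] compares the integrands uniformly; elsewhere
    they differ by at most 2, on an event of probability at most [e / 4]. *)
Lemma cf_transfer : tends_infty k -> tight_counts -> forall t,
  cf_re (random_sum_law (X n) (N n)) t - cf_re (mixture mu sigma (ratio_law n)) t
    @[n --> \oo] --> 0 /\
  cf_im (random_sum_law (X n) (N n)) t - cf_im (mixture mu sigma (ratio_law n)) t
    @[n --> \oo] --> 0.
Proof.
move=> koo tc t.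
have key (a : nat -> nat -> R) (b : nat -> R -> R) :
    (forall n j, `|a n j| <= 1) -> (forall n z, `|b n z| <= 1) ->
    (forall n, measurable_fun setT (b n)) ->
    (forall (M : nat) (e : R), 0 < e -> \forall n \near \oo, forall j, (j <= M * k n)%N ->
      `|a n j - b n (j%:R / (k n)%:R)| <= e) ->
    \int[P]_w a n (N n w) - \int[ratio_law n]_z b n z @[n --> \oo] --> 0.
  move=> a1 b1 mb H; apply/cvgrPdist_le => e e0.
  have e2 : 0 < e / 2 by rewrite divr_gt0.
  have e4 : 0 < e / 4 by rewrite divr_gt0.
  have [M HM] := tc _ e4; have {}H := H M _ e2.
  near=> n; rewrite sub0r normrN.
  have Hn : forall j, (j <= M * k n)%N -> `|a n j - b n (j%:R / (k n)%:R)| <= e / 2.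
    by near: n; exact: H.
  have HMn : fine (P [set w | (M * k n < N n w)%N]) <= e / 4 by near: n.
  have bb : bounded_mfun (b n) by split => //; exists 1; exact: b1.
  have ba : bounded_mfun (fun w => a n (N n w)).
    exact: (bounded_count (N n) (a1 n)).
  have bc : bounded_mfun (fun w => b n (ratio n w)).
    by apply: (bounded_mfun_comp bb); exact: measurable_ratio.
  pose A := [set w | (M * k n < N n w)%N].
  have mA : measurable A by exact: measurable_gtN.
  have bA := bounded_mfun_indic (R := R) mA.
  rewrite mean_distribution// -meanB// (le_trans (norm_mean _ (bounded_mfunB ba bc)))//.
  apply: (@le_trans _ _ (\int[P]_w (e / 2 * 1 + 2 * \1_A w))).
    apply: mean_le => [||w].
    - by apply: bounded_mfun_norm; exact: bounded_mfunB.
    - apply: bounded_mfunD; first exact: bounded_mfun_cst.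
      by apply: bounded_mfunM => //; exact: bounded_mfun_cst.
    rewrite indicE; have [NM|NM] := ltnP (M * k n) (N n w).
      rewrite mem_set//= (le_trans (ler_normB _ _))//.
      by have := a1 n (N n w); have := b1 n (ratio n w); lra.
    rewrite memNset/=; last by rewrite /A /=; apply/negP; rewrite -leqNgt.
    by rewrite mulr0 addr0 mulr1; exact: Hn.
  rewrite mean_lincomb//; last exact: bounded_mfun_cst.
  rewrite mean_cst mean_indic//.
  by move: HMn; rewrite -/A; lra.
have AL := @array_limit _ nu lam k mu sigma re0 im0 reS imS re_lim im_lim koo t.
split.
- under eq_fun do rewrite (cf_re_random_sum (@indep _)) cf_re_mixture.
  apply: (key (fun n j => cf_re (lam n j) t) (fun n => mixture_re mu sigma t)).
  + by move=> n j; exact: norm_cf_re_le.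
  + by move=> n z; exact: mixture_re_le1.
  + by move=> n; case: (bounded_mixture_re mu sigma t).
  + move=> M e e0; apply: filterS (AL M e e0) => n H j jM.
    by have [h _] := H j jM; rewrite /mixture_re pos_part_id ?divr_ge0.
- under eq_fun do rewrite (cf_im_random_sum (@indep _)) cf_im_mixture.
  apply: (key (fun n j => cf_im (lam n j) t) (fun n => mixture_im mu sigma t)).
  + by move=> n j; exact: norm_cf_im_le.
  + by move=> n z; exact: mixture_im_le1.
  + by move=> n; case: (bounded_mixture_im mu sigma t).
  + move=> M e e0; apply: filterS (AL M e e0) => n H j jM.
    by have [_ h] := H j jM; rewrite /mixture_im pos_part_id ?divr_ge0.
Unshelve. all: end_near. Qed.

End random_sums.

(** * Recovering the mixing law *)

Section laplace.
Context {R : realType}.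
Variables (mu sigma : R).
Hypothesis sigma_gt0 : 0 < sigma.
Implicit Types (V : probability R R) (t s z : R).

(** Given V = z, exp(lam W) has mean exp((lam mu + lam^2 sigma^2 / 2) z), which for this value of
    [lam] is exp(- c z). *)
Let lam := - mu / sigma ^+ 2.
Let c := mu ^+ 2 / (2 * sigma ^+ 2).

(** Equal, up to the constant factor exp(- (lam / s)^2 / 2), to exp(lam x) exp(- (s x)^2 / 2) cos(t
    x): the exponential tilt made bounded by a Gaussian cut-off of width 1 / s. *)
Let bump s t (x : R) : R :=
  expR (- (2^-1 * (s * (x - lam / s ^+ 2)) ^+ 2)) * cos (t * x).

Let damped s t z (y : R) : R :=
  expR (- (2^-1 * (s * (sigma * Num.sqrt z * y)) ^+ 2)) * cos (t * (sigma * Num.sqrt z * y)).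

Let bounded_bump s t : bounded_mfun (bump s t).
Proof.
apply: bounded_mfunM; last exact: bounded_cos.
apply: bounded_mfun_gauss.
by apply: measurable_funM => //; exact: measurable_funB.
Qed.

Let bounded_damped s t z : bounded_mfun (damped s t z).
Proof.
apply: bounded_mfunM.
  apply: bounded_mfun_gauss.
  by apply: measurable_funM => //; exact: measurable_funM.
by apply: bounded_mfun_cos; apply: measurable_funM => //; exact: measurable_funM.
Qed.

Let sigma_neq0 : sigma != 0. Proof. by rewrite gt_eqF. Qed.

(* The factor [exp (lam * x)] hidden in [bump] is chosen so that the Gaussian
   shift it induces cancels the drift [mu * z]. *)
Let mean_bump s t z : s != 0 ->
  expR (2^-1 * (lam / s) ^+ 2) *
    \int[gauss R]_y bump s t (mu * pos_part z + sigma * Num.sqrt z * y) =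
  expR (- (c * pos_part z)) * \int[gauss R]_y damped s t z y.
Proof.
move=> s0.
have bm : bounded_mfun
    (fun y : R => bump s t (mu * pos_part z + sigma * Num.sqrt z * y)).
  apply: (bounded_mfun_comp (bounded_bump s t)).
  by apply: measurable_funD => //; exact: measurable_funM.
rewrite -meanZ//; pose a := lam * (sigma * Num.sqrt z).
pose X y := mu * pos_part z + sigma * Num.sqrt z * y.
pose F y := expR (lam * (mu * pos_part z)) *
   (expR (- (2^-1 * (s * X y) ^+ 2)) * cos (t * X y)).
have mX : measurable_fun setT X by apply: measurable_funD => //; exact: measurable_funM.
have bF : bounded_mfun F.
  apply: bounded_mfunM; first exact: bounded_mfun_cst.
  apply: bounded_mfunM; last by apply: bounded_mfun_cos; exact: measurable_funM.
  apply: bounded_mfun_gauss.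
  exact: measurable_funM.
transitivity (\int[gauss R]_y (F y * expR (a * y))).
  apply: eq_Rintegral => y _; rewrite /F /bump -/(X y) mulrA -expRD.
  rewrite [RHS]mulrC !mulrA -!expRD; congr (expR _ * _).
  by rewrite /a /X /lam /pos_part; field; rewrite s0 sigma_neq0.
rewrite (mean_gauss_shift a bF).
have E y : F (y + a) = expR (lam * (mu * pos_part z)) * damped s t z y.
  rewrite /F /damped (_ : X (y + a) = sigma * Num.sqrt z * y)//.
  by rewrite /X /a /lam /pos_part; field.
under eq_Rintegral do rewrite E.
rewrite meanZ// mulrA -expRD; congr (expR _ * _).
by rewrite /a /c /lam /pos_part; field.
Qed.

(** Serves as an upper bound for the Gaussian second moment. *)
Let K : R := \int[gauss R]_y ((1 + `|y| * 1) ^+ 2).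

Let K0 : 0 <= K. Proof. by apply: mean_ge0 => y; exact: sqr_ge0. Qed.

(** Removing the cut-off costs at most 1 - exp(- w) <= w, with w = (s sigma y)^2 z / 2. The price
    grows linearly in z, whence the role of tightness below. *)
Let damping_error s t z :
  `|\int[gauss R]_y damped s t z y - expR (- (2^-1 * (sigma * t) ^+ 2 * pos_part z))|
  <= 2^-1 * (s * sigma) ^+ 2 * K * pos_part z.
Proof.
have bc : bounded_mfun (fun y : R => cos (t * sigma * Num.sqrt z * y)).
  exact: bounded_cos.
rewrite [X in _ - X](_ : _ = \int[gauss R]_y cos (t * sigma * Num.sqrt z * y)); last first.
  by rewrite mean_gauss_cos; congr expR; rewrite /pos_part; ring.
rewrite -meanB//; apply: (le_trans (norm_mean _ (bounded_mfunB (bounded_damped s t z) bc))).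
pose C := 2^-1 * (s * sigma) ^+ 2 * pos_part z.
have C0 : 0 <= C by rewrite mulr_ge0 ?pos_part_ge0// mulr_ge0 ?sqr_ge0 ?invr_ge0.
apply: (@le_trans _ _ (\int[gauss R]_y (C * (1 + `|y| * 1) ^+ 2))); last first.
  rewrite RintegralZl//; last exact: gauss_integrable_sqr.
  by rewrite -/K /C mulrAC.
apply: le_Rintegral => //.
- by apply: bounded_integrable; apply: bounded_mfun_norm; exact: bounded_mfunB.
- by have := integrableZl measurableT C (gauss_integrable_sqr (@ler01 R)); exact.
move=> y _; rewrite /damped.
set w := 2^-1 * (s * (sigma * Num.sqrt z * y)) ^+ 2.
have w0 : 0 <= w by rewrite mulr_ge0 ?sqr_ge0.
rewrite (_ : t * (sigma * _ * y) = t * sigma * Num.sqrt z * y); last by ring.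
rewrite -[X in _ - X]mul1r -mulrBl normrM.
have e1 : expR (- w) <= 1 by rewrite expR_le1 oppr_le0.
have e2 : 1 - w <= expR (- w) by exact: expR_ge1Dx.
have h1 : `|expR (- w) - 1| <= w by rewrite ler0_norm; lra.
have h2 : `|cos (t * sigma * Num.sqrt z * y)| <= 1 by exact: cos_max.
apply: (@le_trans _ _ (w * 1)); first exact: ler_pM.
have -> : w = C * `|y| ^+ 2 by rewrite real_normK ?num_real// /w /C /pos_part; ring.
rewrite mulr1 ler_wpM2l// ler_sqr ?nnegrE ?addr_ge0 ?mulr_ge0//.
by rewrite mulr1 lerDr.
Qed.

(** For fixed s the integrals of [bump] converge. The choice of s precedes that of n: it makes the
    cut-off harmless for z <= M, simultaneously for [V] and all [V_ n], and beyond M the tails are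
    small. *)
Lemma mixture_cf_cvg_laplace (V_ : nat -> probability R R) V :
  (forall t, cf_re (mixture mu sigma (V_ n)) t @[n --> \oo] --> cf_re (mixture mu sigma V) t) ->
  (forall t, cf_im (mixture mu sigma (V_ n)) t @[n --> \oo] --> cf_im (mixture mu sigma V) t) ->
  (forall e : R, 0 < e -> exists M : nat,
    \forall n \near \oo, fine (V_ n [set z | M%:R < z]) <= e) ->
  forall t, \int[V_ n]_z expR (- ((c + 2^-1 * (sigma * t) ^+ 2) * pos_part z)) @[n --> \oo] -->
    \int[V]_z expR (- ((c + 2^-1 * (sigma * t) ^+ 2) * pos_part z)).
Proof.
move=> cre cim tight t; apply/cvgrPdist_le => e e0.
have e16 : 0 < e / 16 by rewrite divr_gt0.
have [M1 HM1] := tight _ e16.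
have [M2 HM2 _] := law_fun_ge1B V e16.
pose M := maxn M1 M2.
pose tail := [set z : R | M%:R < z].
have mtail : measurable tail by exact: measurable_gt.
pose q := 1 + sigma ^+ 2 * K * M%:R.
have q1 : 1 <= q by rewrite lerDl mulr_ge0// mulr_ge0 ?sqr_ge0.
have [s [s0 s1 sq]] : exists s, [/\ 0 < s, s <= 1 & s * q <= e / 16].
  have qp : 0 < q by exact: lt_le_trans q1.
  exists (Num.min 1 (e / 16 / q)); split.
  - by rewrite lt_min ltr01 divr_gt0.
  - by rewrite ge_min lexx.
  - by rewrite -ler_pdivlMr// ge_min lexx orbT.
have s_neq0 : s != 0 by rewrite gt_eqF.
pose Q z := \int[gauss R]_y damped s t z y.
pose L z := expR (- (c * pos_part z)).
pose E0 := expR (2^-1 * (lam / s) ^+ 2).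
have c0 : 0 <= c by rewrite divr_ge0 ?sqr_ge0// mulr_ge0 ?sqr_ge0.
have bexp b : 0 <= b -> bounded_mfun (fun z => expR (- (b * pos_part z))).
  move=> b0; apply: bounded_mfun_expR => [|z].
    by apply: measurableT_comp => //; apply: measurable_funM => //; exact: measurable_pos_part.
  by rewrite oppr_le0 mulr_ge0 ?pos_part_ge0.
have b0 : 0 <= 2^-1 * (sigma * t) ^+ 2 by rewrite mulr_ge0 ?sqr_ge0 ?invr_ge0.
set b := 2^-1 * (sigma * t) ^+ 2 in b0 *.
have bQ : bounded_mfun Q.
  pose f (p : R * R) := damped s t p.1 p.2.
  have mf : measurable_fun setT (fun p : R * R => sigma * Num.sqrt p.1 * p.2).
    apply: measurable_funM => //; apply: measurable_funM => //.
    exact: (measurableT_comp measurable_sqrtr).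
  apply: (@bounded_mfun_mean _ _ _ _ _ (gauss R) (gauss R) f).
  apply: bounded_mfunM; last by apply: bounded_mfun_cos; exact: measurable_funM.
  apply: bounded_mfun_gauss.
  exact: measurable_funM.
have bLQ : bounded_mfun (fun z => L z * Q z) by apply: bounded_mfunM => //; exact: bexp.
have bA := bexp _ (addr_ge0 c0 b0).
have BE (m : probability R R) :
    \int[m]_z (L z * Q z) = E0 * \int[mixture mu sigma m]_x bump s t x.
  rewrite mean_mixture; last exact: bounded_bump.
  rewrite -meanZ; last first.
    pose f (p : R * R) := bump s t (mixture_map mu sigma p).
    apply: (@bounded_mfun_mean _ _ _ _ _ (gauss R) (gauss R) f).
    apply: (bounded_mfun_comp (bounded_bump s t)).
    exact: measurable_mixture_map.
  by apply: eq_Rintegral => z _; rewrite mean_bump.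
have close (m : probability R R) :
    `|\int[m]_z expR (- ((c + b) * pos_part z)) - \int[m]_z (L z * Q z)| <=
    e / 16 + 2 * fine (m tail).
  rewrite -meanB// (le_trans (norm_mean _ (bounded_mfunB bA bLQ)))//.
  apply: (@le_trans _ _ (\int[m]_z (e / 16 * 1 + 2 * \1_tail z))); last first.
    rewrite mean_lincomb; [|exact: bounded_mfun_cst|exact: bounded_mfun_indic].
    by rewrite mean_cst mean_indic// mulr1.
  apply: mean_le => [||z].
  - by apply: bounded_mfun_norm; exact: bounded_mfunB.
  - apply: bounded_mfunD; first exact: bounded_mfun_cst.
    apply: bounded_mfunM; first exact: bounded_mfun_cst.
    exact: bounded_mfun_indic.
  rewrite mulrDl opprD expRD -mulrBr normrM ger0_norm ?expR_ge0// mulr1.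
  have L1 : expR (- (c * pos_part z)) <= 1.
    by rewrite expR_le1 oppr_le0 mulr_ge0 ?pos_part_ge0.
  apply: (@le_trans _ _ (1 * `|expR (- (b * pos_part z)) - Q z|)).
    by rewrite ler_wpM2r.
  rewrite mul1r indicE; have [zM|zM] := ltP M%:R z.
    rewrite mem_set//= (le_trans (ler_normB _ _))//.
    have h1 : `|expR (- (b * pos_part z))| <= 1.
      by rewrite ger0_norm ?expR_ge0// expR_le1 oppr_le0 mulr_ge0 ?pos_part_ge0.
    have h2 : `|Q z| <= 1.
      apply: mean_norm_le; first by case: (bounded_damped s t z).
      move=> y; rewrite /damped normrM ger0_norm ?expR_ge0// -[leRHS]mulr1.
      apply: ler_pM; rewrite ?expR_ge0 ?cos_max// expR_le1 oppr_le0.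
      by rewrite mulr_ge0 ?invr_ge0 ?sqr_ge0.
    by lra.
  rewrite memNset/=; last by rewrite /tail /=; apply/negP; rewrite -leNgt.
  rewrite mulr0 addr0 distrC (le_trans (damping_error s t z))// (le_trans _ sq)//.
  have pM : pos_part z <= M%:R.
    have [z0|/ltW z0] := leP 0 z; first by rewrite pos_part_id.
    by rewrite pos_part0.
  have -> : 2^-1 * (s * sigma) ^+ 2 * K * pos_part z =
    s * (2^-1 * (s * (sigma ^+ 2 * K * pos_part z))) by ring.
  rewrite ler_pM2l//.
  have h0 : 0 <= sigma ^+ 2 * K * pos_part z by rewrite mulr_ge0 ?pos_part_ge0// mulr_ge0 ?sqr_ge0.
  have h1 : sigma ^+ 2 * K * pos_part z <= sigma ^+ 2 * K * M%:R.
    by rewrite ler_wpM2l// mulr_ge0 ?sqr_ge0.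
  have h2 : s * (sigma ^+ 2 * K * pos_part z) <= 1 * (sigma ^+ 2 * K * pos_part z).
    by rewrite ler_wpM2r.
  by rewrite /q; lra.
have Blim : \int[V_ n]_z (L z * Q z) @[n --> \oo] --> \int[V]_z (L z * Q z).
  rewrite BE; under eq_fun do rewrite BE.
  apply: cvgM; first exact: cvg_cst.
  exact: (cvg_gauss_bump cre cim).
have tailV : fine (V tail) <= e / 16.
  have h1 : fine (V tail) <= 1 - law_fun V M2%:R.
    rewrite /law_fun -probC; last exact: measurable_lt.
    apply: prob_le => //; first by apply: measurableC; exact: measurable_lt.
    move=> z /= /ltW Mz; apply/negP; rewrite -leNgt (le_trans _ Mz)//.
    by rewrite ler_nat leq_maxr.
  by lra.
have e4 : 0 < e / 4 by rewrite divr_gt0.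
move/cvgrPdist_le : Blim => /(_ _ e4) Blim.
near=> n.
have h1 : fine (V_ n tail) <= e / 16.
  apply: (@le_trans _ _ (fine (V_ n [set z | M1%:R < z]))); last by near: n.
  apply: prob_le => //; first exact: measurable_gt.
  by move=> z /=; apply: le_lt_trans; rewrite ler_nat leq_maxl.
have h2 : `|\int[V]_z (L z * Q z) - \int[V_ n]_z (L z * Q z)| <= e / 4 by near: n.
have h3 := close V; have h4 := close (V_ n).
move/ler_normlP : h2 => [? ?]; move/ler_normlP : h3 => [? ?]; move/ler_normlP : h4 => [? ?].
by apply/ler_normlP; split; lra.
Unshelve. all: end_near. Qed.

(** All powers j >= 1 of exp(- (c + 1) z) are Laplace kernels at points j (c + 1) >= c, where
    convergence is known. The summand 1 keeps the function nonconstant when mu = 0. Its level sets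
    see only the positive part of z, so they are half-lines bounded by x for x > 0. *)
Lemma mixture_cf_cvg_law_fun (V_ : nat -> probability R R) V : atomless V ->
  (forall t, cf_re (mixture mu sigma (V_ n)) t @[n --> \oo] --> cf_re (mixture mu sigma V) t) ->
  (forall t, cf_im (mixture mu sigma (V_ n)) t @[n --> \oo] --> cf_im (mixture mu sigma V) t) ->
  (forall e : R, 0 < e -> exists M : nat,
    \forall n \near \oo, fine (V_ n [set z | M%:R < z]) <= e) ->
  forall x, 0 < x -> law_fun (V_ n) x @[n --> \oo] --> law_fun V x.
Proof.
move=> aV cre cim tight x x0.
have c0 : 0 <= c by rewrite divr_ge0 ?sqr_ge0// mulr_ge0 ?sqr_ge0.
have c1 : 0 < c + 1 by lra.
pose f z := expR (- ((c + 1) * pos_part z)).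
have mf : measurable_fun setT f.
  by apply: measurableT_comp => //; apply: measurableT_comp => //;
    apply: measurable_funM => //; exact: measurable_pos_part.
have f01 z : 0 <= f z <= 1.
  by rewrite expR_ge0 expR_le1 oppr_le0 mulr_ge0 ?pos_part_ge0 ?ltW.
have moments j : \int[V_ n]_z (f z ^+ j) @[n --> \oo] --> \int[V]_z (f z ^+ j).
  case: j => [|j].
    under eq_fun do (under eq_Rintegral do rewrite expr0).
    under eq_Rintegral do rewrite expr0.
    by rewrite mean_cst; under eq_fun do rewrite mean_cst; exact: cvg_cst.
  (* The frequency at which c + sigma^2 t^2 / 2 equals (j + 1) (c + 1). *)
  pose t := Num.sqrt (2 * (j.+1%:R * (c + 1) - c)) / sigma.
  have tE : c + 2^-1 * (sigma * t) ^+ 2 = j.+1%:R * (c + 1).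
    have -> : sigma * t = Num.sqrt (2 * (j.+1%:R * (c + 1) - c)).
      by rewrite /t mulrCA mulfV ?mulr1.
    rewrite sqr_sqrtr; first by field.
    have : 0 <= j%:R * (c + 1) by rewrite mulr_ge0// ltW.
    by rewrite -[j.+1%:R]natr1 mulrDl mul1r; lra.
  have H := @mixture_cf_cvg_laplace _ _ cre cim tight t.
  have E z : f z ^+ j.+1 = expR (- ((c + 2^-1 * (sigma * t) ^+ 2) * pos_part z)).
    by rewrite tE /f -expRM_natl; congr expR; ring.
  have EI (m : probability R R) : \int[m]_z (f z ^+ j.+1) =
      \int[m]_z expR (- ((c + 2^-1 * (sigma * t) ^+ 2) * pos_part z)).
    by apply: eq_Rintegral => z _; exact: E.
  by rewrite EI; under eq_fun do rewrite EI.
pose r := expR (- ((c + 1) * x)).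
have r0 : 0 < r by exact: expR_gt0.
have r1 : r < 1 by rewrite expR_lt1 oppr_lt0 mulr_gt0.
have fr z : (r < f z) = (z < x).
  rewrite ltr_expR ltrN2 ltr_pM2l//; have [z0|z0] := leP 0 z; first by rewrite pos_part_id.
  by rewrite pos_part0 ?(ltW z0)// x0 (lt_trans z0 x0).
have rf z : (f z < r) = (x < z).
  rewrite ltr_expR ltrN2 ltr_pM2l//; have [z0|z0] := leP 0 z; first by rewrite pos_part_id.
  by rewrite pos_part0 ?(ltW z0)// !ltNge (ltW x0) (ltW (lt_trans z0 x0)).
apply/cvgrPdist_le => e e0.
have := moments_liminf mf f01 moments r0 e0.
have := moments_limsup mf f01 moments r1 e0.
rewrite (_ : [set z | f z < r] = [set z | x < z]); last by apply/seteqP; split => z /=; rewrite rf.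
rewrite (_ : [set z | r < f z] = [set z | z < x]); last by apply/seteqP; split => z /=; rewrite fr.
move=> sup inf; near=> n.
have h1 : fine (V [set z | z < x]) - e <= fine (V_ n [set z | z < x]) by near: n.
have h2 : fine (V [set z | x < z]) - e <= fine (V_ n [set z | x < z]) by near: n.
have h3 : fine (V_ n [set z | x < z]) <= 1 - law_fun (V_ n) x.
  rewrite /law_fun -probC; last exact: measurable_lt.
  apply: prob_le; [exact: measurable_gt|by apply: measurableC; exact: measurable_lt|].
  by move=> z /= /ltW xz; apply/negP; rewrite -leNgt.
rewrite prob_gtE// in h2; rewrite -!/(law_fun _ _) in h1.
by apply/ler_normlP; split; lra.
Unshelve. all: end_near. Qed.

End laplace.

(** The two limits upgrade [F] to a [cumulativeBounded] function, whose Stieltjes measure is a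
    probability. *)
Lemma stieltjes_probability {R : realType} (F : cumulative R R) :
  F x @[x --> -oo] --> (0 : R) -> F x @[x --> +oo] --> (1 : R) ->
  exists H : probability (measurableTypeR R) R,
    forall A, H A = lebesgue_stieltjes_measure F A.
Proof.
move=> F0 F1.
have b := isCumulativeBounded.Build R 0 1 (Cumulative.sort F) F0 F1.
have [Fb <-] : exists Fb : cumulativeBounded (0 : R) (1 : R), Fb = F :> cumulative R R.
  case: F F0 F1 b => f [c] _ _ b.
  by exists (CumulativeBounded.Pack (CumulativeBounded.Class b c)).
by exists (lebesgue_stieltjes_measure Fb).
Qed.

(** Replaces the Stieltjes integral in [weibull_II] by a mean under a law on the canonical reals.
    Continuity of [F] excludes atoms: a point lies in intervals of arbitrarily small increment. *)
Lemma stieltjes_law {R : realType} (F : cumulative R R) :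
  F x @[x --> -oo] --> (0 : R) -> F x @[x --> +oo] --> (1 : R) -> continuous F ->
  exists H : probability R R, [/\ atomless H, law_fun H =1 F &
    forall (D : set R) (g : R -> R), measurable D -> measurable_fun setT g ->
      (forall x, 0 <= g x) ->
      \int[lebesgue_stieltjes_measure F]_(x in D) g x = \int[H]_(x in D) g x].
Proof.
move=> F0 F1 cF; have [m mE] := stieltjes_probability F0 F1.
pose H : probability R R := canonical_law m.
have Hitv a b : a <= b -> fine (H `]a, b]%classic) = F b - F a.
  move=> ab; rewrite /H canonical_lawE.
  have -> : m `]a, b]%classic = (F b - F a)%:E.
    rewrite mE /lebesgue_stieltjes_measure /measure_extension measurable_mu_extE/=;
      last exact: is_ocitv.
    by rewrite wlength_itv_bnd.
  by [].
have aH : atomless H.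
  move=> x; rewrite -[LHS]fineK ?fin_num_measure//; congr EFin.
  apply/eqP; rewrite eq_le prob_ge0 andbT; apply/ler_addgt0Pl => e e0; rewrite addr0.
  move/cvgrPdist_le : (cF x) => /(_ _ e0) [d /= d0 dx].
  have xd : x - d / 2 <= x by rewrite gerDl oppr_le0 divr_ge0 ?ltW.
  apply: (@le_trans _ _ (fine (H `]x - d / 2, x]%classic))).
    apply: prob_le => //; move=> z /= ->; rewrite in_itv/= lexx andbT.
    by rewrite gtrDl oppr_lt0 divr_gt0.
  rewrite Hitv// (le_trans (ler_norm _))//; apply: dx => /=.
  by rewrite opprB addrC subrK ger0_norm ?divr_ge0 ?ltW//; lra.
exists H; split => //.
- move=> x; rewrite law_funE//.
  have h1 : fine (H `]x - n%:R, x]%classic) @[n --> \oo] --> fine (H `]-oo, x]%classic).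
    apply: (@mean_indic_cvg _ _ _ H (fun n => `]x - n%:R, x]%classic)) => // z.
    have [A HA] : exists A : nat, `|x - z| < A%:R.
      by exists (Num.bound `|x - z|); exact: archi_boundP.
    exists A => // n /= An; rewrite !in_itv/=; split => [/andP[]//|zx]; rewrite zx andbT.
    have : A%:R <= n%:R :> R by rewrite ler_nat.
    by move/ltr_normlP : HA => [_ ?]; lra.
  have h2 : fine (H `]x - n%:R, x]%classic) @[n --> \oo] --> F x - 0.
    have E n : fine (H `]x - n%:R, x]%classic) = F x - F (x - n%:R).
      by rewrite Hitv// gerDl oppr_le0.
    under eq_fun do rewrite E; apply: cvgB; first exact: cvg_cst.
    apply: (cvg_ninftyP _ _).1 => //; apply/cvgrNyPle => A.
    have [B HB] : exists B : nat, `|x - A| < B%:R.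
      by exists (Num.bound `|x - A|); exact: archi_boundP.
    exists B => // n /= Bn; have : B%:R <= n%:R :> R by rewrite ler_nat.
    by move/ltr_normlP : HB => [_ ?]; lra.
  by rewrite subr0 in h2; exact: cvg_unique h1 h2.
- move=> D g mD mg g0.
  apply: (etrans (@Rintegral_mkcond _ _ _ (lebesgue_stieltjes_measure F) D g)).
  apply: (etrans _ (esym (@Rintegral_mkcond _ _ _ H D g))).
  have mgD : measurable_fun setT (g \_ D).
    by apply: (measurable_restrictT g mD).1; exact: measurable_funTS.
  have gD0 x : 0 <= (g \_ D) x by rewrite patch_indic /= mulr_ge0 ?g0// indicE.
  rewrite /Rintegral; congr fine.
  have mE' : measurable_fun setT (EFin \o (g \_ D)) by exact/measurable_EFinP.
  have gE0 x : (0 <= (EFin \o (g \_ D)) x)%E by rewrite lee_fin.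
  rewrite (ge0_integral_canonical_law m mE' gE0).
  by apply: eq_measure_integral => A mA _; exact: esym (mE A).
Qed.

(** * The Weibull mixture *)

Section positive_law.
Context {R : realType}.
Variable m : probability R R.
Hypothesis m_gt0 : fine (m [set z | 0 < z]) = 1.

Lemma mean_positive (f : R -> R) : bounded_mfun f ->
  \int[m]_z f z = \int[m]_z (\1_[set z | 0 < z] z * f z).
Proof.
move=> bf; have [mf [C fC]] := bf.
have bi : bounded_mfun (\1_[set z : R | 0 < z] : R -> R).
  by apply: bounded_mfun_indic; exact: measurable_gt.
have bif : bounded_mfun (fun z : R => \1_[set z : R | 0 < z] z * f z).
  exact: bounded_mfunM.
apply/eqP; rewrite -subr_eq0 -meanB// -normr_le0.
rewrite (le_trans (norm_mean _ (bounded_mfunB bf bif)))//.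
apply: (@le_trans _ _ (\int[m]_z (C * 1 + (- C) * \1_[set z : R | 0 < z] z))).
  apply: mean_le => [||z].
  - by apply: bounded_mfun_norm; exact: bounded_mfunB.
  - apply: bounded_mfunD; first exact: bounded_mfun_cst.
    by apply: bounded_mfunM => //; exact: bounded_mfun_cst.
  rewrite indicE; case: (_ \in _) => /=.
    by rewrite mul1r subrr normr0 !mulr1 subrr.
  by rewrite mul0r subr0 mulr0 addr0 mulr1.
rewrite mean_lincomb//; last exact: bounded_mfun_cst.
by rewrite mean_cst mean_indic ?m_gt0; [rewrite !mulr1 subrr|exact: measurable_gt].
Qed.

(** Reconciles the domains of integration: the closed half-line of [Hmix], the open one of
    [weibull_II], and the whole line. *)
Lemma mean_in_positive (D : set R) (f : R -> R) : measurable D ->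
  [set z | 0 < z] `<=` D -> bounded_mfun f ->
  \int[m]_(z in D) f z = \int[m]_z (\1_[set z | 0 < z] z * f z).
Proof.
move=> mD posD bf; rewrite Rintegral_mkcond patch_indic.
have bfD : bounded_mfun (fun z => f z * \1_D z).
  by apply: bounded_mfunM => //; exact: bounded_mfun_indic.
apply: (etrans (mean_positive bfD)); apply: eq_Rintegral => z _.
rewrite !indicE; have [z0|z0] := ltP 0 z.
  by rewrite !mem_set//= ?mulr1//; exact: posD.
by rewrite memNset ?mul0r//=; apply/negP; rewrite -leNgt.
Qed.

End positive_law.

Section mixing_law.
Context {R : realType}.
Variables (g : R) (G : probability R R).
Hypotheses (g_le1 : g <= 1) (hG : one_sided_stable_law g G).

Lemma stable_law_gt0 : fine (G [set z | 0 < z]) = 1.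
Proof.
have [h1 h2] := hG.
have E : [set z : R | 0 < z] = `]0, +oo[%classic.
  by apply/seteqP; split => z /=; rewrite in_itv/= andbT.
move: g_le1; rewrite le_eqVlt => /orP[/eqP gE|glt].
  apply/eqP; rewrite eq_le prob_le1/=; last exact: measurable_gt.
  rewrite -(_ : fine (G [set 2]) = 1); last by rewrite h2.
  by apply: prob_le => //; [exact: measurable_gt|move=> z /= ->].
by have [E1 _ _] := h1 glt; rewrite E E1.
Qed.

(** Clamping y at 0 gives one formula for 1 - H valid on the whole line, with no case split in the
    proof of continuity. Restricting to z > 0 makes the integrand tend to 0 at every z as y
    grows. *)
Let survival (y z : R) : R :=
  \1_[set z | 0 < z] z * expR (- (8^-1 * Num.max y 0 * z ^+ 2)).

Let bounded_survival y : bounded_mfun (survival y).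
Proof.
apply: bounded_mfunM; first by apply: bounded_mfun_indic; exact: measurable_gt.
apply: bounded_mfun_expR => [|z].
  by apply: measurableT_comp => //; apply: measurable_funM => //; exact: measurable_funX.
by rewrite oppr_le0 mulr_ge0 ?sqr_ge0// mulr_ge0 ?invr_ge0// le_max lexx orbT.
Qed.

Let survival_itv y z : 0 <= survival y z <= 1.
Proof.
rewrite /survival indicE; case: (_ \in _); rewrite ?mul0r ?lexx ?ler01//= mul1r.
rewrite expR_ge0 expR_le1 oppr_le0 mulr_ge0 ?sqr_ge0// mulr_ge0 ?invr_ge0//.
by rewrite le_max lexx orbT.
Qed.

Lemma HmixE y : Hmix G y = 1 - \int[G]_z survival y z.
Proof.
have [y0|y0] := leP 0 y; last first.
  rewrite /Hmix leNgt y0/=.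
  rewrite [X in _ - X](_ : _ = \int[G]_z \1_[set z | 0 < z] z).
    by rewrite mean_indic ?stable_law_gt0 ?subrr//; exact: measurable_gt.
  apply: eq_Rintegral => z _; rewrite /survival max_r ?(ltW y0)// mulr0 mul0r oppr0.
  by rewrite expR0 mulr1.
rewrite /Hmix y0; congr (_ - _).
rewrite (mean_in_positive stable_law_gt0)//.
- by apply: eq_Rintegral => z _; rewrite /survival max_l.
- by move=> z /= z0; rewrite in_itv/= andbT ltW.
apply: bounded_mfun_expR => [|z].
  by apply: measurableT_comp => //; apply: measurable_funM => //; exact: measurable_funX.
by rewrite oppr_le0 mulr_ge0 ?sqr_ge0// mulr_ge0 ?invr_ge0.
Qed.

Lemma Hmix_le0 y : y <= 0 -> Hmix G y = 0.
Proof.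
move=> y0; rewrite HmixE.
rewrite [X in _ - X](_ : _ = \int[G]_z \1_[set z | 0 < z] z).
  by rewrite mean_indic ?stable_law_gt0 ?subrr//; exact: measurable_gt.
apply: eq_Rintegral => z _; rewrite /survival max_r// mulr0 mul0r oppr0.
by rewrite expR0 mulr1.
Qed.

Let survival_cvg (u : nat -> R) (f0 : R -> R) :
  (forall z, survival (u n) z @[n --> \oo] --> f0 z) ->
  Hmix G (u n) @[n --> \oo] --> 1 - \int[G]_z f0 z.
Proof.
move=> uf; under eq_fun do rewrite HmixE.
apply: cvgB; first exact: cvg_cst.
apply: (@mean_bounded_cvg _ _ _ _ _ _ 1) => //.
- by move=> n; case: (bounded_survival (u n)).
- by near=> n => z; have /andP[? ?] := survival_itv (u n) z; rewrite ger0_norm.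
Unshelve. all: end_near. Qed.

Lemma continuous_Hmix : continuous (Hmix G).
Proof.
move=> y; apply/(@cvg_nbhsP _ R^o) => u uy; rewrite HmixE; apply: survival_cvg => z.
apply: cvgM; first exact: cvg_cst.
apply: continuous_cvg; first exact: continuous_expR.
apply: cvgN; apply: cvgM; last exact: cvg_cst.
apply: cvgM; first exact: cvg_cst.
have cm : {for y, continuous (fun x : R => Num.max x 0)}.
  by apply: (@continuous_max R R id (fun=> 0) y); [exact: cvg_id|exact: cvg_cst].
exact: (cvg_comp _ _ uy cm).
Qed.

Lemma Hmix_pinfty : Hmix G y @[y --> +oo] --> (1 : R).
Proof.
apply/cvg_pinftyP => u uoo.
have E0 : \int[G]_z (fun=> 0 : R) z = 0 by rewrite mean_cst.
rewrite -[X in _ --> X]subr0 -E0; apply: survival_cvg => z.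
rewrite /survival indicE; have [z0|z0] := ltP 0 z; last first.
  rewrite memNset/=; last by apply/negP; rewrite -leNgt.
  by under eq_fun do rewrite mul0r; exact: cvg_cst.
rewrite mem_set//=; under eq_fun do rewrite mul1r.
apply: (@cvg_comp _ _ _ (fun n => 8^-1 * Num.max (u n) 0 * z ^+ 2)
  (fun x => expR (- x)) _ _ _ _ (@cvgr_expR R)).
apply/cvgryPge => A; have z2 : 0 < z ^+ 2 by exact: exprn_gt0.
have : \forall n \near \oo, 8 * (A / z ^+ 2) <= u n by move/cvgryPge : uoo; exact.
apply: filterS => n h; rewrite -ler_pdivrMr//.
have : u n <= Num.max (u n) 0 by rewrite le_max lexx.
by lra.
Qed.

Lemma Hmix_ninfty : Hmix G y @[y --> -oo] --> (0 : R).
Proof.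
apply: cvg_near_cst; near=> y; apply: Hmix_le0; near: y.
exact: nbhs_ninfty_le.
Unshelve. all: end_near. Qed.

Lemma mixing_law_exists : exists H : probability R R,
  [/\ atomless H, law_fun H =1 Hmix G, fine (H [set z | 0 < z]) = 1 &
    forall (D : set R) (f : R -> R), measurable D -> measurable_fun setT f ->
      (forall x, 0 <= f x) ->
      \int[lebesgue_stieltjes_measure (Hmix G)]_(x in D) f x = \int[H]_(x in D) f x].
Proof.
have [H [aH HE HI]] := stieltjes_law Hmix_ninfty Hmix_pinfty continuous_Hmix.
by exists H; split => //; rewrite prob_gtE// HE [X in _ - X](Hmix_le0 (lexx 0)) subr0.
Qed.

End mixing_law.

Section mixture_law.
Context {R : realType}.
Variables (mu sigma : R) (H : probability R R).
Hypotheses (sigma_gt0 : 0 < sigma) (H_gt0 : fine (H [set z | 0 < z]) = 1).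

(** The conditional probability of [A] given V = z. *)
Let slice (A : set R) (z : R) : R := \int[gauss R]_y \1_A (mixture_map mu sigma (z, y)).

Let bounded_slice A : measurable A -> bounded_mfun (slice A).
Proof.
move=> mA; pose k (p : R * R) := \1_A (mixture_map mu sigma p) : R.
apply: (@bounded_mfun_mean _ _ _ _ _ (gauss R) (gauss R) k).
apply: (bounded_mfun_comp (bounded_mfun_indic mA)).
exact: measurable_mixture_map.
Qed.

Let slice_gt0 A z : measurable A -> 0 < z ->
  slice A z = fine (gauss R [set y | A (mu * z + sigma * Num.sqrt z * y)]).
Proof.
move=> mA z0; rewrite -mean_indic; last first.
  rewrite -[X in measurable X]setTI.
  have : measurable_fun setT (fun y : R => mu * z + sigma * Num.sqrt z * y).
    by apply: measurable_funD => //; exact: measurable_funM.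
  by apply.
apply: eq_Rintegral => y _.
by rewrite !indicE /mixture_map /= pos_part_id ?(ltW z0).
Qed.

Let mean_slice (A : set R) (f : R -> R) : measurable A ->
  (forall z, 0 < z -> slice A z = f z) ->
  fine (mixture mu sigma H A) = \int[H]_z (\1_[set z | 0 < z] z * f z).
Proof.
move=> mA fE; rewrite -(mean_indic _ mA) mean_mixture; last exact: bounded_mfun_indic.
rewrite (mean_positive H_gt0 (bounded_slice mA)); apply: eq_Rintegral => z _.
rewrite indicE; have [z0|z0] := ltP 0 z; first by rewrite fE.
by rewrite memNset ?mul0r//=; apply/negP; rewrite -leNgt.
Qed.

Let slice_lt x z : 0 < z ->
  slice [set y | y < x] z = Phi ((x - mu * z) / (sigma * Num.sqrt z)).
Proof.
move=> z0; rewrite slice_gt0//; last exact: measurable_lt.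
rewrite PhiE /law_fun; congr (fine (gauss R _)); apply/seteqP; split => y /=;
  by rewrite ltr_pdivlMr ?mulr_gt0 ?sqrtr_gt0// ltrBrDl (mulrC y).
Qed.

(** Given V = z > 0 the law is a nondegenerate normal one, and [H] charges only such z. *)
Lemma mixture_atomless : atomless (mixture mu sigma H).
Proof.
move=> x; rewrite -[LHS]fineK ?fin_num_measure//; congr EFin.
rewrite (@mean_slice _ (fun=> 0)) => [||z z0]; last 2 first.
- exact: measurable_set1.
- rewrite (slice_gt0 (measurable_set1 x) z0).
  rewrite (_ : [set y | _] = [set (x - mu * z) / (sigma * Num.sqrt z)]).
    by rewrite atomless_fine//; exact: gauss_atomless.
  have sz : sigma * Num.sqrt z != 0 by rewrite gt_eqF// mulr_gt0 ?sqrtr_gt0.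
  apply/seteqP; split => y /=.
    by move=> <-; rewrite addrAC subrr add0r mulrC mulKf.
  by move=> ->; rewrite mulrCA mulfV// mulr1 addrC subrK.
by under eq_Rintegral do rewrite mulr0; rewrite mean_cst.
Qed.

Lemma weibull_IIE (G : probability R R) x :
  (forall (D : set R) (f : R -> R), measurable D -> measurable_fun setT f ->
    (forall x, 0 <= f x) ->
    \int[lebesgue_stieltjes_measure (Hmix G)]_(x in D) f x = \int[H]_(x in D) f x) ->
  weibull_II G mu sigma x = law_fun (mixture mu sigma H) x.
Proof.
move=> HI; have ml := measurable_lt x; have bs := bounded_slice ml.
rewrite /law_fun (mean_slice ml (f := slice [set y | y < x]))// /weibull_II.
rewrite -(mean_in_positive H_gt0 (D := `]0, +oo[%classic))//; last first.
  by move=> z /= z0; rewrite in_itv/= andbT.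
rewrite -HI//; last 2 first.
- by case: bs.
- by move=> z; apply: mean_ge0 => y; rewrite indicE.
by apply: eq_Rintegral => z; rewrite inE/= in_itv/= andbT => z0; rewrite slice_lt.
Qed.

End mixture_law.

Lemma cvg_sub0l {R : realType} (a b : nat -> R) (l : R) :
  a n @[n --> \oo] --> l -> a n - b n @[n --> \oo] --> 0 -> b n @[n --> \oo] --> l.
Proof.
move=> al ab; have E n : b n = a n - (a n - b n) by ring.
by rewrite -[l]subr0; under eq_fun do rewrite E; exact: cvgB.
Qed.

Theorem theorem4 (R : realType) (d : measure_display) (T : measurableType d)
    (P : probability T R)
    (gamma : R) (gamma_gt0 : 0 < gamma) (gamma_le1 : gamma <= 1)
    (G : probability R R) (hG : one_sided_stable_law gamma G)
    (X : nat -> nat -> {RV P >-> R}) (N : nat -> {RV P >-> nat})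
    (X_iid : forall n, iid (X n))
    (NX_indep : forall n, mutually_independent P (sigma_family (N n) (X n)))
    (k : nat -> nat) (mu sigma : R) (sigma_gt0 : 0 < sigma)
    (S_normal : weakly_cvg
       (fun n => dist_fun P (partial_sum (X n) (k n)))
       (fun x => Phi ((x - mu) / sigma)))
    (N_infty : cvg_infty_in_prob N) :
  weakly_cvg
    (fun n => dist_fun P (fun w => partial_sum (X n) (N n w) w))
    (weibull_II G mu sigma)
  <->
  weakly_cvg
    (fun n x => fine (P [set w | (N n w)%:R < x * (k n)%:R]))
    (Hmix G).
Proof.
have S_cvg x : law_fun (sum_law (X n) (k n)) x @[n --> \oo] --> law_fun (normal_law mu sigma) x.
  have E y : Phi ((y - mu) / sigma) = law_fun (normal_law mu sigma) y by rewrite law_fun_normal.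
  rewrite -E; apply: S_normal; rewrite (funext E).
  exact: law_fun_continuous (normal_law_atomless mu sigma_gt0) x.
have re_lim t : cf_re (sum_law (X n) (k n)) t @[n --> \oo] -->
    expR (- (2^-1 * (sigma * t) ^+ 2)) * cos (mu * t).
  by rewrite -cf_re_normal; exact: law_fun_cvg_cf_re.
have im_lim t : cf_im (sum_law (X n) (k n)) t @[n --> \oo] -->
    expR (- (2^-1 * (sigma * t) ^+ 2)) * sin (mu * t).
  by rewrite -cf_im_normal; exact: law_fun_cvg_cf_im.
have k_gt0 : \forall n \near \oo, (0 < k n)%N.
  exact: (norming_gt0 X_iid NX_indep sigma_gt0 re_lim im_lim).
have [H [aH HE H_gt0 HI]] := mixing_law_exists gamma_le1 hG.
have aM := mixture_atomless mu sigma_gt0 H_gt0.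
have WE x : weibull_II G mu sigma x = law_fun (mixture mu sigma H) x.
  exact: weibull_IIE.
split => cvgS.
(* From the sums to the counts. The limit has no atoms, so weak convergence holds at every point, as
   the Lipschitz test functions behind [cre] and [cim] require. *)
- have {}cvgS x : law_fun (random_sum_law (X n) (N n)) x @[n --> \oo] -->
      law_fun (mixture mu sigma H) x.
    rewrite -WE; apply: cvgS; rewrite (funext WE).
    exact: law_fun_continuous aM x.
  have cre := law_fun_cvg_cf_re cvgS.
  have cim := law_fun_cvg_cf_im cvgS.
  have tc := tight_counts_of_cvg X_iid NX_indep sigma_gt0 re_lim im_lim cre cim.
  have koo := tight_counts_infty N_infty tc.
  have tr := cf_transfer X_iid NX_indep re_lim im_lim koo tc.
  have mre t : cf_re (mixture mu sigma (ratio_law N k n)) t @[n --> \oo] -->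
      cf_re (mixture mu sigma H) t.
    by have [h _] := tr t; exact: cvg_sub0l (@cre t) h.
  have mim t : cf_im (mixture mu sigma (ratio_law N k n)) t @[n --> \oo] -->
      cf_im (mixture mu sigma H) t.
    by have [_ h] := tr t; exact: cvg_sub0l (@cim t) h.
  (* Counts are nonnegative, so both sides vanish for [x <= 0]; [mixture_cf_cvg_law_fun] covers the
     positive points. *)
  move=> x _; have [x0|x0] := ltP 0 x; last first.
    rewrite (Hmix_le0 gamma_le1 hG x0).
    have E n : fine (P [set w | (N n w)%:R < x * (k n)%:R]) = 0.
      rewrite (_ : [set w | _] = set0) ?measure0//.
      apply/seteqP; split => // w /=; apply/negP; rewrite -leNgt.
      by rewrite (@le_trans _ _ 0)// mulr_le0_ge0.
    by under eq_fun do rewrite E; exact: cvg_cst.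
  rewrite -HE.
  apply: (@cvg_trans _ (law_fun (ratio_law N k n) x @[n --> \oo])).
    by apply: near_eq_cvg; apply: filterS k_gt0 => n k0; rewrite ratio_law_fun.
  apply: (mixture_cf_cvg_law_fun sigma_gt0 aH mre mim) => // e e0.
  have [M HM] := tc e e0; exists M; near=> n.
  by rewrite ratio_law_tail//; near: n.
(* From the counts to the sums. The two distribution functions agree only once [k n] is positive. *)
- have {}cvgS x : law_fun (ratio_law N k n) x @[n --> \oo] --> law_fun H x.
    apply: (@cvg_trans _ (fine (P [set w | (N n w)%:R < x * (k n)%:R]) @[n --> \oo])).
      by apply: near_eq_cvg; apply: filterS k_gt0 => n k0; rewrite ratio_law_fun.
    by rewrite HE; apply: cvgS; exact: continuous_Hmix gamma_le1 hG x.
  (* Convergence at one far point [M%:R] already bounds the tails of the ratios. *)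
  have tc : tight_counts N k.
    move=> e e0; have e2 : 0 < e / 2 by rewrite divr_gt0.
    have [M HM _] := law_fun_ge1B H e2.
    exists M; move/cvgrPdist_le : (cvgS M%:R) => /(_ _ e2) hM; near=> n.
    have k0 : (0 < k n)%N by near: n.
    have /ler_normlP[_ h] : `|law_fun H M%:R - law_fun (ratio_law N k n) M%:R| <= e / 2.
      by near: n.
    rewrite -ratio_law_tail//.
    have : fine (ratio_law N k n [set z | M%:R < z]) <= 1 - law_fun (ratio_law N k n) M%:R.
      rewrite /law_fun -probC; last exact: measurable_lt.
      apply: prob_le; [exact: measurable_gt|by apply: measurableC; exact: measurable_lt|].
      by move=> z /= /ltW Mz; apply/negP; rewrite -leNgt.
    by lra.
  have koo := tight_counts_infty N_infty tc.
  have tr := cf_transfer X_iid NX_indep re_lim im_lim koo tc.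
  have mcf := mixture_cvg_cf mu sigma cvgS.
  have cre t : cf_re (random_sum_law (X n) (N n)) t @[n --> \oo] -->
      cf_re (mixture mu sigma H) t.
    have [h _] := tr t; have [h' _] := mcf t; exact: (cvg_sub0 h h').
  have cim t : cf_im (random_sum_law (X n) (N n)) t @[n --> \oo] -->
      cf_im (mixture mu sigma H) t.
    have [_ h] := tr t; have [_ h'] := mcf t; exact: (cvg_sub0 h h').
  by move=> x _; rewrite WE; exact: (@continuity_theorem _ _ _ cre cim x aM).
Unshelve. all: end_near. Qed.
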